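(* Let $\mu_0>0$, $A>0$, $\gamma>1$. Let $H_1=\kappa$ be a constant parameter satisfying $\kappa^2\ll\min\{\mu_0^{-1}A\gamma,1\}$, and let $\delta>0$ be sufficiently small. Consider the planar MHD system $\partial_t\Phi+\mathcal A(\Phi)\partial_x\Phi=0$ for $|\Phi|\le 2\delta\ll1$. Put $w_i:=l_i\,\partial_x\Phi$, let $\rho_i:=\partial_{z_i}X_i$ be the inverse density of the $i$-th characteristics, $v_i:=\rho_iw_i$, and $\partial_{s_i}:=\partial_t+\lambda_i\partial_x$. Then the system can be rewritten, for $i=1,\dots,7$, as $$\partial_{s_i}\rho_i=c_{ii}^iv_i+\Big(\sum_{m\ne i}c_{im}^iw_m\Big)\rho_i,$$ $$\partial_{s_i}w_i=-c_{ii}^iw_i^2+\Big(\sum_{m\neq i}(-c_{im}^i+\gamma_{im}^i)w_m\Big)w_i+\sum_{m\ne i,\,k\neq i,\,m\neq k}\gamma_{km}^iw_kw_m,$$ $$\partial_{s_i}v_i=\Big(\sum_{m\ne i}\gamma_{im}^iw_m\Big)v_i+\sum_{m\ne i,\,k\neq i,\,m\neq k}\gamma_{km}^iw_kw_m\,\rho_i .$$ The coefficients $c^i_{ii},c^i_{im},\gamma^i_{im},\gamma^i_{km}$, which are functions of $\Phi$, are all of order $1$: there is a uniform constant $C$ with $$\max_{i,k,m}\ \sup_{|\Phi|\le2\delta}\{|c^i_{ii}|,|c^i_{im}|,|\gamma^i_{im}|,|\gamma^i_{km}|\}\le C.$$ In addition the coefficients have the following structure: (a) $c_{22}^2=c_{44}^4=c_{66}^6=0$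 (no $v_i$ term in the $\rho_i$-equation and no $w_i^2$ term in the $w_i$-equation for $i=2,4,6$), while for $i=1,3,5,7$ the $v_i$ term in the $\rho_i$-equation and the $w_i^2$ term in the $w_i$-equation are retained, with $O(1)$ coefficients; (b) $c^3_{32}=0$ and $c^5_{56}=0$ (no $\rho_3w_2$ term in the $\rho_3$-equation and no $\rho_5w_6$ term in the $\rho_5$-equation), whereas the terms $\rho_2w_3$ in the $\rho_2$-equation, $\rho_6w_5$ in the $\rho_6$-equation, $w_2w_3$ in the $w_2$-equation and $w_5w_6$ in the $w_6$-equation enter as strong interaction terms, with $O(1)$ coefficients for which no small factor $\lambda_2-\lambda_3$ or $\lambda_5-\lambda_6$ is asserted; (c) $\gamma^i_{23},\gamma^i_{32}=O(\lambda_2-\lambda_3)$ for every $i\notin\{2,3\}$, and $\gamma^i_{56},\gamma^i_{65}=O(\lambda_5-\lambda_6)$ for every $i\notin\{5,6\}$ (weak interaction terms); (d) $\gamma^2_{23}=O(\lambda_2-\lambda_3)$, $\gamma^3_{32}=O(\lambda_2-\lambda_3)$, $\gamma^5_{56}=O(\lambda_5-\lambda_6)$, $\gamma^6_{65}=O(\lambda_5-\lambda_6)$ (so the $v_2w_3$, $v_3w_2$, $v_5w_6$, $v_6w_5$ terms in the equations for $v_2,v_3,v_5,v_6$ are weak); consequently the coefficient $-c_{32}^3+\gamma_{32}^3$ of $w_2w_3$ in the $w_3$-equation is $O(\lambda_2-\lambda_3)$ and the coefficient $-c_{56}^5+\gamma_{56}^5$ of $w_5w_6$ in the $w_5$-equation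 is $O(\lambda_5-\lambda_6)$. All other terms of the displayed system occur with $O(1)$ coefficients.
   Context: **Planar MHD system.** $\Phi=(u_1,u_2,u_3,\varrho-1,H_2,H_3,S)^T$ is a function of $(x,t)\in\mathbb R\times[0,T)$; $H_1\equiv\kappa$ is a constant; $p=Ae^S\varrho^\gamma$ and $c=\sqrt{\partial_\varrho p}$. The planar-symmetric 3D ideal compressible MHD equations are $\varrho\partial_tu_1+\varrho u_1\partial_xu_1+c^2\partial_x\varrho+\partial_Sp\,\partial_xS+\mu_0H_2\partial_xH_2+\mu_0H_3\partial_xH_3=0$; $\varrho\partial_tu_j+\varrho u_1\partial_xu_j-\mu_0\kappa\,\partial_xH_j=0$ $(j=2,3)$; $\partial_t\varrho+u_1\partial_x\varrho+\varrho\partial_xu_1=0$; $\partial_tH_j+u_1\partial_xH_j-\kappa\,\partial_xu_j+H_j\partial_xu_1=0$ $(j=2,3)$; $\partial_tS+u_1\partial_xS=0$. Written as $\partial_t\Phi+\mathcal A(\Phi)\partial_x\Phi=0$ this defines the $7\times7$ matrix $\mathcal A(\Phi)$. **Eigenvalues.** $\lambda_1=u_1+C_f$, $\lambda_2=u_1+C_a$, $\lambda_3=u_1+C_s$, $\lambda_4=u_1$, $\lambda_5=u_1-C_s$, $\lambda_6=u_1-C_a$, $\lambda_7=u_1-C_f$, where $C_a=\sqrt{\mu_0/\varrho}\,|\kappa|$ and, with $b=\frac{\mu_0}{\varrho}(\kappa^2+H_2^2+H_3^2)+c^2$, $C_f^2=\frac12\big(b+\sqrt{b^2-4\mu_0\kappa^2c^2/\varrho}\big)$,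 $C_s^2=\frac12\big(b-\sqrt{b^2-4\mu_0\kappa^2c^2/\varrho}\big)$, $C_f,C_s\ge0$. For $\kappa\neq0$ one has $\lambda_7<\lambda_6\le\lambda_5<\lambda_4<\lambda_3\le\lambda_2<\lambda_1$, with equalities exactly when $H_2^2+H_3^2=0$, so the system is not strictly hyperbolic. **Right eigenvectors, $\kappa\ne0$.** For $K>0$ put $R_\pm(K)=\big(\tfrac{C_a^2}{K}-K,\ \tfrac{C_a^2H_2}{K\kappa},\ \tfrac{C_a^2H_3}{K\kappa},\ \pm\varrho(\tfrac{C_a^2}{K^2}-1),\ \mp H_2,\ \mp H_3,\ 0\big)^T$. Then $r_1=R_+(C_f)$, $r_3=R_+(C_s)$, $r_5=R_-(C_s)$, $r_7=R_-(C_f)$, $r_2=(0,\tfrac{C_aH_3}{\kappa},-\tfrac{C_aH_2}{\kappa},0,-H_3,H_2,0)^T$, $r_4=(0,0,0,-\tfrac{\varrho}{\gamma},0,0,1)^T$, $r_6=(0,\tfrac{C_aH_3}{\kappa},-\tfrac{C_aH_2}{\kappa},0,H_3,-H_2,0)^T$. **Right eigenvectors, $\kappa=0$** (then $C_a=C_s=0$, $C_f=\{\frac{\mu_0}{\varrho}(H_2^2+H_3^2)+c^2\}^{1/2}$, $\lambda_2=\dots=\lambda_6=u_1$): $r_1=(-1,0,0,-\varrho/C_f,-H_2/C_f,-H_3/C_f,0)^T$, $r_2=e_2$, $r_3=e_3$ (standard basis vectors), $r_4=(0,0,0,-\partial_Sp/c^2,0,0,1)^T$, $r_5=(0,0,0,-\mu_0H_2/c^2,1,0,0)^T$,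 $r_6=(0,0,0,-\mu_0H_3/c^2,0,1,0)^T$, $r_7=(-1,0,0,\varrho/C_f,H_2/C_f,H_3/C_f,0)^T$. **Left eigenvectors** $l_i$: dual to the right ones, $l_ir_j=\delta_{ij}$. For $\kappa\ne0$ the 2nd, 3rd, 5th and 6th components of $l_i$, $i\ne4$, contain the potentially singular factor $1/(H_2^2+H_3^2)$; part of the assertion is that this factor cancels in all the coefficients. **Coefficients** ($\nabla_\Phi r_k\cdot r_m$ denotes the derivative of $r_k$ in direction $r_m$): $c_{im}^i=\nabla_\Phi\lambda_i\cdot r_m$ (all $i,m$); $\gamma_{im}^i=-(\lambda_i-\lambda_m)\,l_i\cdot(\nabla_\Phi r_i\cdot r_m-\nabla_\Phi r_m\cdot r_i)$ for $m\ne i$; $\gamma_{km}^i=-(\lambda_k-\lambda_m)\,l_i\cdot(\nabla_\Phi r_k\cdot r_m)$ for $k\neq i$, $m\ne i$. **Characteristics.** $X_i(z_i,t)$ solves $\partial_tX_i=\lambda_i(\Phi(X_i,t))$, $X_i(z_i,0)=z_i$. *)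

(* Defs.v *)
From HB Require Import structures.
From mathcomp Require Import all_boot all_order all_algebra.
From mathcomp Require Import all_classical all_reals all_analysis.
Set Implicit Arguments.
Unset Strict Implicit.
Unset Printing Implicit Defensive.
Import Order.TTheory GRing.Theory Num.Theory.
Import numFieldNormedType.Exports.
Local Open Scope classical_set_scope.
Local Open Scope ring_scope.

(* [ix k] is the k-th index in 1-based numbering, so that components, wave
   families and coefficients carry their usual numbers 1, ..., 7. *)
Definition ix (k : nat) : 'I_7 := inord k.-1.

Section state.
Variable R : realType.
Implicit Type Phi : 'cV[R]_7.

Definition vec7 (a1 a2 a3 a4 a5 a6 a7 : R) : 'cV[R]_7 :=
  \col_(j < 7) [:: a1; a2; a3; a4; a5; a6; a7]`_j.

(* The library norm on matrices is the sup norm. *)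
Definition enorm Phi : R := Num.sqrt (\sum_j Phi j 0 ^+ 2).

(* Phi = (u1, u2, u3, dens - 1, H2, H3, entropy)^T *)
Definition u1 Phi : R := Phi (ix 1) 0.
Definition dens Phi : R := Phi (ix 4) 0 + 1.
Definition H2 Phi : R := Phi (ix 5) 0.
Definition H3 Phi : R := Phi (ix 6) 0.
Definition entropy Phi : R := Phi (ix 7) 0.

End state.

Section planar_mhd.
Variables (R : realType) (mu0 A gamma kappa : R).
Implicit Type Phi : 'cV[R]_7.

Definition pressure (rho s : R) : R := A * expR s * rho `^ gamma.

Definition dp_dens Phi : R := derive1 (fun rho => pressure rho (entropy Phi)) (dens Phi).
Definition dp_S Phi : R := derive1 (fun s => pressure (dens Phi) s) (entropy Phi).
Definition sound Phi : R := Num.sqrt (dp_dens Phi).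

(* Each momentum equation has been divided by the density. *)
Definition mhd_matrix Phi : 'M[R]_7 :=
  let u := u1 Phi in let rho := dens Phi in
  let h2 := H2 Phi in let h3 := H3 Phi in
  let c2 := sound Phi ^+ 2 in
  \matrix_(i < 7, j < 7)
    (nth [::]
    [:: [:: u;  0; 0; c2 / rho; mu0 * h2 / rho; mu0 * h3 / rho; dp_S Phi / rho];
        [:: 0;  u; 0; 0; - (mu0 * kappa / rho); 0; 0];
        [:: 0;  0; u; 0; 0; - (mu0 * kappa / rho); 0];
        [:: rho; 0; 0; u; 0; 0; 0];
        [:: h2; - kappa; 0; 0; u; 0; 0];
        [:: h3; 0; - kappa; 0; 0; u; 0];
        [:: 0; 0; 0; 0; 0; 0; u]] i)`_j.

Definition Ca Phi : R := Num.sqrt (mu0 / dens Phi) * `|kappa|.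
Definition bquad Phi : R :=
  mu0 / dens Phi * (kappa ^+ 2 + H2 Phi ^+ 2 + H3 Phi ^+ 2) + sound Phi ^+ 2.
Definition discr Phi : R :=
  bquad Phi ^+ 2 - 4 * mu0 * kappa ^+ 2 * sound Phi ^+ 2 / dens Phi.
Definition Cf Phi : R :=
  Num.sqrt (2^-1 * (bquad Phi + Num.sqrt (discr Phi))).
Definition Cs Phi : R :=
  Num.sqrt (2^-1 * (bquad Phi - Num.sqrt (discr Phi))).

Definition lambda (i : 'I_7) Phi : R :=
  [:: u1 Phi + Cf Phi; u1 Phi + Ca Phi; u1 Phi + Cs Phi; u1 Phi;
      u1 Phi - Cs Phi; u1 Phi - Ca Phi; u1 Phi - Cf Phi]`_i.

(* [Rpm 1 K] and [Rpm (-1) K] are the vectors R_+(K) and R_-(K). *)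
Definition Rpm (sg K : R) Phi : 'cV[R]_7 :=
  vec7 (Ca Phi ^+ 2 / K - K)
       (Ca Phi ^+ 2 * H2 Phi / (K * kappa))
       (Ca Phi ^+ 2 * H3 Phi / (K * kappa))
       (sg * (dens Phi * (Ca Phi ^+ 2 / K ^+ 2 - 1)))
       (- (sg * H2 Phi)) (- (sg * H3 Phi)) 0.

Definition r_magnetic (i : 'I_7) Phi : 'cV[R]_7 :=
  [:: Rpm 1 (Cf Phi) Phi;
      vec7 0 (Ca Phi * H3 Phi / kappa) (- (Ca Phi * H2 Phi / kappa))
           0 (- H3 Phi) (H2 Phi) 0;
      Rpm 1 (Cs Phi) Phi;
      vec7 0 0 0 (- (dens Phi / gamma)) 0 0 1;
      Rpm (-1) (Cs Phi) Phi;
      vec7 0 (Ca Phi * H3 Phi / kappa) (- (Ca Phi * H2 Phi / kappa))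
           0 (H3 Phi) (- H2 Phi) 0;
      Rpm (-1) (Cf Phi) Phi]`_i.

Definition r_nonmagnetic (i : 'I_7) Phi : 'cV[R]_7 :=
  let c2 := sound Phi ^+ 2 in
  [:: vec7 (-1) 0 0 (- (dens Phi / Cf Phi))
           (- (H2 Phi / Cf Phi)) (- (H3 Phi / Cf Phi)) 0;
      vec7 0 1 0 0 0 0 0;
      vec7 0 0 1 0 0 0 0;
      vec7 0 0 0 (- (dp_S Phi / c2)) 0 0 1;
      vec7 0 0 0 (- (mu0 * H2 Phi / c2)) 1 0 0;
      vec7 0 0 0 (- (mu0 * H3 Phi / c2)) 0 1 0;
      vec7 (-1) 0 0 (dens Phi / Cf Phi) (H2 Phi / Cf Phi) (H3 Phi / Cf Phi) 0]`_i.

Definition reig (i : 'I_7) Phi : 'cV[R]_7 :=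
  if kappa == 0 then r_nonmagnetic i Phi else r_magnetic i Phi.

(* For kappa <> 0 the right eigenvectors 2, 3, 5 and 6 vanish where H2 = H3 = 0, so
   that no dual frame exists there. *)
Definition frame_ok Phi : Prop :=
  kappa = 0 \/ H2 Phi ^+ 2 + H3 Phi ^+ 2 <> 0.

(* The frame dual to [reig]; outside [frame_ok] it is a meaningless value. *)
Definition leig (i : 'I_7) Phi : 'rV[R]_7 :=
  row i (invmx (\matrix_(j < 7, k < 7) reig k Phi j 0)).

Definition Dr (k m : 'I_7) Phi : 'cV[R]_7 := 'D_(reig m Phi) (reig k) Phi.

Definition c_coef (i m : 'I_7) Phi : R := 'D_(reig m Phi) (lambda i) Phi.

(* [gamma_coef i k m] is gamma^i_{km}; it is only meaningful for m != i. *)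
Definition gamma_coef (i k m : 'I_7) Phi : R :=
  if k == i then
    - (lambda i Phi - lambda m Phi) *
      (leig i Phi *m (Dr i m Phi - Dr m i Phi)) 0 0
  else
    - (lambda k Phi - lambda m Phi) * (leig i Phi *m Dr k m Phi) 0 0.

End planar_mhd.

Section calculus.
Variables (R : realType) (V : normedModType R).

(* Derivative at t relative to D: two-sided at interior points of D, one-sided
   at its end points. *)
Definition deriv_within (D : set R) (f : R -> V) (t : R) (d : V) : Prop :=
  (fun s => (s - t)^-1 *: (f s - f t)) @ within D t^' --> d.

Implicit Type f : R -> R -> V.

Definition is_dt (T : R) f (x t : R) (d : V) : Prop :=
  deriv_within `[0, T[ (f x) t d.

Definition is_dx f (x t : R) (d : V) : Prop := is_derive x 1 (f ^~ t) d.

Definition dx f (x t : R) : V := derive1 (f ^~ t) x.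

(* Regularity on the strip R x [0, T[, up to the initial line t = 0. *)
Definition C0_strip (T : R) f : Prop :=
  {within [set p : R * R | 0 <= p.2 < T], continuous (fun p => f p.1 p.2)}.

Definition C1_strip (T : R) f : Prop :=
  C0_strip T f /\
  exists fx ft : R -> R -> V,
    [/\ forall x t, 0 <= t < T -> is_dx f x t (fx x t),
        forall x t, 0 <= t < T -> is_dt T f x t (ft x t),
        C0_strip T fx & C0_strip T ft].

Definition C2_strip (T : R) f : Prop :=
  C0_strip T f /\
  exists fx ft : R -> R -> V,
    [/\ forall x t, 0 <= t < T -> is_dx f x t (fx x t),
        forall x t, 0 <= t < T -> is_dt T f x t (ft x t),
        C1_strip T fx & C1_strip T ft].

End calculus.

Section solutions.
Variables (R : realType) (mu0 A gamma kappa : R).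

Definition mhd_solution (T : R) (Phi : R -> R -> 'cV[R]_7) : Prop :=
  C2_strip T Phi /\
  forall x t, 0 <= t < T ->
    exists2 Phit : 'cV[R]_7, is_dt T Phi x t Phit &
      Phit + mhd_matrix mu0 A gamma kappa (Phi x t) *m dx Phi x t = 0.

Definition characteristics (T : R) (Phi : R -> R -> 'cV[R]_7)
    (X : 'I_7 -> R -> R -> R) : Prop :=
  forall i z, X i z 0 = z /\
    forall t, 0 <= t < T ->
      is_dt T (X i) z t (lambda mu0 A gamma kappa i (Phi (X i z t) t)).

(* (d/dt + lambda_i d/dx) g = d for a field g of the variables (x, t) *)
Definition is_ds (T : R) (Phi : R -> R -> 'cV[R]_7) (i : 'I_7)
    (g : R -> R -> R) (x t d : R) : Prop :=
  exists gt gx : R,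
    [/\ is_dt T g x t gt, is_dx g x t gx &
        gt + lambda mu0 A gamma kappa i (Phi x t) * gx = d].

(* d/ds_i of a quantity carried by the i-th characteristics, that is, a
   function q of (z_i, t).  As X_i moves with speed lambda_i, the operator
   d/dt + lambda_i d/dx is the t-derivative at fixed z_i. *)
Definition is_ds_char (T : R) (q : R -> R -> R) (z t d : R) : Prop :=
  is_dt T q z t d.

Definition w (Phi : R -> R -> 'cV[R]_7) (i : 'I_7) (x t : R) : R :=
  (leig mu0 A gamma kappa i (Phi x t) *m dx Phi x t) 0 0.

Definition inv_density (X : 'I_7 -> R -> R -> R) (i : 'I_7) (z t : R) : R :=
  dx (X i) z t.

Definition v (Phi : R -> R -> 'cV[R]_7) (X : 'I_7 -> R -> R -> R)
    (i : 'I_7) (z t : R) : R :=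
  inv_density X i z t * w Phi i (X i z t) t.

End solutions.

(* Main.v *)
(** The right eigenvectors r_k degenerate where H = (H2, H3) vanishes, but in the frame
    d/du1, H.d/du, H'.d/du, d/drho, H.d/dH, H'.d/dH, d/dS with H' = (H3, -H2) their
    coordinates are smooth and invertible, even at H = 0 and as kappa -> 0, and the
    derivative of each frame field along each other one has constant coefficients in the
    frame. So l_i (Dr_k r_m) is a smooth function of (Phi, |kappa|), in which the factor
    1 / |H|^2 has cancelled, and compactness bounds it uniformly in kappa. As gamma^i_{km}
    carries the factor lambda_k - lambda_m, (c) and (d) follow; (a) and (b) hold because the
    speeds depend on H only through |H|.

    The equation for w_i comes from l_i Phi_t = - lambda_i w_i, differentiated in x, and
    Phi_xt = Phi_tx. The inverse density solves the linear equation
    rho_i' = (d lambda_i / dx) rho_i along the characteristic. *)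
Require Import Defs.
From HB Require Import structures.
From mathcomp Require Import all_boot all_order all_algebra.
From mathcomp Require Import all_classical all_reals all_analysis.
From mathcomp Require Import ring lra.
Set Implicit Arguments.
Unset Strict Implicit.
Unset Printing Implicit Defensive.
Import Order.TTheory GRing.Theory Num.Theory.
Import numFieldNormedType.Exports.
Local Open Scope classical_set_scope.
Local Open Scope ring_scope.

(** * One-sided derivatives *)

(** The bounds must be uniform in kappa, although the eigenvectors contain 1 / kappa and 1 / C_s.
    Hence |kappa| is treated as an extra variable a, and the slow speed is factored as C_s = C_a g
    with g = c / C_f. Then C_a / C_s = 1 / g, and of the quotient |kappa| / kappa only the sign of
    kappa survives. The eigenvectors given for kappa = 0 are not limits of the others, so there are
    three cases: the two signs of kappa with the polar frame, and kappa = 0 with the standard basis.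

    The speeds are smooth in (Phi, a) where the discriminant is positive. At H = 0 it equals (c^2 -
    C_a^2)^2, and the smallness of kappa^2 against A gamma / mu0 serves to keep C_a < c.

    Differentiability of X_i in z is not assumed but proved. The x-derivative of Phi may be
    unbounded on the strip, but the speeds are bounded, so the characteristics starting near z stay
    in a compact set up to any time t < T. All time derivatives are one-sided at t = 0. *)

Section one_sided_derivatives.
Context {R : realType}.

(** Without a quotient the estimate also covers s = t, and increments can be split and bounded term
    by term. *)
Lemma deriv_withinP {V : normedModType R} (D : set R) (f : R -> V) (t : R) (d : V) :
  deriv_within D f t d <->
  forall e, 0 < e -> exists2 r, 0 < r &
    forall s, D s -> `|s - t| < r -> `|f s - f t - (s - t) *: d| <= e * `|s - t|.
Proof.
have E s : s != t ->
  `|d - (s - t)^-1 *: (f s - f t)| = `|s - t|^-1 * `|f s - f t - (s - t) *: d|.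
  move=> st; have st0 : s - t != 0 by rewrite subr_eq0.
  rewrite -normfV -normrZ [in RHS]scalerBr scalerA mulVf // scale1r.
  by rewrite -normrN opprB.
rewrite /deriv_within; split=> [/cvgrPdist_le H e e0|H].
  have := H e e0; rewrite near_withinE /= => -[r /= r0 rH].
  exists r => // s Ds sr; have [->|st] := eqVneq s t.
    by rewrite !subrr scale0r subrr !normr0 mulr0.
  have st0 : 0 < `|s - t| by rewrite normr_gt0 subr_eq0.
  rewrite -ler_pdivrMr // mulrC -E //; apply: rH => //=.
  by rewrite distrC.
apply/cvgrPdist_le => e e0; have [r r0 rH] := H e e0.
rewrite near_withinE; exists r => //= s; rewrite /= distrC => sr st Ds.
rewrite E // ler_pdivrMl ?normr_gt0 ?subr_eq0 // mulrC; exact: rH.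
Qed.

Lemma is_deriveP {V : normedModType R} (f : R -> V) (t : R) (d : V) :
  is_derive t 1 f d <-> deriv_within setT f t d.
Proof.
have E : is_derive t 1 f d <->
    h^-1 *: ((f \o shift t) (h *: 1) - f t) @[h --> 0^'] --> d.
  split=> [[/cvg_ex[l fl]]|fd].
    by rewrite /derive (cvg_lim _ fl) // => <-.
  apply: DeriveDef; first by apply/cvg_ex; exists d.
  exact: cvg_lim fd.
rewrite E deriv_withinP; split=> [/cvgrPdist_le H e e0|H].
  have := H e e0 => -[r /= r0 rH].
  exists r => // s _ sr; have [->|st] := eqVneq s t.
    by rewrite !subrr scale0r subrr !normr0 mulr0.
  have st0 : s - t != 0 by rewrite subr_eq0.
  have := rH (s - t); rewrite /= sub0r normrN => /(_ sr st0).
  rewrite [(s - t) *: 1]mulr1 subrK.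
  rewrite -(ler_pM2l (x := `|s - t|)) ?normr_gt0 //.
  by rewrite -normrZ scalerBr scalerA divff // scale1r distrC mulrC.
apply/cvgrPdist_le => e e0; have [r r0 rH] := H e e0.
exists r => //= h; rewrite /= sub0r normrN => hr h0.
have := rH (h + t) I; rewrite addrK => /(_ hr).
rewrite -(ler_pM2l (x := `|h|^-1)) ?invr_gt0 ?normr_gt0 //.
rewrite mulrCA mulVf ?normr_eq0 // mulr1 -normfV -normrZ scalerBr scalerA.
by rewrite mulVf // scale1r distrC [h *: 1]mulr1.
Qed.

Lemma deriv_within_sub {V : normedModType R} (D E : set R) (f : R -> V) t d :
  D `<=` E -> deriv_within E f t d -> deriv_within D f t d.
Proof.
move=> DE /deriv_withinP H; apply/deriv_withinP => e e0.
by have [r r0 rH] := H e e0; exists r => // s /DE; exact: rH.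
Qed.

Lemma deriv_within_near {V : normedModType R} (D : set R) (f g : R -> V) t d :
  f t = g t -> (\forall s \near t, D s -> f s = g s) ->
  deriv_within D f t d -> deriv_within D g t d.
Proof.
move=> fgt [r r0 rH] /deriv_withinP H; apply/deriv_withinP => e e0.
have [r' r'0 H'] := H e e0; exists (Num.min r r').
  by rewrite lt_min r0.
move=> s Ds; rewrite lt_min => /andP[sr sr'].
by rewrite -fgt -rH ?H' //= distrC.
Qed.

Lemma deriv_within_eq {V : normedModType R} (D : set R) (f g : R -> V) t d :
  f t = g t -> (forall s, D s -> f s = g s) ->
  deriv_within D f t d -> deriv_within D g t d.
Proof. by move=> fgt fg; apply: deriv_within_near => //; exists 1 => /= [|s _ /fg]. Qed.

(* Off D the curve is continued by its tangent line, so that the calculus of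
   two-sided derivatives applies at end points of D. *)
Lemma deriv_within_extend {V : normedModType R} (D : set R) (f : R -> V) t d :
  deriv_within D f t d <->
  exists g : R -> V, [/\ is_derive t 1 g d, g t = f t & forall s, D s -> g s = f s].
Proof.
split=> [/deriv_withinP H|[g [/is_deriveP gd gt gs]]]; last first.
  apply: (@deriv_within_eq _ _ g) => //.
  exact: deriv_within_sub gd.
exists (fun s => if `[< D s >] then f s else f t + (s - t) *: d).
have gt : (if `[< D t >] then f t else f t + (t - t) *: d) = f t.
  by case: asboolP => // _; rewrite subrr scale0r addr0.
split=> //; last by move=> s /asboolP ->.
apply/is_deriveP/deriv_withinP => e e0; have [r r0 rH] := H e e0.
exists r => // s _ sr; rewrite gt; case: asboolP => Ds; first exact: rH.
by rewrite [f t + _]addrC addrK subrr normr0 mulr_ge0 // ltW.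
Qed.

Lemma deriv_within_derive {V : normedModType R} (D : set R) (f : R -> V) t d :
  nbhs t D -> deriv_within D f t d -> is_derive t 1 f d.
Proof.
move=> nD /deriv_within_extend[g [gd gt gs]].
by apply: near_eq_is_derive gd; move: nD; apply: filterS => s /gs.
Qed.

Lemma deriv_within_cvg {V : normedModType R} (D : set R) (f : R -> V) t d :
  deriv_within D f t d -> f @ within D (nbhs t) --> f t.
Proof.
move=> /deriv_within_extend[g [gd gt gs]].
have cg : {for t, continuous g}.
  by apply/differentiable_continuous/derivable1_diffP; case: gd.
rewrite -gt; have: g @ within D (nbhs t) --> g t.
  exact: cvg_within_filter cg.
apply: cvg_trans; apply: near_eq_cvg; rewrite near_withinE.
by exists 1 => //= s _ /gs.
Qed.

Lemma deriv_withinD {V : normedModType R} D (f g : R -> V) t a b :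
  deriv_within D f t a -> deriv_within D g t b ->
  deriv_within D (fun s => f s + g s) t (a + b).
Proof.
move=> /deriv_within_extend[f' [fd ft fs]] /deriv_within_extend[g' [gd gt gs]].
apply/deriv_within_extend; exists (f' + g'); split; first exact: is_deriveD.
  by rewrite fctE ft gt.
by move=> s Ds; rewrite fctE fs ?gs.
Qed.

Lemma deriv_withinN {V : normedModType R} D (f : R -> V) t a :
  deriv_within D f t a -> deriv_within D (fun s => - f s) t (- a).
Proof.
move=> /deriv_within_extend[f' [fd ft fs]].
apply/deriv_within_extend; exists (- f'); split; first exact: is_deriveN.
  by rewrite fctE ft.
by move=> s Ds; rewrite fctE fs.
Qed.

Lemma deriv_withinB {V : normedModType R} D (f g : R -> V) t a b :
  deriv_within D f t a -> deriv_within D g t b ->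
  deriv_within D (fun s => f s - g s) t (a - b).
Proof. by move=> df dg; apply: deriv_withinD => //; exact: deriv_withinN. Qed.

Lemma deriv_withinM D (f g : R -> R) t a b :
  deriv_within D f t a -> deriv_within D g t b ->
  deriv_within D (fun s => f s * g s) t (a * g t + f t * b).
Proof.
move=> /deriv_within_extend[f' [fd ft fs]] /deriv_within_extend[g' [gd gt gs]].
apply/deriv_within_extend; exists (f' * g'); split.
- by apply: is_derive_eq; rewrite ft gt /GRing.scale /= addrC mulrC.
- by rewrite fctE ft gt.
- by move=> s Ds; rewrite fctE fs ?gs.
Qed.

Lemma deriv_within_mx m n D (f : R -> 'M[R]_(m, n)) t (d : 'M[R]_(m, n)) :
  deriv_within D f t d <->
  forall i j, deriv_within D (fun s => f s i j) t (d i j).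
Proof.
have mxle (M : 'M[R]_(m, n)) c : 0 <= c -> (`|M| <= c) = [forall ij, `|M ij.1 ij.2| <= c].
  move=> c0; rewrite [`|M|]mx_normrE; apply/idP/forallP => [H ij|H].
    exact: le_trans (le_bigmax _ _ ij) H.
  exact: bigmax_le.
split=> [/deriv_withinP H i j|H].
  apply/deriv_withinP => e e0; have [r r0 rH] := H e e0; exists r => // s Ds sr.
  have := rH s Ds sr; rewrite mxle; last by rewrite mulr_ge0 // ltW.
  move=> /forallP/(_ (i, j)).
  by rewrite !mxE.
apply/deriv_withinP => e e0.
pose Q (ij : 'I_m * 'I_n) (r : R) := 0 < r /\ forall s, D s -> `|s - t| < r ->
  `|f s ij.1 ij.2 - f t ij.1 ij.2 - (s - t) *: d ij.1 ij.2| <= e * `|s - t|.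
have [r rQ] : {r & forall ij, Q ij (r ij)}.
  apply: choice => ij.
  by have /deriv_withinP/(_ e e0)[r r0 rH] := H ij.1 ij.2; exists r.
exists (\big[Num.min/1]_ij r ij).
  by apply/bigmin_gtP; split=> [|ij _]; [exact: ltr01|case: (rQ ij)].
move=> s Ds /bigmin_gtP[_ sr]; rewrite mxle; last by rewrite mulr_ge0 // ltW.
apply/forallP => ij; have [_ /(_ s Ds (sr ij isT))] := rQ ij.
by rewrite !mxE.
Qed.

Lemma deriv_within_diff {V W : normedModType R} D (g : V -> W) (f : R -> V) t d :
  differentiable g (f t) -> deriv_within D f t d ->
  deriv_within D (g \o f) t ('d g (f t) d).
Proof.
move=> dg /deriv_within_extend[f' [fd ft fs]].
apply/deriv_within_extend; exists (g \o f'); rewrite /= ft; split=> //.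
  have df' : differentiable f' t by apply/derivable1_diffP; case: fd.
  have dg' : differentiable g (f' t) by rewrite ft.
  have dgf : differentiable (g \o f') t by exact: differentiable_comp.
  apply: DeriveDef; first exact: diff_derivable.
  have fd' : 'd f' t 1 = d by rewrite -deriveE //; case: fd.
  by rewrite deriveE // diff_comp //= fd' ft.
by move=> s Ds; rewrite /= fs.
Qed.

Lemma deriv_within_comp D (g f : R -> R) (t d g' : R) :
  is_derive (f t) 1 g g' -> deriv_within D f t d ->
  deriv_within D (g \o f) t (g' * d).
Proof.
move=> [/derivable1_diffP dg <-] df.
suff -> : 'D_1 g (f t) * d = 'd g (f t) d by exact: deriv_within_diff.
by rewrite deriveE // -[d in RHS]mulr1 [RHS]linearZ mulrC.
Qed.

End one_sided_derivatives.

(** * Limits of inverse matrices and differentiation of linear systems *)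

Section matrix_limits.
Context {R : realType} {T : Type} {F : set_system T} {FF : Filter F}.

Lemma cvg_mxP m n (f : T -> 'M[R]_(m, n)) (M : 'M[R]_(m, n)) :
  f @ F --> M <-> forall i j, f x i j @[x --> F] --> M i j.
Proof.
split=> [H i j|H].
  apply: (@continuous_cvg _ _ _ _ _ f (fun N : 'M[R]_(m, n) => N i j)) => //.
  exact/differentiable_continuous/differentiable_coord.
apply/cvgrPdist_le => e e0; near=> x.
rewrite [leLHS]mx_normrE; apply: bigmax_le => [|ij _]; first exact: ltW.
rewrite !mxE; move: ij; near: x; apply: filter_forall => ij.
by have /cvgrPdist_le := H ij.1 ij.2; apply.
Unshelve. all: by end_near. Qed.

Lemma cvg_mulmx m n p (f : T -> 'M[R]_(m, n)) (g : T -> 'M[R]_(n, p))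
    (A : 'M[R]_(m, n)) (B : 'M[R]_(n, p)) :
  f @ F --> A -> g @ F --> B -> f x *m g x @[x --> F] --> A *m B.
Proof.
move=> /cvg_mxP fA /cvg_mxP gB; apply/cvg_mxP => i j.
under eq_fun do rewrite mxE; rewrite mxE.
apply: cvg_big => [|k _]; [exact: add_continuous|exact: cvgM].
Qed.

Lemma cvg_det n (f : T -> 'M[R]_n) (A : 'M[R]_n) :
  f @ F --> A -> \det (f x) @[x --> F] --> \det A.
Proof.
move=> /cvg_mxP fA; apply: cvg_big => [|s _]; [exact: add_continuous|apply: cvgM]; first exact:
  cvg_cst.
by apply: cvg_big => [|i _]; [exact: mul_continuous|exact: fA].
Qed.

(** Cramer's formula: determinant and adjugate are polynomial in the entries, and the determinant
    stays away from 0 near the limit. *)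
Lemma cvg_invmx n (f : T -> 'M[R]_n) (A : 'M[R]_n) :
  A \in unitmx -> f @ F --> A ->
  (\forall x \near F, f x \in unitmx) /\ invmx (f x) @[x --> F] --> invmx A.
Proof.
move=> uA fA; have dA : \det A != 0 by rewrite -unitfE -unitmxE.
have nu : \forall x \near F, f x \in unitmx.
  have := cvg_det fA => /cvgrPdist_lt/(_ `|\det A|).
  rewrite normr_gt0 => /(_ dA); apply: filterS => x.
  by rewrite unitmxE unitfE; apply: contraTneq => ->; rewrite subr0 ltxx.
split=> //; have H : (\det (f x))^-1 *: \adj (f x) @[x --> F] --> invmx A.
  rewrite /invmx uA; apply: cvgZ; first by apply: cvgV => //; exact: cvg_det.
  apply/cvg_mxP => i j; under eq_fun do rewrite mxE; rewrite mxE.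
  apply: cvgM; first exact: cvg_cst.
  apply: cvg_det; apply/cvg_mxP => k l; move/cvg_mxP: fA => fA.
  under eq_fun do rewrite !mxE; rewrite !mxE; exact: fA.
apply: cvg_trans H; apply: near_eq_cvg; near=> x.
by rewrite /invmx (near nu x).
Unshelve. all: by end_near. Qed.

End matrix_limits.

(** The solution z of M z = y satisfies z' = M^-1 (y' - M' z). The difference quotient of z is
    M(s)^-1 applied to a combination of those of y and M, so the inverse need only be continuous.
    With M the matrix of eigenvectors this yields rates of w_i without differentiating l_i. *)
Lemma deriv_within_solve (R : realType) n D (M : R -> 'M[R]_n) (y : R -> 'cV[R]_n)
    t M' y' :
  M t \in unitmx -> deriv_within D M t M' -> deriv_within D y t y' ->
  deriv_within D (fun s => invmx (M s) *m y s) t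
    (invmx (M t) *m (y' - M' *m (invmx (M t) *m y t))).
Proof.
move=> uM dM dy; set w := _ *m y t.
have cM : M @ within D t^' --> M t.
  apply: cvg_trans (deriv_within_cvg dM); apply: cvg_app => A [r r0 rA].
  by exists r => // s sr _; exact: rA.
have [uMs iM] := cvg_invmx uM cM.
have H : invmx (M s) *m ((s - t)^-1 *: (y s - y t) - ((s - t)^-1 *: (M s - M t)) *m w)
  @[s --> within D t^'] --> invmx (M t) *m (y' - M' *m w).
  by apply: cvg_mulmx => //; apply: cvgB => //; apply: cvg_mulmx => //; exact: cvg_cst.
apply: cvg_trans H; apply: near_eq_cvg; apply: filterS uMs => s uMs.
rewrite -scalemxAl -scalerBr -scalemxAr; congr (_ *: _).
rewrite !mulmxBl !mulmxBr mulKmx // {2}/w.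
rewrite [M t *m w]mulmxA mulmxV // mul1mx.
by rewrite opprB addrA subrK.
Qed.

(** * Mean values, chain rule and mixed derivatives on the strip *)

Section strip.
Context {R : realType}.

Lemma C0_stripP {V : normedModType R} (T : R) (f : R -> R -> V) :
  C0_strip T f <->
  forall x t, 0 <= t < T -> forall e, 0 < e -> exists2 r, 0 < r &
    forall y s, 0 <= s < T -> `|y - x| < r -> `|s - t| < r ->
      `|f y s - f x t| <= e.
Proof.
rewrite /C0_strip subspace_continuousP; split=> [H x t tT e e0|H [x t] /= tT].
  have := H (x, t) tT => /cvgrPdistC_le/(_ e e0).
  rewrite near_withinE => -[[A B] [[r r0 rA] [r' r'0 rB]] AB].
  exists (Num.min r r'); first by rewrite lt_min r0.
  move=> y s sT; rewrite !lt_min => /andP[yr _] /andP[_ sr].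
  by apply: (AB (y, s)) => //; split; [apply: rA|apply: rB] => /=; rewrite distrC.
apply/cvgrPdistC_le => e e0; rewrite near_withinE.
have [r r0 rH] := H x t tT e e0.
exists (ball x r, ball t r); first by split; exact: nbhsx_ballx.
by move=> [y s] [/= yr sr] sT; apply: rH; rewrite // distrC.
Qed.

Lemma C0_strip_eq {V : normedModType R} (T : R) (f g : R -> R -> V) :
  (forall x t, 0 <= t < T -> g x t = f x t) -> C0_strip T f -> C0_strip T g.
Proof.
move=> fg /C0_stripP H; apply/C0_stripP => x t tT e e0.
have [r r0 rH] := H x t tT e e0.
by exists r => // y s sT yr sr; rewrite !fg //; exact: rH.
Qed.

Lemma C0_strip_entry m n (T : R) (f : R -> R -> 'M[R]_(m, n)) i j :
  C0_strip T f -> C0_strip T (fun x t => f x t i j).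
Proof.
move=> /C0_stripP H; apply/C0_stripP => y s sT e e0; have [r r0 rH] := H y s sT e e0.
exists r => // y' s' sT' yr sr; apply: le_trans (rH y' s' sT' yr sr).
by rewrite [leRHS]mx_normrE; apply: le_trans (le_bigmax _ _ (i, j)); rewrite !mxE.
Qed.

Lemma MVT_global (f df : R -> R) (a b : R) : (forall x : R, is_derive x 1 f (df x)) ->
  exists2 c, `|c - a| <= `|b - a| & f b - f a = df c * (b - a).
Proof.
move=> fd.
have cf (I : set R) : {within I, continuous f}.
  apply: continuous_subspaceT => x.
  by apply/differentiable_continuous/derivable1_diffP; case: (fd x).
have [ab|ba|->] := ltgtP a b; last by exists b => //; rewrite !subrr mulr0.
- have [c /[!in_itv]/= /andP[ac cb] E] := MVT ab (fun x _ => fd x) (cf _).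
  by exists c => //; rewrite !ger0_norm ?subr_ge0 ?lerD2r ?ltW.
- have [c /[!in_itv]/= /andP[bc ca] E] := MVT ba (fun x _ => fd x) (cf _).
  exists c; last by lra.
  by rewrite !ler0_norm ?subr_le0 ?lerN2 ?lerD2r ?ltW.
Qed.

Lemma nbhs_itvco (T s : R) : 0 < s < T -> nbhs s `[0, T[%classic.
Proof.
move=> sT; apply: filterS (near_in_itvoo _); last first.
- by rewrite /= in_itv /=; exact: sT.
- by move=> y; rewrite /= !in_itv /= => /andP[/ltW -> ->].
Qed.

Lemma deriv_within_continuous (V : normedModType R) (T t : R) (f df : R -> V) : t < T ->
  (forall s, 0 <= s < T -> deriv_within `[0, T[ f s (df s)) ->
  {within `[0, t], continuous f}.
Proof.
move=> tT fd; apply: (@continuous_subspaceW _ _ _ `[0, T[%classic).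
  by move=> s; rewrite /= !in_itv /= => /andP[-> /= /le_lt_trans]; apply.
apply/subspace_continuousP => s; rewrite /= in_itv /= => sT.
exact: deriv_within_cvg (fd s sT).
Qed.

Lemma MVT_within (T a b : R) (f df : R -> R) : 0 <= a -> a < b -> b < T ->
  (forall s, 0 <= s < T -> deriv_within `[0, T[ f s (df s)) ->
  exists2 c, a < c < b & f b - f a = df c * (b - a).
Proof.
move=> a0 ab bT fd.
have [||c] := @MVT _ f df a b ab; last first.
- by rewrite in_itv /= => cab ->; exists c.
- apply: continuous_subspaceW (deriv_within_continuous bT fd) => s.
  by rewrite /= !in_itv /= => /andP[as_ ->]; rewrite andbT (le_trans a0).
- move=> s; rewrite in_itv /= => /andP[as_ sb].
  have sT : 0 < s < T by rewrite (le_lt_trans a0 as_) (lt_trans sb).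
  apply: deriv_within_derive (fd s _); first exact: nbhs_itvco.
  by case/andP: sT => /ltW -> ->.
Qed.

Lemma deriv_within_along (T t x' : R) (X : R -> R) (f fx : R -> R -> R) ft :
  0 <= t < T -> deriv_within `[0, T[ X t x' ->
  (forall x s, 0 <= s < T -> is_dx f x s (fx x s)) -> C0_strip T fx ->
  is_dt T f (X t) t ft ->
  deriv_within `[0, T[ (fun s => f (X s) s) t (ft + x' * fx (X t) t).
Proof.
move=> tT dX dfx /C0_stripP cfx dft; apply/deriv_withinP => e e0.
set a := fx (X t) t.
pose K := `|x'| + 1 + `|a| + 1.
have K0 : 0 < K by rewrite /K; have := normr_ge0 x'; have := normr_ge0 a; lra.
pose e1 := Num.min 1 (e / (2 * K)).
have e10 : 0 < e1 by rewrite lt_min ltr01 /= divr_gt0 // mulr_gt0.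
have e1K : e1 * K <= e / 2.
  have : e1 <= e / (2 * K) by rewrite ge_min lexx orbT.
  move=> /(ler_wpM2r (ltW K0)) /le_trans; apply.
  by rewrite invfM mulrA mulfVK // gt_eqF.
have e11 : e1 <= 1 by rewrite ge_min lexx.
have [r1 r10 H1] := (deriv_withinP _ _ _ _).1 dX e1 e10.
have e2 : 0 < e / 2 by rewrite divr_gt0.
have [r2 r20 H2] := (deriv_withinP _ _ _ _).1 dft _ e2.
have [r3 r30 H3] := cfx (X t) t tT e1 e10.
have [r4 r40 H4] : exists2 r4, 0 < r4 & forall s, `|s - t| < r4 -> (`|x'| + 1) * `|s - t| < r3.
  exists (r3 / (`|x'| + 1)) => [|s]; first by rewrite divr_gt0 // ltr_wpDl.
  by rewrite ltr_pdivlMr ?ltr_wpDl // mulrC.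
exists (Num.min (Num.min r1 r2) (Num.min r3 r4)); first by rewrite !lt_min r10 r20 r30.
move=> s sT; rewrite !lt_min => /andP[/andP[/(H1 s sT) {}H1 /(H2 s sT) {}H2] /andP[s3 /H4 {}H4]].
have sT' : 0 <= s < T by move: sT; rewrite /= in_itv.
have XX : `|X s - X t| <= (`|x'| + 1) * `|s - t|.
  rewrite -(subrK ((s - t) * x') (X s - X t)) (le_trans (ler_normD _ _)) //.
  rewrite normrM [leRHS]mulrDl mul1r addrC [_ * `|x'|]mulrC lerD2l (le_trans H1) //.
  by rewrite -[leRHS]mul1r ler_wpM2r.
have [c cX E] := @MVT_global (f ^~ s) (fx ^~ s) (X t) (X s) (fun y => dfx y s sT').
have Hc : `|fx c s - a| <= e1 by apply: H3 => //; exact: le_lt_trans (le_trans cX XX) H4.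
have -> : f (X s) s - f (X t) t - (s - t) *: (ft + x' * a) =
  (fx c s - a) * (X s - X t) + a * (X s - X t - (s - t) *: x')
   + (f (X t) s - f (X t) t - (s - t) *: ft).
  have -> : f (X s) s = f (X t) s + fx c s * (X s - X t) by rewrite -E; ring.
  by rewrite /GRing.scale /=; ring.
apply: le_trans (ler_normD _ _) _; rewrite [in leRHS](splitr e) [leRHS]mulrDl lerD //.
apply: le_trans (ler_normD _ _) _; rewrite !normrM.
have P1 := ler_pM (normr_ge0 _) (normr_ge0 _) Hc XX.
have P2 := ler_wpM2l (normr_ge0 a) H1.
apply: le_trans (lerD P1 P2) _.
have -> : e1 * ((`|x'| + 1) * `|s - t|) + `|a| * (e1 * `|s - t|) =
  e1 * (`|x'| + 1 + `|a|) * `|s - t| by ring.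
apply: ler_wpM2r => //; apply: le_trans e1K.
by apply: ler_wpM2l; [exact: ltW|rewrite /K lerDl].
Qed.

(* Both mixed derivatives are limits of the same second difference quotient. *)
Lemma mixed_derivatives (T x t : R) (f fx ft fxt ftx : R -> R -> R) :
  0 <= t < T ->
  (forall x t, 0 <= t < T -> is_dx f x t (fx x t)) ->
  (forall x t, 0 <= t < T -> is_dt T f x t (ft x t)) ->
  (forall x t, 0 <= t < T -> is_dt T fx x t (fxt x t)) ->
  (forall x t, 0 <= t < T -> is_dx ft x t (ftx x t)) ->
  C0_strip T fxt -> C0_strip T ftx -> fxt x t = ftx x t.
Proof.
move=> tT dfx dft dfxt dftx /C0_stripP cxt /C0_stripP ctx.
apply/eqP; rewrite -subr_eq0 -normr_le0; apply/ler_addgt0Pl => e e0; rewrite addr0.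
have e2 : 0 < e / 2 by rewrite divr_gt0.
have [r1 r10 H1] := cxt x t tT _ e2; have [r2 r20 H2] := ctx x t tT _ e2.
have [r [r0 rr1 rr2]] : exists r, [/\ 0 < r, r < r1 & r < r2].
  exists (Num.min r1 r2 / 2); split.
  - by rewrite divr_gt0 // lt_min r10.
  - have : Num.min r1 r2 <= r1 by rewrite ge_min lexx.
    lra.
  - have : Num.min r1 r2 <= r2 by rewrite ge_min lexx orbT.
    lra.
have [k [k0 kr kT]] : exists k, [/\ 0 < k, k <= r & t + k < T].
  case/andP: tT => _ tT; exists (Num.min r ((T - t) / 2)); split.
  - rewrite lt_min r0 /=; lra.
  - by rewrite ge_min lexx.
  - have : Num.min r ((T - t) / 2) <= (T - t) / 2 by rewrite ge_min lexx orbT.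
    lra.
case/andP: (tT) => t0 _.
have tkT : 0 <= t + k < T by rewrite kT andbT; lra.
have sT s : t < s < t + k -> 0 <= s < T.
  by move=> /andP[ts sk]; rewrite (le_trans t0 (ltW ts)) (lt_trans sk).
have tk : t < t + k by rewrite ltrDl.
pose Delta y := f y (t + k) - f y t.
have [|xi Hxi E1] := @MVT_global Delta (fun y => fx y (t + k) - fx y t) x (x + r).
  by move=> y; apply: is_deriveB; exact: dfx.
have [tau1 T1 E2] := @MVT_within T t (t + k) _ _ t0 tk kT (dfxt xi).
pose Theta s := f (x + r) s - f x s.
have [|tau2 T2 E3] := @MVT_within T t (t + k) Theta (fun s => ft (x + r) s - ft x s) t0 tk kT.
  by move=> s sT0; apply: deriv_withinB; exact: dft.
have [xi2 Hxi2 E4] := @MVT_global (ft ^~ tau2) (ftx ^~ tau2) x (x + r) (fun y => dftx y _ (sT _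
  T2)).
have : fxt xi tau1 = ftx xi2 tau2.
  have kn : k != 0 by rewrite gt_eqF.
  have rn : r != 0 by rewrite gt_eqF.
  apply: (mulIf kn); apply: (mulIf rn).
  move: E1 E3; rewrite E2 /= E4 /Delta /Theta.
  rewrite [x + r]addrC [t + k]addrC !addrK => E1 E3.
  by rewrite -E1 [RHS]mulrAC -E3; ring.
have {}H1 : `|fxt xi tau1 - fxt x t| <= e / 2.
  case/andP: (T1) => T11 T12; apply: H1; first exact: sT.
    by rewrite (le_lt_trans Hxi) // [x + r]addrC addrK gtr0_norm.
  by rewrite ger0_norm ?subr_ge0 ?ltW //; lra.
have {}H2 : `|ftx xi2 tau2 - ftx x t| <= e / 2.
  case/andP: (T2) => T21 T22; apply: H2; first exact: sT.
    rewrite (le_lt_trans Hxi2) // [x + r]addrC addrK gtr0_norm //.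
  by rewrite ger0_norm ?subr_ge0 ?ltW //; lra.
move=> E; rewrite [e]splitr.
have -> : fxt x t - ftx x t = (ftx xi2 tau2 - ftx x t) - (fxt xi tau1 - fxt x t).
  by rewrite E; ring.
by rewrite (le_trans (ler_normB _ _)) // lerD.
Qed.

End strip.

(** * Characteristic flows *)

Section flow.
Context {R : realType}.

(** E is the exponential of the integral of a from 0. It will be the z-derivative of a
    characteristic, and 1 / E the integrating factor. *)
Lemma exp_antiderivative (a : R -> R) : continuous a ->
  exists E : R -> R, [/\ E 0 = 1, forall t, 0 < E t,
    forall t : R, 0 <= t -> is_derive t 1 E (a t * E t) &
    forall t : R, 0 <= t -> is_derive t 1 (fun s => (E s)^-1) (- a t * (E t)^-1)].
Proof.
move=> ca.
(* The lower limit -1 makes each t >= 0 interior, so the fundamental theorem gives two-sided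
   derivatives there, even at t = 0. *)
pose I t := (\int[lebesgue_measure]_(s in [set` `[(-1), t]]) a s)%R.
have dI (t : R) : 0 <= t -> is_derive t 1 I (a t).
  move=> t0; have tt : t < t + 1 by rewrite ltrDl.
  have ia : lebesgue_measure.-integrable `[(-1), (t + 1)] (EFin \o a).
    apply: continuous_compact_integrable; first exact: segment_compact.
    exact: continuous_subspaceT.
  have t1 : -1 < t by rewrite (lt_le_trans _ t0) // ltrN10.
  have [||dI E] := continuous_FTC1 tt ia; [by []|exact: ca|].
  by apply: DeriveDef; [exact: dI|rewrite -derive1E; exact: E].
exists (fun t => expR (I t - I 0)); split=> [|t|t t0|t t0].
- by rewrite subrr expR0.
- exact: expR_gt0.
- apply/is_deriveP; rewrite mulrC.
  apply: (deriv_within_comp (g := expR) (f := fun s => I s - I 0)).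
  apply/is_deriveP; have dIt := dI t t0.
  by apply: is_derive_eq; rewrite subr0.
- have -> : (fun s => (expR (I s - I 0))^-1) = (fun s => expR (I 0 - I s)).
    by apply/funext => s; rewrite -expRN opprB.
  rewrite -expRN opprB.
  apply/is_deriveP; rewrite mulrC.
  apply: (deriv_within_comp (g := expR) (f := fun s => I 0 - I s)).
  apply/is_deriveP; have dIt := dI t t0.
  by apply: is_derive_eq; rewrite ?add0r ?mul1r.
Qed.

Lemma monotone_within (T : R) (f df : R -> R) :
  (forall s, 0 <= s < T -> deriv_within `[0, T[ f s (df s)) ->
  (forall s, 0 <= s < T -> df s <= 0) ->
  forall s, 0 <= s < T -> f s <= f 0.
Proof.
move=> fd d0 s /andP[s0 sT]; move: s0; rewrite le_eqVlt => /predU1P[<-//|s0].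
have [c /andP[c0 cs] E] := MVT_within (lexx 0) s0 sT fd.
rewrite -subr_le0 E subr0 mulr_le0_ge0 ?(ltW s0) // d0 //.
by rewrite (ltW c0) (lt_trans cs).
Qed.

Lemma norm_le_within (T K : R) (f df : R -> R) : 
  (forall s, 0 <= s < T -> deriv_within `[0, T[ f s (df s)) ->
  (forall s, 0 <= s < T -> `|df s| <= K) ->
  forall s, 0 <= s < T -> `|f s - f 0| <= K * s.
Proof.
move=> fd dK s /andP[s0 sT]; move: s0; rewrite le_eqVlt => /predU1P[<-|s0].
  by rewrite subrr normr0 mulr0.
have [c /andP[c0 cs] E] := MVT_within (lexx 0) s0 sT fd.
rewrite E subr0 normrM (gtr0_norm s0) ler_wpM2r ?(ltW s0) // dK //.
by rewrite (ltW c0) (lt_trans cs).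
Qed.

(** The square is used because |D| need not be differentiable: D^2 exp(- 2 L s) is nonincreasing. *)
Lemma gronwall_within (T L : R) (D dD : R -> R) : 0 <= L ->
  (forall s, 0 <= s < T -> deriv_within `[0, T[ D s (dD s)) ->
  (forall s, 0 <= s < T -> `|dD s| <= L * `|D s|) ->
  forall s, 0 <= s < T -> `|D s| <= `|D 0| * expR (L * s).
Proof.
move=> L0 dd dL s sT.
pose e s := expR (- (2 * L) * s).
have de r : deriv_within `[0, T[ e r (e r * - (2 * L)).
  apply: (@deriv_within_sub _ _ _ setT) => //.
  apply: (deriv_within_comp (g := expR) (f := fun s => - (2 * L) * s)).
  apply/is_deriveP; apply: is_derive_eq.
  by rewrite /GRing.scale /=; ring.
have := @monotone_within T (fun r => D r * D r * e r)
  (fun r => (dD r * D r + D r * dD r) * e r + D r * D r * (e r * - (2 * L))).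
move=> /(_ _ _ s sT) H.
have {H} : D s * D s * e s <= D 0 * D 0 * e 0.
  apply: H => r rT.
    apply: deriv_withinM => //; apply: deriv_withinM; exact: dd.
  have -> : (dD r * D r + D r * dD r) * e r + D r * D r * (e r * - (2 * L)) =
     2 * e r * (dD r * D r - L * (D r * D r)) by ring.
  rewrite pmulr_rle0 ?mulr_gt0 ?expR_gt0 // subr_le0.
  have DD : 0 <= D r * D r by rewrite -expr2 sqr_ge0.
  rewrite (le_trans (ler_norm _)) // -[in leRHS](ger0_norm DD) !normrM mulrA.
  by rewrite ler_wpM2r // dL.
have -> : e 0 = 1 by rewrite /e mulr0 expR0.
have -> : e s = (expR (L * s) ^+ 2)^-1.
  by rewrite /e -expRM_natl -expRN; congr expR; ring.
rewrite mulr1 ler_pdivrMr ?exprn_gt0 ?expR_gt0 // -!expr2 -exprMn => H.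
rewrite -[leRHS]ger0_norm ?mulr_ge0 ?expR_ge0 // normrM normr_id -normrM.
by rewrite -ler_sqrt ?sqr_ge0 // !sqrtr_sqr in H.
Qed.

(** Composed with this projection of time, data known only on the strip become continuous on the
    whole line, as [exp_antiderivative] and the compactness arguments require. *)
Definition clamp (t s : R) : R := Num.max 0 (Num.min s t).

Lemma clamp_id t s : 0 <= s <= t -> clamp t s = s.
Proof. by move=> /andP[s0 st]; rewrite /clamp min_l // max_r. Qed.

Lemma clamp_itv t s : 0 <= t -> 0 <= clamp t s <= t.
Proof.
by move=> t0; rewrite /clamp le_max lexx /= ge_max t0 ge_min lexx orbT.
Qed.

Lemma clamp_lip t s r : `|clamp t s - clamp t r| <= `|s - r|.
Proof.
have := ler_norm (s - r); have := ler_norm (r - s); rewrite (distrC r s).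
rewrite /clamp !minEle !maxEle ler_norml => H1 H2.
by apply/andP; split; do !case: ifPn; rewrite -?ltNge; lra.
Qed.

Lemma continuous_pairing (S U V : topologicalType) (f : S -> U) (g : S -> V) x :
  {for x, continuous f} -> {for x, continuous g} ->
  {for x, continuous (fun y => (f y, g y))}.
Proof. by move=> cf cg; exact: cvg_pair cf cg. Qed.

Section bounded_field.
Variables (T M : R) (F Fx X : R -> R -> R).
Hypothesis dF : forall x t, 0 <= t < T -> is_dx F x t (Fx x t).
Hypothesis cF : C0_strip T Fx.
Hypothesis bF : forall x t, 0 <= t < T -> `|F x t| <= M.
Hypothesis X0 : forall z, X z 0 = z.
Hypothesis dX : forall z t, 0 <= t < T -> is_dt T X z t (F (X z t) t).

Lemma clamped_continuous (t : R) : 0 <= t < T ->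
  continuous (fun p : R * R => Fx p.1 (clamp t p.2)).
Proof.
move=> /andP[t0 tT] [y s]; apply/cvgrPdistC_le => e e0.
have cT r : 0 <= clamp t r < T.
  by have /andP[-> /le_lt_trans->] := clamp_itv r t0.
have [r r0 rH] := (C0_stripP _ _).1 cF y (clamp t s) (cT s) e e0.
exists (ball y r, ball s r); first by split; exact: nbhsx_ballx.
move=> [y' s'] [/= yr sr]; apply: rH => //; first by rewrite distrC.
by rewrite (le_lt_trans (clamp_lip _ _ _)) // distrC.
Qed.

Lemma clamped_path_continuous (z t : R) : 0 <= t < T ->
  continuous (fun s => X z (clamp t s)).
Proof.
move=> /andP[t0 tT] s.
have cT r : 0 <= clamp t r < T.
  by have /andP[-> /le_lt_trans->] := clamp_itv r t0.
have := deriv_within_cvg (@dX z _ (cT s)) => /cvgrPdistC_le H.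
apply/cvgrPdistC_le => e /H; rewrite near_withinE => -[r /= r0 rH].
exists r => //= s' ss'; apply: rH.
  by rewrite /= (le_lt_trans (clamp_lip _ _ _)).
by rewrite /= in_itv /=.
Qed.

(** E solves the linearised equation E' = Fx(X z) E with E(0) = 1. The difference D of two
    characteristics satisfies D' = Fx(c) D with c between them, so D / E changes only through Fx(c)
    - Fx(X z), which is uniformly small on [0, t]. Stopping at t < T makes the time interval
    compact. *)
Lemma flow_upto (z t : R) : 0 < t < T -> exists E : R -> R,
  forall s, 0 <= s < t -> is_derive z 1 (X ^~ s) (E s) /\
    deriv_within `[0, t[ E s (Fx (X z s) s * E s).
Proof.
move=> /andP[t0 tT].
have tT' : 0 <= t < T by rewrite (ltW t0).
have cFt := clamped_continuous tT'; have cXt := @clamped_path_continuous z t tT'.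
pose a s := Fx (X z (clamp t s)) (clamp t s).
have cG : continuous (fun p : R * R => Fx (X z (clamp t p.1) + p.2) (clamp t p.1)).
  have c1 : continuous (fun p : R * R => (X z (clamp t p.1) + p.2, p.1)).
    move=> p; have c2 : {for p, continuous (fst : R * R -> R)} by exact: cvg_fst.
    have c3 : {for p, continuous (fun p : R * R => X z (clamp t p.1))}.
      exact: continuous_comp c2 (cXt _).
    have c4 : {for p, continuous (snd : R * R -> R)} by exact: cvg_snd.
    exact: continuous_pairing (continuousD c3 c4) c2.
  by move=> p; apply: continuous_comp (c1 p) (cFt _).
have ca : continuous a.
  have -> : a = (fun p : R * R => Fx (X z (clamp t p.1) + p.2) (clamp t p.1)) \o (fun s => (s, 0)).
    by apply/funext => s; rewrite /a /= addr0.
  move=> s; apply: continuous_comp; last exact: cG.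
  have c1 : {for s, continuous (cst (0 : R))} by exact: cvg_cst.
  have c2 : {for s, continuous (@id R)} by exact: cvg_id.
  exact: continuous_pairing c2 c1.
have [E [E0 Epos dE dEV]] := exp_antiderivative ca.
have sub s : 0 <= s < t -> 0 <= s < T by move=> /andP[-> /lt_trans->].
have aE s : 0 <= s < t -> a s = Fx (X z s) s.
  by move=> /andP[s0 st]; rewrite /a clamp_id // s0 ltW.
have M0 : 0 <= M by apply: le_trans (@bF 0 _ tT').
have subtT : `[0, t[%classic `<=` `[0, T[.
  by move=> s; rewrite /= !in_itv /=; exact: sub.
have growth y s : 0 <= s < t -> `|X y s - y| <= M * t.
  move=> /[dup] st /andP[s0 /ltW st'].
  have := @norm_le_within T M (X y) (fun r => F (X y r) r) (@dX y) (fun r rT => @bF _ _ rT) s (sub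
    _ st).
  by rewrite X0 => /le_trans; apply; rewrite ler_wpM2l.
(* For |y - z| < 1 the two characteristics differ by at most 2 M t + 1, and X z is within M t of z;
   hence an intermediate point is within 3 M t + 1 of z. *)
pose B := 3 * (M * t + 1).
have Mt : 0 <= M * t by rewrite mulr_ge0 // ltW.
(* [Fx] need not be bounded on the strip; L is its maximum modulus on the compact rectangle that
   contains all points used below. *)
have [L [L0 HL]] : exists L, 0 <= L /\ forall y s, `|y - z| <= B -> 0 <= s < t -> `|Fx y s| <= L.
  have K0 : `[z - B, z + B]%classic `*` `[0, t]%classic !=set0.
    by exists (z, 0); split=> /=; rewrite in_itv /= ?lexx ?(ltW t0) //; apply/andP; split; rewrite
      /B; lra.
  have [||c _ Hc] := @compact_EVT_max _ R (fun p : R * R => `|Fx p.1 (clamp t p.2)|) _ K0.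
  - by apply: compact_setX; exact: segment_compact.
  - apply: continuous_subspaceT => p; apply: (continuous_comp (cFt p)); exact: norm_continuous.
  exists `|Fx c.1 (clamp t c.2)|; split=> // y s yz /andP[s0 st].
  have := Hc (y, s); rewrite /= clamp_id ?s0 ?(ltW st) //; apply.
  rewrite inE /= ; split; rewrite /= in_itv /= ?s0 ?(ltW st) //.
  by move: yz; rewrite ler_norml => /andP[? ?]; apply/andP; split; lra.
pose K := expR (L * t).
have K0 : 0 < K by exact: expR_gt0.
have expK s : 0 <= s < t -> expR (L * s) <= K.
  by move=> /andP[_ /ltW st]; rewrite ler_expR ler_wpM2l.
have zB s : 0 <= s < t -> `|X z s - z| <= B.
  by move=> st; rewrite (le_trans (growth z s st)) // /B; lra.
have dE' s : 0 <= s < t -> deriv_within `[0, t[ E s (a s * E s).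
  by move=> /andP[s0 _]; apply: (@deriv_within_sub _ _ _ setT) => //; apply/is_deriveP/dE.
have dEV' s : 0 <= s < t -> deriv_within `[0, t[ (fun s => (E s)^-1) s (- a s * (E s)^-1).
  by move=> /andP[s0 _]; apply: (@deriv_within_sub _ _ _ setT) => //; apply/is_deriveP/dEV.
have aL s : 0 <= s < t -> `|a s| <= L by move=> st; rewrite aE // HL // zB.
have EK s : 0 <= s < t -> E s <= K.
  move=> st; have := @gronwall_within t L E _ L0 dE' _ s st.
  rewrite E0 normr1 mul1r gtr0_norm // => H; apply: le_trans (expK s st); apply: H => r rt.
  by rewrite normrM ler_wpM2r // aL.
have EVK s : 0 <= s < t -> (E s)^-1 <= K.
  move=> st; have := @gronwall_within t L _ _ L0 dEV' _ s st.
  rewrite E0 invr1 normr1 mul1r gtr0_norm ?invr_gt0 // => H; apply: le_trans (expK s st); apply: H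
    => r rt.
  by rewrite normrM normrN ler_wpM2r // aL.
exists E => s st; split; last by rewrite -aE //; exact: dE'.
apply/is_deriveP/deriv_withinP => e e0.
(* The three factors K bound |D| / |y - z|, 1 / E and E; the factor t comes from integrating in
   time. *)
pose e1 := e / (K * K * K * t).
have e10 : 0 < e1 by rewrite divr_gt0 // !mulr_gt0.
(* Continuity of Fx along the path is made uniform in time by compactness of [0, t]. *)
have [eta eta0 Heta] : exists2 eta, 0 < eta & forall d, `|d| < eta -> forall s, 0 <= s <= t ->
    `|Fx (X z s + d) s - Fx (X z s) s| <= e1.
  have := (@compact_near_coveringP R `[0, t]).1 (@segment_compact _ 0 t) R (nbhs (0 : R))
    (fun d s => `|Fx (X z (clamp t s) + d) (clamp t s) - a s| <= e1) _.
  case=> [r _|eta eta0 Heta].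
    have c1 : {for (r, 0), continuous (fst : R * R -> R)} by exact: cvg_fst.
    have := continuousB (cG (r, 0)) (continuous_comp c1 (ca _)).
    move=> /cvgrPdistC_le/(_ e1 e10); apply: filterS => p /=.
    by rewrite !fctE /= addr0 subrr subr0.
  exists eta => // d dd r rt; have := Heta d; rewrite /= sub0r normrN => /(_ dd r).
  by rewrite /= in_itv /= rt /a clamp_id //; apply.
(* The bound 1 is the one built into B; eta / K keeps |D| below eta, since |D| <= |y - z| K. *)
exists (Num.min 1 (eta / K)); first by rewrite lt_min ltr01 divr_gt0.
move=> y _; rewrite lt_min ltr_pdivlMr // => /andP[y1 yeta].
pose D r := X y r - X z r; pose dD r := F (X y r) r - F (X z r) r.
have dDr r : 0 <= r < t -> deriv_within `[0, t[ D r (dD r).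
  by move=> /sub rT; apply: (deriv_within_sub subtT); apply: deriv_withinB; exact: dX.
have DB r : 0 <= r < t -> `|D r| <= 2 * (M * t) + 1.
  move=> rt; have := growth y r rt; have := growth z r rt; rewrite distrC => H1 H2.
  have -> : D r = (X y r - y) + (y - z) + (z - X z r) by rewrite /D; ring.
  rewrite (le_trans (ler_normD _ _)) // (le_trans (lerD (ler_normD _ _) (lexx _))) //.
  by move: H1 H2 y1; lra.
have mean r : 0 <= r < t -> exists c, [/\ `|c - z| <= B, `|c - X z r| <= `|D r| & dD r = Fx c r * D
  r].
  move=> rt; have [c cD EE] := MVT_global (X z r) (X y r) (fun x => @dF x _ (sub _ rt)).
  exists c; split=> //; have -> : c - z = (c - X z r) + (X z r - z) by ring.
  rewrite (le_trans (ler_normD _ _)) // (le_trans (lerD cD (growth z r rt))) //.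
  by rewrite (le_trans (lerD (DB r rt) (lexx _))) // /B; lra.
have Dh r : 0 <= r < t -> `|D r| <= `|y - z| * K.
  move=> rt; have := @gronwall_within t L D dD L0 dDr _ r rt.
  rewrite /D !X0 => H; apply: (le_trans (H _)); last by rewrite ler_wpM2l // expK.
  move=> r' rt'; have [c [cB _ ->]] := mean r' rt'.
  by rewrite normrM ler_wpM2r // HL.
(* As E' = Fx E along the path from z, the quotient D / E is nearly constant. *)
pose G r := D r * (E r)^-1.
have dG r : 0 <= r < t -> deriv_within `[0, t[ G r (dD r * (E r)^-1 + D r * (- a r * (E r)^-1)).
  by move=> rt; apply: deriv_withinM; [exact: dDr|exact: dEV'].
have := @norm_le_within t (e1 * (`|y - z| * K) * K) G _ dG _ s st.
rewrite {2}/G E0 invr1 mulr1 {2}/D !X0 => H.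
have {H} : `|G s - (y - z)| <= e1 * (`|y - z| * K) * K * s.
  apply: H => r rt; have [c [_ cD ->]] := mean r rt.
  have -> : Fx c r * D r * (E r)^-1 + D r * (- a r * (E r)^-1) = (Fx c r - a r) * D r * (E r)^-1.
    by ring.
  rewrite !normrM; apply: ler_pM; rewrite ?mulr_ge0 //; last first.
    by rewrite gtr0_norm ?invr_gt0 // EVK.
  apply: ler_pM => //; last exact: Dh.
  rewrite aE // -[c](subrK (X z r)) [_ + X z r]addrC; apply: Heta.
    by rewrite (le_lt_trans cD) // (le_lt_trans (Dh r rt)).
  by case/andP: rt => -> /ltW ->.
move=> H; have -> : X y s - X z s - (y - z) *: E s = (G s - (y - z)) * E s.
  by rewrite mulrBl /G mulfVK // gt_eqF.
rewrite normrM (gtr0_norm (Epos s)).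
apply: le_trans (ler_pM (normr_ge0 _) (ltW (Epos s)) H (EK s st)) _.
have -> : e * `|y - z| = e1 * (`|y - z| * K) * K * t * K.
  by rewrite /e1; field; rewrite !gt_eqF.
rewrite ler_wpM2r ?(ltW K0) // ler_wpM2l //; last by case/andP: st => _ /ltW.
by do ![exact: ltW | exact: normr_ge0 | apply: mulr_ge0].
Qed.

(** [flow_upto] gives an E for each end time. Up to the midpoint of t and T that E coincides with
    [dx X z], which transfers its equation to [dx X] itself. *)
Lemma flow_derivative (z t : R) : 0 <= t < T ->
  derivable (X ^~ t) z 1 /\ is_dt T (dx X) z t (Fx (X z t) t * dx X z t).
Proof.
move=> /andP[t0 tT]; pose t2 := (t + T) / 2.
have t2T : 0 < t2 < T by rewrite /t2; apply/andP; split; lra.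
have tt2 : t < t2 by rewrite /t2; lra.
have [E HE] := flow_upto z t2T.
have dxE s : 0 <= s < t2 -> dx X z s = E s.
  by move=> /HE[[_ Ed] _]; rewrite /dx derive1E.
have tt : 0 <= t < t2 by rewrite t0.
split; first by case: (HE t tt) => -[].
have [_ /deriv_withinP H] := HE t tt.
rewrite dxE //; apply/deriv_withinP => e e0; have [r r0 rH] := H e e0.
exists (Num.min r (t2 - t)); first by rewrite lt_min r0 subr_gt0.
move=> s; rewrite /= in_itv /= lt_min => /andP[s0 _] /andP[sr st].
have st2 : 0 <= s < t2.
  by rewrite s0 /=; move: (ler_norm (s - t)) st => /le_lt_trans/[apply]; lra.
by rewrite !dxE //; apply: rH; rewrite //= in_itv.
Qed.

End bounded_field.

End flow.

(** * The equations for w, rho and v *)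

Lemma deriv_within_unique (R : realType) (V : normedModType R) (T t : R) (f : R -> V) (d d' : V) :
  0 <= t < T -> deriv_within `[0, T[ f t d -> deriv_within `[0, T[ f t d' -> d = d'.
Proof.
move=> /andP[t0 tT] /deriv_withinP H /deriv_withinP H'.
apply/eqP; rewrite -subr_eq0 -normr_le0; apply/ler_addgt0Pl => e e0; rewrite addr0.
have e2 : 0 < e / 2 by rewrite divr_gt0.
have [r r0 rH] := H _ e2; have [r' r'0 rH'] := H' _ e2.
pose h := Num.min (Num.min r r') (T - t) / 2.
have m0 : 0 < Num.min (Num.min r r') (T - t) by rewrite !lt_min r0 r'0 subr_gt0.
have h0 : 0 < h by rewrite divr_gt0.
have : h < Num.min (Num.min r r') (T - t) by rewrite /h; lra.
rewrite !lt_min => /andP[/andP[hr hr'] hT].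
have thT : `[0, T[%classic (t + h) by rewrite /= in_itv /=; apply/andP; split; lra.
have := rH _ thT; have := rH' _ thT; rewrite [t + h]addrC addrK gtr0_norm // => /(_ hr') E' /(_ hr)
  E.
rewrite -(ler_pM2l h0) -[X in X * _](gtr0_norm h0) -normrZ.
have -> : h *: (d - d') = (f (h + t) - f t - h *: d') - (f (h + t) - f t - h *: d).
  by rewrite scalerBr opprB [RHS]addrC addrA subrK.
rewrite (le_trans (ler_normB _ _)) // (le_trans (lerD E' E)) //.
by rewrite -mulrDl -splitr mulrC.
Qed.

(** Here G k m stands for l_i (Dr_k r_m). In the double sum the terms k = m vanish. The terms with
    exactly one index equal to i come in two kinds, G i m and G m i with opposite factors, and
    together they form the difference in gamma^i_{im}. *)
Lemma wave_algebra (R : comRingType) n (i : 'I_n) (l w c : 'I_n -> R)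
    (G : 'I_n -> 'I_n -> R) (g : 'I_n -> 'I_n -> R) :
  (forall m, m != i -> g i m = - (l i - l m) * (G i m - G m i)) ->
  (forall k m, m != i -> k != i -> g k m = - (l k - l m) * G k m) ->
  - (\sum_m c m * w m) * w i + \sum_m \sum_k (l m - l k) * G k m * w k * w m =
  - c i * w i ^+ 2 + (\sum_(m | m != i) (- c m + g i m) * w m) * w i
  + \sum_(m | m != i) \sum_(k | (k != i) && (m != k)) g k m * w k * w m.
Proof.
move=> gi gk.
rewrite [X in - X * _](bigD1 i) //= [X in _ + X = _](bigD1 i) //=.
rewrite [X in _ + (X + _) = _](bigD1 i) //= subrr !mul0r add0r.
have -> : \sum_(m | m != i) \sum_k (l m - l k) * G k m * w k * w m =
  \sum_(m | m != i) (l m - l i) * G i m * w i * w m +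
  \sum_(m | m != i) \sum_(k | (k != i) && (m != k)) g k m * w k * w m.
  rewrite -big_split /=; apply: eq_bigr => m mi.
  rewrite (bigD1 i) //=; congr (_ + _).
  rewrite (bigD1 m) //= subrr !mul0r add0r.
  under [RHS]eq_bigl do rewrite (eq_sym m).
  by apply: eq_bigr => k /andP[ki km]; rewrite gk // opprB.
rewrite !addrA; congr (_ + _).
have -> : (\sum_(m | m != i) (- c m + g i m) * w m) * w i =
  - (\sum_(m | m != i) c m * w m) * w i + \sum_(m | m != i) (l i - l m) * G m i * w m * w i
  + \sum_(m | m != i) (l m - l i) * G i m * w i * w m.
  rewrite !mulr_suml mulNr mulr_suml -sumrN -!big_split /=.
  by apply: eq_bigr => m mi; rewrite gi //; ring.
by rewrite !addrA; congr (_ + _ + _); ring.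
Qed.

Section wave_equations.
Context {R : realType} (mu0 A gamma kappa : R).
Local Notation r := (reig mu0 A gamma kappa).
Local Notation lam := (lambda mu0 A gamma kappa).
Local Notation l := (leig mu0 A gamma kappa).
Local Notation Mx := (mhd_matrix mu0 A gamma kappa).
Local Notation c := (c_coef mu0 A gamma kappa).
Local Notation gam := (gamma_coef mu0 A gamma kappa).
Implicit Types Phi : 'cV[R]_7.

Definition frame_mx Phi : 'M[R]_7 := \matrix_(j < 7, k < 7) r k Phi j 0.

Definition dframe Phi (d : 'cV[R]_7) : 'M[R]_7 :=
  \matrix_(j < 7, k < 7) 'd (fun Psi => r k Psi j 0) Phi d.

Variable B : set 'cV[R]_7.
Hypothesis diff_lam : forall i Phi, B Phi -> differentiable (lam i) Phi.
Hypothesis C1_lam : forall i Phi v, B Phi -> {for Phi, continuous (fun Psi => 'd (lam i) Psi v)}.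
Variable M : R.
Hypothesis bound_lam : forall i Phi, B Phi -> `|lam i Phi| <= M.
Hypothesis diff_r : forall k j Phi, B Phi -> differentiable (fun Psi => r k Psi j 0) Phi.
Hypothesis unit_frame : forall Phi, B Phi -> frame_ok kappa Phi -> frame_mx Phi \in unitmx.
Hypothesis eigen : forall k Phi, B Phi -> Mx Phi *m r k Phi = lam k Phi *: r k Phi.

Lemma leigE i Phi (y : 'cV[R]_7) : (l i Phi *m y) 0 0 = (invmx (frame_mx Phi) *m y) i 0.
Proof. by rewrite /leig -row_mul mxE. Qed.

Lemma leig_dual Phi i j : B Phi -> frame_ok kappa Phi -> (l i Phi *m r j Phi) 0 0 = (i == j)%:R.
Proof.
move=> BP ok; rewrite leigE.
have -> : r j Phi = col j (frame_mx Phi) by apply/colP => k; rewrite !mxE.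
by rewrite colE mulmxA mulVmx ?unit_frame // mul1mx mxE andbT.
Qed.

Lemma DrE k m j Phi : B Phi ->
  Dr mu0 A gamma kappa k m Phi j 0 = 'd (fun Psi => r k Psi j 0) Phi (r m Phi).
Proof.
move=> BP; rewrite /Dr derive_mx; last first.
  by apply/derivable_mxP => i j'; rewrite ord1; exact/diff_derivable/diff_r.
by rewrite mxE deriveE //; exact: diff_r.
Qed.

Lemma dframeDr k m Phi : B Phi -> col k (dframe Phi (r m Phi)) = Dr mu0 A gamma kappa k m Phi.
Proof. by move=> BP; apply/colP => j; rewrite DrE // !mxE. Qed.

Lemma dframe_linear Phi n (a : 'I_n -> R) (v : 'I_n -> 'cV[R]_7) :
  dframe Phi (\sum_m a m *: v m) = \sum_m a m *: dframe Phi (v m).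
Proof.
apply/matrixP => j k; rewrite mxE linear_sum summxE; apply: eq_bigr => m _.
by rewrite linearZ !mxE.
Qed.

(** Serves all rates needed: y = Phi_x in t, in x and along a characteristic, and y = Phi_t in x. *)
Lemma deriv_coefficient D (phi y : R -> 'cV[R]_7) t d y' i :
  B (phi t) -> frame_ok kappa (phi t) ->
  deriv_within D phi t d -> deriv_within D y t y' ->
  deriv_within D (fun s => (l i (phi s) *m y s) 0 0) t
    ((l i (phi t) *m (y' - dframe (phi t) d *m (invmx (frame_mx (phi t)) *m y t))) 0 0).
Proof.
move=> BP ok dphi dy; rewrite leigE.
under eq_fun do rewrite leigE.
have dF : deriv_within D (frame_mx \o phi) t (dframe (phi t) d).
  apply/deriv_within_mx => j k; rewrite mxE.
  under eq_fun do rewrite mxE.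
  exact: (deriv_within_diff (g := fun Psi => r k Psi j 0)) (diff_r k j BP) dphi.
by have /deriv_within_mx := deriv_within_solve (unit_frame BP ok) dF dy; apply.
Qed.

Section solution.
Variables (T : R) (Phi : R -> R -> 'cV[R]_7).
Hypothesis sol : mhd_solution mu0 A gamma kappa T Phi.
Hypothesis inB : forall x t, 0 <= t < T -> B (Phi x t).

Local Notation W := (w mu0 A gamma kappa Phi).

Lemma solution_derivatives : exists Phix Phit Phixx Phixt Phitx : R -> R -> 'cV[R]_7,
  [/\ [/\ forall x t, 0 <= t < T -> is_dx Phi x t (Phix x t),
      forall x t, 0 <= t < T -> is_dt T Phi x t (Phit x t),
      forall x t, 0 <= t < T -> is_dx Phix x t (Phixx x t),
      forall x t, 0 <= t < T -> is_dt T Phix x t (Phixt x t) &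
      forall x t, 0 <= t < T -> is_dx Phit x t (Phitx x t)],
      [/\ C0_strip T Phi, C0_strip T Phix & C0_strip T Phixx],
      forall x t, 0 <= t < T -> Phixt x t = Phitx x t,
      forall x t, 0 <= t < T -> Phit x t = - (Mx (Phi x t) *m Phix x t) &
      forall x t, 0 <= t < T -> dx Phi x t = Phix x t].
Proof.
case: sol => -[c0 [Phix [Phit [dPx dPt [cx [Phixx [Phixt [dxx dxt cxx cxt]]]]
  [ct [Phitx [Phitt [dtx dtt ctx ctt]]]]]]]] eqn.
have dxE x t : 0 <= t < T -> dx Phi x t = Phix x t.
  by move=> tT; rewrite /dx derive1E; case: (dPx x t tT).
exists Phix, Phit, Phixx, Phixt, Phitx; split=> //.
- move=> x t tT; apply/colP => j.
  apply: (@mixed_derivatives R T x t (fun x t => Phi x t j 0) (fun x t => Phix x t j 0) (fun x t =>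
    Phit x t j 0)
    (fun x t => Phixt x t j 0) (fun x t => Phitx x t j 0)) => //.
  + by move=> y s sT; apply/is_deriveP; have /is_deriveP/deriv_within_mx := dPx y s sT; exact.
  + by move=> y s sT; have /deriv_within_mx := dPt y s sT; exact.
  + by move=> y s sT; have /deriv_within_mx := dxt y s sT; exact.
  + by move=> y s sT; apply/is_deriveP; have /is_deriveP/deriv_within_mx := dtx y s sT; exact.
  + exact: C0_strip_entry.
  + exact: C0_strip_entry.
- move=> x t tT; have [Pt dPt' E] := eqn x t tT.
  rewrite (deriv_within_unique tT (dPt x t tT) dPt') -dxE //.
  by apply/eqP; rewrite -addr_eq0; apply/eqP.
Qed.

(** With F the matrix of right eigenvectors, A F = F diag(lambda) gives F^-1 A = diag(lambda) F^-1,
    whose rows are the l_k. *)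
Lemma leig_eigen k Psi : B Psi -> frame_ok kappa Psi ->
  l k Psi *m Mx Psi = lam k Psi *: l k Psi.
Proof.
move=> BP ok; have uF := unit_frame BP ok.
have AF : Mx Psi *m frame_mx Psi = frame_mx Psi *m diag_mx (\row_j lam j Psi).
  apply/matrixP => j k'; rewrite mul_mx_diag !mxE.
  transitivity ((Mx Psi *m r k' Psi) j 0); last by rewrite eigen // !mxE mulrC.
  by rewrite mxE; apply: eq_bigr => m _; rewrite !mxE.
have AE : invmx (frame_mx Psi) *m Mx Psi = diag_mx (\row_j lam j Psi) *m invmx (frame_mx Psi).
  by rewrite -[Mx Psi](mulmxK uF) AF !mulmxA mulVmx // mul1mx.
rewrite /leig -row_mul AE mul_diag_mx; apply/rowP => j; by rewrite !mxE.
Qed.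

Lemma frame_decomposition Psi (y : 'cV[R]_7) : B Psi -> frame_ok kappa Psi ->
  y = \sum_m (l m Psi *m y) 0 0 *: r m Psi.
Proof.
move=> BP ok; apply/colP => j; rewrite summxE.
transitivity ((frame_mx Psi *m (invmx (frame_mx Psi) *m y)) j 0).
  by rewrite mulKVmx // unit_frame.
by rewrite mxE; apply: eq_bigr => m _; rewrite leigE [RHS]mxE mulrC; congr (_ * _); rewrite mxE.
Qed.

(** The identity l_i Phi_t = - lambda_i w_i is to be differentiated in x, so it must hold on a
    neighbourhood and not only at the point. *)
Lemma near_frame_ok (phi : R -> 'cV[R]_7) x : {for x, continuous phi} ->
  frame_ok kappa (phi x) -> \forall y \near x, frame_ok kappa (phi y).
Proof.
move=> cphi [k0|q0]; first by near=> y; left.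
have cc j : {for x, continuous (fun y => phi y j 0)}.
  have cj := differentiable_continuous (differentiable_coord (phi x) j 0).
  exact: continuous_comp cphi cj.
have cq := continuousD (continuousM (cc (ix 5)) (cc (ix 5)))
  (continuousM (cc (ix 6)) (cc (ix 6))).
have ne : phi x (ix 5) 0 * phi x (ix 5) 0 + phi x (ix 6) 0 * phi x (ix 6) 0 != 0.
  by rewrite -!expr2; apply/eqP.
have /(_ _ ne) := cvgr_neq0 _ cq.
by apply: filterS => y ney; right; apply/eqP; rewrite !expr2; exact: ney.
Unshelve. all: by end_near. Qed.

Section point.
Variables (x t : R) (i : 'I_7).
Hypothesis tT : 0 <= t < T.
Hypothesis ok : frame_ok kappa (Phi x t).

(* The rate of l_i Phi_t = - lambda_i w_i in x, computed on both sides, is combined with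
   Phi_xt = Phi_tx. *)
Lemma wave_rates : exists gt gx : R,
  [/\ is_dt T (W i) x t gt, is_dx (W i) x t gx,
      gt + lam i (Phi x t) * gx =
      - c i i (Phi x t) * W i x t ^+ 2
      + (\sum_(m | m != i) (- c i m (Phi x t) + gam i i m (Phi x t)) * W m x t) * W i x t
      + \sum_(m | m != i) \sum_(k | (k != i) && (m != k))
          gam i k m (Phi x t) * W k x t * W m x t &
      forall X : R -> R, X t = x -> deriv_within `[0, T[ X t (lam i (Phi x t)) ->
        deriv_within `[0, T[ (fun s => W i (X s) s) t (gt + lam i (Phi x t) * gx)].
Proof.
have [Phix [Phit [Phixx [Phixt [Phitx [[dPx dPt dxx dxt dtx] [cP cx cxx] mixed evol dxE]]]]]] :=
  solution_derivatives.
have BP := inB x tT.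
pose F := frame_mx (Phi x t); pose wv := invmx F *m Phix x t.
have wvE m : W m x t = wv m 0 by rewrite /w leigE dxE.
pose gt := (l i (Phi x t) *m (Phixt x t - dframe (Phi x t) (Phit x t) *m wv)) 0 0.
pose gx := (l i (Phi x t) *m (Phixx x t - dframe (Phi x t) (Phix x t) *m wv)) 0 0.
have dWt : is_dt T (W i) x t gt.
  have := @deriv_coefficient `[0, T[ (Phi x) (Phix x) t _ _ i BP ok (dPt x t tT) (dxt x t tT).
  apply: deriv_within_eq.
    by rewrite /w dxE.
  by move=> s; rewrite /= in_itv /= => sT; rewrite /w dxE.
have dWx m : is_dx (W m) x t
    ((l m (Phi x t) *m (Phixx x t - dframe (Phi x t) (Phix x t) *m wv)) 0 0).
  apply/is_deriveP; have /is_deriveP dP := dPx x t tT; have /is_deriveP dQ := dxx x t tT.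
  have := @deriv_coefficient setT (Phi ^~ t) (Phix ^~ t) x _ _ m BP ok dP dQ.
  apply: deriv_within_eq.
    by rewrite /w dxE.
  by move=> y _; rewrite /w dxE.
exists gt, gx; split=> //.
- pose mu m := lam m (Phi x t) * W m x t.
  have Phix_dec : Phix x t = \sum_m W m x t *: r m (Phi x t).
    rewrite {1}(frame_decomposition (Phix x t) BP ok); apply: eq_bigr => m _.
    by rewrite /w dxE.
  have lPhit m : (l m (Phi x t) *m Phit x t) 0 0 = - mu m.
    by rewrite evol // mulmxN mulmxA leig_eigen // -scalemxAl !mxE /mu /w dxE // mxE.
  have Phit_dec : Phit x t = \sum_m (- mu m) *: r m (Phi x t).
    by rewrite {1}(frame_decomposition (Phit x t) BP ok); apply: eq_bigr => m _; rewrite lPhit.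
  pose G k m := (l i (Phi x t) *m Dr mu0 A gamma kappa k m (Phi x t)) 0 0.
  have bil a u : (l i (Phi x t) *m (dframe (Phi x t) (\sum_m a m *: r m (Phi x t)) *m u)) 0 0 =
      \sum_m \sum_k a m * u k 0 * G k m.
    rewrite dframe_linear mulmx_suml mulmx_sumr summxE; apply: eq_bigr => m _.
    rewrite -scalemxAl -scalemxAr mxE mulmxA mxE mulr_sumr; apply: eq_bigr => k _.
    rewrite -mulrA; congr (_ * _); rewrite mulrC; congr (_ * _).
    rewrite /G -dframeDr // !mxE; apply: eq_bigr => j _; congr (_ * _).
    by rewrite [RHS]mxE.
  have dlam : 'd (lam i) (Phi x t) (Phix x t) = \sum_m c i m (Phi x t) * W m x t.
    rewrite Phix_dec linear_sum; apply: eq_bigr => m _.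
    by rewrite linearZ /c_coef deriveE; [rewrite mulrC|exact: diff_lam].
  have D1 : deriv_within setT (fun y => (l i (Phi y t) *m Phit y t) 0 0) x
      ((l i (Phi x t) *m (Phitx x t - dframe (Phi x t) (Phix x t) *m (invmx F *m Phit x t))) 0 0).
    have /is_deriveP dP := dPx x t tT; have /is_deriveP dQ := dtx x t tT.
    exact: (@deriv_coefficient setT (Phi ^~ t) (Phit ^~ t) x _ _ i BP ok dP dQ).
  have D2 : deriv_within setT (fun y => (l i (Phi y t) *m Phit y t) 0 0) x
      (- ('d (lam i) (Phi x t) (Phix x t) * W i x t + lam i (Phi x t) * gx)).
    have cPhi : {for x, continuous (fun y => Phi y t)}.
      by apply/differentiable_continuous/derivable1_diffP; case: (dPx x t tT).
    apply: (@deriv_within_near _ _ _ (fun y => - (lam i (Phi y t) * W i y t))).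
    - by rewrite lPhit.
    - apply: filterS (near_frame_ok cPhi ok) => y oky _.
      by rewrite evol // mulmxN mulmxA (leig_eigen i (inB y tT) oky) -scalemxAl !mxE /w dxE // mxE.
    - apply: deriv_withinN; apply: deriv_withinM; last exact/is_deriveP/dWx.
      have /is_deriveP dP := dPx x t tT.
      exact: (deriv_within_diff (g := lam i) (f := Phi ^~ t)) (diff_lam i BP) dP.
  have E : (l i (Phi x t) *m (Phitx x t - dframe (Phi x t) (Phix x t) *m (invmx F *m Phit x t))) 0
    0 =
      - ('d (lam i) (Phi x t) (Phix x t) * W i x t + lam i (Phi x t) * gx).
    by move/is_deriveP : D1 => [_ <-]; move/is_deriveP : D2 => [_ <-].
  have l_sub (u v : 'cV[R]_7) : (l i (Phi x t) *m (u - v)) 0 0 =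
      (l i (Phi x t) *m u) 0 0 - (l i (Phi x t) *m v) 0 0.
    by rewrite mulmxBr !mxE.
  rewrite -(@wave_algebra _ 7 i (fun m => lam m (Phi x t)) (fun m => W m x t)
    (fun m => c i m (Phi x t)) G (fun k m => gam i k m (Phi x t))); last 2 first.
  + move=> m mi; rewrite /gamma_coef eqxx; congr (_ * _).
    by rewrite l_sub.
  + by move=> k m mi ki; rewrite /gamma_coef (negbTE ki).
  rewrite -dlam; move: E; rewrite /gt l_sub mixed // l_sub.
  have -> : (l i (Phi x t) *m (dframe (Phi x t) (Phix x t) *m (invmx F *m Phit x t))) 0 0 =
      - \sum_m \sum_k lam k (Phi x t) * G k m * W k x t * W m x t.
    rewrite Phix_dec bil -sumrN; apply: eq_bigr => m _; rewrite -sumrN; apply: eq_bigr => k _.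
    by rewrite -leigE lPhit /mu; ring.
  have -> : (l i (Phi x t) *m (dframe (Phi x t) (Phit x t) *m wv)) 0 0 =
      - \sum_m \sum_k lam m (Phi x t) * G k m * W k x t * W m x t.
    rewrite Phit_dec bil -sumrN; apply: eq_bigr => m _; rewrite -sumrN; apply: eq_bigr => k _.
    by rewrite -wvE /mu; ring.
  have -> : \sum_m \sum_k (lam m (Phi x t) - lam k (Phi x t)) * G k m * W k x t * W m x t =
     \sum_m \sum_k lam m (Phi x t) * G k m * W k x t * W m x t -
     \sum_m \sum_k lam k (Phi x t) * G k m * W k x t * W m x t.
    rewrite -sumrB; apply: eq_bigr => m _; rewrite -sumrB; apply: eq_bigr => k _; ring.
  by move=> /eqP; rewrite subr_eq => /eqP ->; ring.
(* The chain rule is applied to Phi and Phi_x, whose x-derivatives are continuous on the whole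
   strip, and not to w_i, which is meaningful only where the dual frame exists. *)
- move=> X Xt dX.
  have along (f fx ft : R -> R -> 'cV[R]_7) :
      (forall x t, 0 <= t < T -> is_dx f x t (fx x t)) -> C0_strip T fx ->
      is_dt T f x t (ft x t) ->
      deriv_within `[0, T[ (fun s => f (X s) s) t (ft x t + lam i (Phi x t) *: fx x t).
    move=> dfx cfx dft; apply/deriv_within_mx => j k; rewrite ord1 !mxE -Xt.
    apply: (deriv_within_along (f := fun x t => f x t j 0) (fx := fun x t => fx x t j 0)) => //.
    + by rewrite Xt.
    + by move=> y s sT; apply/is_deriveP; have /is_deriveP/deriv_within_mx := dfx y s sT; exact.
    + exact: C0_strip_entry.
    + by have /deriv_within_mx := dft; rewrite Xt; exact.
  have okX : frame_ok kappa (Phi (X t) t) by rewrite Xt.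
  have BX : B (Phi (X t) t) by rewrite Xt.
  have := @deriv_coefficient `[0, T[ (fun s => Phi (X s) s) (fun s => Phix (X s) s) t _ _ i
    BX okX (along _ _ _ dPx cx (dPt x t tT)) (along _ _ _ dxx cxx (dxt x t tT)).
  rewrite Xt.
  have -> : (l i (Phi x t) *m (Phixt x t + lam i (Phi x t) *: Phixx x t -
      dframe (Phi x t) (Phit x t + lam i (Phi x t) *: Phix x t) *m
       (invmx (frame_mx (Phi x t)) *m Phix x t))) 0 0 = gt + lam i (Phi x t) * gx.
    have -> : dframe (Phi x t) (Phit x t + lam i (Phi x t) *: Phix x t) =
        dframe (Phi x t) (Phit x t) + lam i (Phi x t) *: dframe (Phi x t) (Phix x t).
      by apply/matrixP => j k; rewrite !mxE linearD linearZ.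
    rewrite /gt /gx mulmxDl -scalemxAl opprD addrACA -scalerBr mulmxDr -scalemxAr.
    by rewrite mxE; congr (_ + _); rewrite mxE.
  apply: deriv_within_eq; first by rewrite Xt /w dxE.
  by move=> s; rewrite /= in_itv /= => sT; rewrite /w dxE.
Qed.

End point.

Section along_characteristics.
Variable X : 'I_7 -> R -> R -> R.
Hypothesis charX : characteristics mu0 A gamma kappa T Phi X.

(** The differential of lambda_i is known to be continuous only in each fixed direction; expanding
    Phi_x in the standard basis reduces the moving direction to fixed ones. *)
Lemma speed_gradient_continuous i :
  C0_strip T (fun x t => 'd (lam i) (Phi x t) (dx Phi x t)).
Proof.
have [Phix [Phit [Phixx [Phixt [Phitx [_ [cP cx _] _ _ dxE]]]]]] := solution_derivatives.
have H : C0_strip T (fun x t => \sum_j Phix x t j 0 * 'd (lam i) (Phi x t) (delta_mx j 0)).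
  apply/subspace_continuousP => -[x t] /= tT.
  apply: cvg_big => [|j _]; first exact: add_continuous.
  move/subspace_continuousP : cP => /(_ (x, t) tT) cP.
  move/subspace_continuousP : cx => /(_ (x, t) tT) /cvg_mxP/(_ j 0) cx.
  apply: cvgM; first exact: cx.
  exact: (continuous_cvg _ (@C1_lam i _ (delta_mx j 0) (inB x tT)) cP).
apply: C0_strip_eq H => y s sT; rewrite dxE // {1}[Phix y s]matrix_sum_delta linear_sum.
by apply: eq_bigr => j _; rewrite big_ord1 linearZ.
Qed.

(** Expanding Phi_x in the eigenvectors turns d lambda_i / dx into the sum of c^i_{im} w_m. In the
    product rule for v_i = rho_i w_i all these terms, including c^i_{ii}, cancel against those of
    the w_i-equation, which leaves only gamma-terms. *)
Lemma characteristic_rates i z t : 0 <= t < T ->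
  derivable (X i ^~ t) z 1 /\
  (frame_ok kappa (Phi (X i z t) t) ->
   let x := X i z t in
   let rho := inv_density X in
   let V := v mu0 A gamma kappa Phi X in
   is_ds_char T (rho i) z t
     (c i i (Phi x t) * V i z t
      + (\sum_(m | m != i) c i m (Phi x t) * W m x t) * rho i z t) /\
   is_ds_char T (V i) z t
     ((\sum_(m | m != i) gam i i m (Phi x t) * W m x t) * V i z t
      + (\sum_(m | m != i) \sum_(k | (k != i) && (m != k))
           gam i k m (Phi x t) * W k x t * W m x t) * rho i z t)).
Proof.
move=> tT; have [Phix [Phit [Phixx [Phixt [Phitx [[dPx _ _ _ _] _ _ _ dxE]]]]]] :=
  solution_derivatives.
have dF y s : 0 <= s < T -> is_dx (fun x t => lam i (Phi x t)) y s
    ('d (lam i) (Phi y s) (dx Phi y s)).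
  move=> sT; rewrite dxE //; apply/is_deriveP; have /is_deriveP dP := dPx y s sT.
  exact: (deriv_within_diff (g := lam i) (f := Phi ^~ s)) (diff_lam i (inB y sT)) dP.
have bF y s : 0 <= s < T -> `|lam i (Phi y s)| <= M by move=> sT; exact/bound_lam/inB.
have X0 y : X i y 0 = y by case: (charX i y).
have dX y s : 0 <= s < T -> is_dt T (X i) y s (lam i (Phi (X i y s) s)).
  by case: (charX i y) => _; apply.
have [dXz drho] := flow_derivative dF (speed_gradient_continuous (i := i)) bF X0 dX z tT.
split=> // ok x rho V.
have speed : 'd (lam i) (Phi x t) (dx Phi x t) = c i i (Phi x t) * W i x t +
    \sum_(m | m != i) c i m (Phi x t) * W m x t.
  rewrite (frame_decomposition (dx Phi x t) (inB x tT) ok) linear_sum (bigD1 i) //=.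
  have ci m : 'd (lam i) (Phi x t) (W m x t *: r m (Phi x t)) = c i m (Phi x t) * W m x t.
    by rewrite linearZ /c_coef deriveE; [rewrite mulrC|exact/diff_lam/inB].
  by rewrite ci; congr (_ + _); apply: eq_bigr => m _; rewrite ci.
have [gt [gx [_ _ E /(_ (X i z) erefl (dX z t tT)) dW]]] := wave_rates i tT ok.
split.
  suff <- : 'd (lam i) (Phi x t) (dx Phi x t) * rho i z t = c i i (Phi x t) * V i z t
      + (\sum_(m | m != i) c i m (Phi x t) * W m x t) * rho i z t by [].
  by rewrite speed /V /v -/rho -/x; ring.
have dV := deriv_withinM drho dW.
suff <- : 'd (lam i) (Phi x t) (dx Phi x t) * rho i z t * W i x t + rho i z t * (gt + lam i (Phi x
  t) * gx) =
  (\sum_(m | m != i) gam i i m (Phi x t) * W m x t) * V i z t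
      + (\sum_(m | m != i) \sum_(k | (k != i) && (m != k))
           gam i k m (Phi x t) * W k x t * W m x t) * rho i z t by [].
rewrite E speed /V /v -/rho -/x.
under [X in _ + rho i z t * (_ + X * _ + _)]eq_bigr do rewrite mulrDl mulNr.
by rewrite big_split /= sumrN; ring.
Qed.

End along_characteristics.

End solution.
End wave_equations.

(** * Functions of class C1 *)

Lemma near_eq_differentiable (R : realType) (V W : normedModType R) (f g : V -> W) x :
  {near x, f =1 g} -> differentiable f x -> differentiable g x.
Proof.
move=> fg df; have E : (g - f) \o shift x = cst ((g - f) x) + \0 +o_ 0 id.
  apply/eqaddoP => e e0; near=> y.
  have -> : ((g - f) \o shift x - (cst ((g - f) x) + \0)) y = 0.
    rewrite !fctE /= (nbhs_singleton fg) subrr addr0 subr0.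
    suff -> : f (y + x) = g (y + x) by rewrite subrr.
    near: y; move: fg; rewrite (near_shift 0) => fg.
    by apply: filterS fg => y /=; rewrite subr0.
  by rewrite normr0 mulr_ge0 // ltW.
have dh : 'd (g - f) x = \0 :> (V -> W).
  by apply: (@diff_unique _ _ _ _ \0) => //; exact: cst_continuous.
have dgf : differentiable (g - f) x.
  by apply/diff_locallyP; rewrite dh; split; [exact: cst_continuous|].
by rewrite -[g](subrK f); exact: differentiableD.
Unshelve. all: by end_near. Qed.

Section C1.
Context {R : realType} {V : normedModType R}.
Implicit Types (U : set V) (f g : V -> R).

(** Continuity of the differential is asked for each fixed direction, so no operator norm enters and
    each closure rule is a statement about scalar functions. *)
Definition C1on U f : Prop := forall x, U x ->
  differentiable f x /\ forall v, {for x, continuous (fun y => 'd f y v)}.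

Lemma C1on_sub U U' f : U' `<=` U -> C1on U f -> C1on U' f.
Proof. by move=> UU Cf x /UU; exact: Cf. Qed.

Lemma C1on_continuous U f : C1on U f -> forall x, U x -> {for x, continuous f}.
Proof. by move=> Cf x /Cf[/differentiable_continuous]. Qed.

Lemma C1on_intro U f (df : V -> V -> R) : open U ->
  (forall x, U x -> differentiable f x) ->
  (forall x v, U x -> 'd f x v = df x v) ->
  (forall x v, U x -> {for x, continuous (fun y => df y v)}) -> C1on U f.
Proof.
move=> oU Df E cdf x Ux; split; first exact: Df.
move=> v; have H : (fun y => df y v) @ x --> 'd f x v.
  by rewrite E //; exact: cdf.
apply: cvg_trans H; apply: near_eq_cvg; have : nbhs x U by exact: open_nbhs_nbhs.
by apply: filterS => y Uy; rewrite E.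
Qed.

Lemma C1on_eq U f g : open U -> (forall x, U x -> f x = g x) -> C1on U f -> C1on U g.
Proof.
move=> oU fg Cf.
have nfg x : U x -> {near x, f =1 g}.
  move=> Ux; have : nbhs x U by exact: open_nbhs_nbhs.
  by apply: filterS => y /fg.
have dg x : U x -> differentiable g x.
  by move=> Ux; apply: near_eq_differentiable (nfg x Ux) _; case: (Cf x Ux).
apply: (C1on_intro (df := fun x v => 'd f x v) oU dg) => x v Ux.
  rewrite -deriveE; last exact: dg.
  rewrite -deriveE; last by case: (Cf x Ux).
  by apply: near_eq_derive; apply: filterS (nfg x Ux).
by case: (Cf x Ux) => _; exact.
Qed.

Lemma C1on_cst U (a : R) : open U -> C1on U (fun=> a).
Proof.
move=> oU; apply: (@C1on_intro _ _ (fun _ _ => 0)) => //.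
- by move=> x v _; rewrite [LHS](_ : _ = 'd (cst a) x v) // diff_cst.
- by move=> x v _; exact: cst_continuous.
Qed.

Lemma C1on_linear U (f : {linear V -> R}) : open U -> continuous f -> C1on U f.
Proof.
move=> oU cf; apply: (C1on_intro (df := fun _ v => f v) oU).
- by move=> x _; exact: linear_differentiable.
- by move=> x v _; rewrite diff_lin.
- by move=> x v _; exact: cst_continuous.
Qed.

Lemma C1onD U f g : open U -> C1on U f -> C1on U g -> C1on U (fun y => f y + g y).
Proof.
move=> oU Cf Cg; apply: (@C1on_intro _ _ (fun x v => 'd f x v + 'd g x v)) => //.
- by move=> x Ux; case: (Cf x Ux) => ? _; case: (Cg x Ux) => ? _; exact: differentiableD.
- by move=> x v Ux; case: (Cf x Ux) => df _; case: (Cg x Ux) => dg _; rewrite (diffD df dg).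
- move=> x v Ux; case: (Cf x Ux) => _ /(_ v) cf; case: (Cg x Ux) => _ /(_ v) cg.
  exact: continuousD cf cg.
Qed.

Lemma C1onM U f g : open U -> C1on U f -> C1on U g -> C1on U (fun y => f y * g y).
Proof.
move=> oU Cf Cg; apply: (@C1on_intro _ _ (fun x v => f x * 'd g x v + g x * 'd f x v)) => //.
- by move=> x Ux; case: (Cf x Ux) => ? _; case: (Cg x Ux) => ? _; exact: differentiableM.
- by move=> x v Ux; case: (Cf x Ux) => df _; case: (Cg x Ux) => dg _; rewrite (diffM df dg).
- move=> x v Ux; have ff := C1on_continuous Cf Ux; have gg := C1on_continuous Cg Ux.
  case: (Cf x Ux) => _ /(_ v) cf; case: (Cg x Ux) => _ /(_ v) cg.
  exact: continuousD (continuousM ff cg) (continuousM gg cf).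
Qed.

Lemma C1on_comp U f (g g' : R -> R) : open U -> C1on U f ->
  (forall x, U x -> is_derive (f x) 1 g (g' (f x))) ->
  (forall x, U x -> {for f x, continuous g'}) -> C1on U (fun y => g (f y)).
Proof.
move=> oU Cf dg cg'.
have Dg x : U x -> differentiable g (f x).
  by move=> Ux; apply/derivable1_diffP; case: (dg x Ux).
apply: (@C1on_intro _ _ (fun x v => g' (f x) * 'd f x v)) => //.
- by move=> x Ux; case: (Cf x Ux) => df _; apply: (differentiable_comp df); exact: (Dg x Ux).
- move=> x v Ux; case: (Cf x Ux) => df _.
  rewrite [LHS](_ : _ = 'd (g \o f) x v) // diff_comp //=; last exact: (Dg x Ux).
  have E : 'd g (f x) 1 = g' (f x).
    by rewrite -deriveE; [case: (dg x Ux)|exact: (Dg x Ux)].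
  by rewrite -[X in 'd g _ X]mulr1 [LHS]linearZ E [LHS]mulrC.
- move=> x v Ux; have ff := C1on_continuous Cf Ux.
  case: (Cf x Ux) => _ /(_ v) cf.
  exact: continuousM (continuous_comp ff (cg' x Ux)) cf.
Qed.

Lemma C1onN U f : open U -> C1on U f -> C1on U (fun y => - f y).
Proof.
move=> oU Cf; apply: (C1on_eq oU _ (C1onM oU (C1on_cst (-1) oU) Cf)) => x _.
by rewrite mulN1r.
Qed.

Lemma C1onB U f g : open U -> C1on U f -> C1on U g -> C1on U (fun y => f y - g y).
Proof. by move=> oU Cf Cg; exact (C1onD oU Cf (C1onN oU Cg)). Qed.

Lemma C1onX U f n : open U -> C1on U f -> C1on U (fun y => f y ^+ n).
Proof.
move=> oU Cf; elim: n => [|n IH]; first exact (C1on_cst 1 oU).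
apply: (C1on_eq oU _ (C1onM oU Cf IH)) => x _.
by rewrite exprS.
Qed.

Lemma C1onV U f : open U -> C1on U f -> (forall x, U x -> f x != 0) ->
  C1on U (fun y => (f y)^-1).
Proof.
move=> oU Cf f0; apply: (C1on_comp (g := GRing.inv) (g' := fun x => - (x ^- 2)) oU Cf) => x Ux.
  apply: DeriveDef.
    by apply: derivableV => //; exact: f0.
  by rewrite deriveV ?f0 // derive_id [LHS]mulr1.
apply: continuousN; apply: continuousV; first by rewrite expf_neq0 // f0.
exact: exprn_continuous.
Qed.

Lemma C1on_sqrt U f : open U -> C1on U f -> (forall x, U x -> 0 < f x) ->
  C1on U (fun y => Num.sqrt (f y)).
Proof.
move=> oU Cf f0; apply: (C1on_comp (g := Num.sqrt) (g' := fun x => (2 * Num.sqrt x)^-1) oU Cf) => x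
  Ux.
  exact/is_derive1_sqrt/f0.
have s0 : 2 * Num.sqrt (f x) != 0 by rewrite mulf_neq0 // gt_eqF // sqrtr_gt0 f0.
apply: continuousV => //.
by apply: continuousM; [exact: cst_continuous|exact: sqrt_continuous].
Qed.

Lemma C1on_expR U f : open U -> C1on U f -> C1on U (fun y => expR (f y)).
Proof.
move=> oU Cf; apply: (C1on_comp (g := expR) (g' := expR) oU Cf) => x Ux.
exact: continuous_expR.
Qed.

Lemma C1on_powR U f (a : R) : open U -> C1on U f -> (forall x, U x -> 0 < f x) ->
  C1on U (fun y => f y `^ a).
Proof.
move=> oU Cf f0.
have Cln : C1on U (fun y => ln (f y)).
  apply: (C1on_comp (g := @ln R) (g' := GRing.inv) oU Cf) => x Ux.
    exact/is_derive1_ln/f0.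
  by apply: inv_continuous; rewrite gt_eqF // f0.
apply: (C1on_eq oU _ (C1on_expR oU (C1onM oU (C1on_cst a oU) Cln))) => x Ux.
by rewrite /powR gt_eqF // f0.
Qed.

End C1.

(** * Restriction of smooth functions to a fixed value of the parameter *)

Section slice.
Context {R : realType} {V W : normedModType R}.

Lemma C1on_slice (U : set (V * W)) (f : V * W -> R) (b : W) : C1on U f ->
  forall x, U (x, b) ->
  [/\ differentiable (fun y => f (y, b)) x,
      forall v, 'd (fun y => f (y, b)) x v = 'd f (x, b) (v, 0) &
      forall v, {for x, continuous (fun y => 'd f (y, b) (v, 0))}].
Proof.
move=> Cf x Ux; have [df cf] := Cf _ Ux.
have dp : is_diff x (fun y : V => (y, b)) (fun v => (v, 0)).
  exact: (@is_diff_pair _ _ _ _ id id (cst b) (\0)).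
have dc : differentiable (f \o (fun y => (y, b))) x by apply: differentiable_comp.
split=> // [v|v].
  by rewrite [LHS](_ : _ = 'd (f \o (fun y => (y, b))) x v) // diff_comp //= diff_val.
have cp : {for x, continuous (fun y : V => (y, b))}.
  by apply: differentiable_continuous.
exact: continuous_comp cp (cf (v, 0)).
Qed.

End slice.

(** * Wave speeds *)

Section ix_facts.

Lemma ixE k (lt_k : (k < 7)%N) : Ordinal lt_k = ix k.+1.
Proof. by apply/val_inj; rewrite /= inordK. Qed.

Lemma forall_ord7 (P : 'I_7 -> Prop) : P (ix 1) -> P (ix 2) -> P (ix 3) -> P (ix 4) ->
  P (ix 5) -> P (ix 6) -> P (ix 7) -> forall i, P i.
Proof.
move=> P1 P2 P3 P4 P5 P6 P7 [[|[|[|[|[|[|[|//]]]]]]] lt_k]; by rewrite ixE.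
Qed.

Lemma val_ix k : (0 < k <= 7)%N -> ix k = k.-1 :> nat.
Proof. by case: k => // k /= k7; rewrite inordK. Qed.

Definition ix_simpl := (val_ix (k := 1) isT, val_ix (k := 2) isT, val_ix (k := 3) isT,
  val_ix (k := 4) isT, val_ix (k := 5) isT, val_ix (k := 6) isT, val_ix (k := 7) isT).

Lemma sum7 (M : nmodType) (f : 'I_7 -> M) :
  \sum_i f i = f (ix 1) + (f (ix 2) + (f (ix 3) + (f (ix 4) + (f (ix 5) + (f (ix 6) + f (ix 7)))))).
Proof.
rewrite !big_ord_recl big_ord0 addr0.
by do ![congr (_ + _)]; congr f; apply/val_inj; rewrite /= val_ix.
Qed.

End ix_facts.

Section coordinates.
Context {R : realType} {n : nat}.
Local Notation V := ('cV[R]_n * R)%type.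

Lemma C1on_state (U : set V) j : open U -> C1on U (fun y : V => y.1 j 0).
Proof.
move=> oU; pose f (y : V) : R := y.1 j 0.
have lf : linear f by move=> a u v; rewrite /f !mxE.
pose F : {linear V -> R} := HB.pack f (GRing.isLinear.Build _ _ _ _ f lf).
apply: (C1on_linear (f := F) oU) => y.
apply: (@continuous_comp _ _ _ fst (fun Phi : 'cV[R]_n => Phi j 0)); first exact: cvg_fst.
exact/differentiable_continuous/differentiable_coord.
Qed.

Lemma C1on_param (U : set V) : open U -> C1on U (fun y : V => y.2).
Proof.
move=> oU; pose f (y : V) : R := y.2.
have lf : linear f by [].
pose F : {linear V -> R} := HB.pack f (GRing.isLinear.Build _ _ _ _ f lf).
by apply: (C1on_linear (f := F) oU) => y; exact: cvg_snd.
Qed.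

End coordinates.

Ltac solve_C1 := repeat match goal with
  | |- C1on _ (fun _ => ?a) => apply: C1on_cst
  | |- C1on _ (fun _ => _ + - _) => apply: C1onB
  | |- C1on _ (fun _ => _ + _) => apply: C1onD
  | |- C1on _ (fun _ => - _) => apply: C1onN
  | |- C1on _ (fun _ => _ * _) => apply: C1onM
  | |- C1on _ (fun _ => _ ^+ _) => apply: C1onX
  | |- C1on _ (fun _ => _^-1) => apply: C1onV
  | H : C1on ?U ?f |- C1on ?U ?f => exact H
  | |- open _ => assumption
  end.

Section wave_speeds.
Context {R : realType} (mu0 A gamma : R).
Hypotheses (mu0_gt0 : 0 < mu0) (A_gt0 : 0 < A) (gamma_gt1 : 1 < gamma).
Local Notation V := ('cV[R]_7 * R)%type.
Implicit Type y : V.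

(* A point y = (Phi, a) stands for the state Phi with |kappa| = a; all speeds are
   functions of y that stay smooth through a = 0. *)
Definition sound2 y : R := A * expR (entropy y.1) * (gamma * dens y.1 `^ (gamma - 1)).
Definition alfven y : R := Num.sqrt (mu0 / dens y.1).
Definition bsum y : R :=
  mu0 / dens y.1 * (y.2 ^+ 2 + H2 y.1 ^+ 2 + H3 y.1 ^+ 2) + sound2 y.
Definition disc y : R := bsum y ^+ 2 - 4 * mu0 * y.2 ^+ 2 * sound2 y / dens y.1.
Definition fast y : R := Num.sqrt (2^-1 * (bsum y + Num.sqrt (disc y))).
(* The ratio of the slow to the Alfven speed. *)
Definition slow_ratio y : R := Num.sqrt (sound2 y) / fast y.

Definition speed (i : 'I_7) y : R :=
  [:: u1 y.1 + fast y; u1 y.1 + alfven y * y.2; u1 y.1 + alfven y * y.2 * slow_ratio y;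
      u1 y.1; u1 y.1 - alfven y * y.2 * slow_ratio y; u1 y.1 - alfven y * y.2;
      u1 y.1 - fast y]`_i.

(** A positive discriminant makes the inner square root smooth and separates the fast from the slow
    speed; H = 0 and a = 0 are allowed. *)
Definition regular : set V := [set y | 0 < dens y.1 /\ 0 < disc y].

Let positive_density : set V := [set y | 0 < dens y.1].

Lemma sound2_gt0 y : positive_density y -> 0 < sound2 y.
Proof.
move=> r0; rewrite /sound2 !mulr_gt0 ?expR_gt0 ?powR_gt0 //.
by rewrite (lt_trans _ gamma_gt1).
Qed.

Let C1_dens U : open U -> C1on U (fun y => dens y.1).
Proof. by move=> oU; exact: (C1onD oU (C1on_state (ix 4) oU) (C1on_cst 1 oU)). Qed.

Let open_positive_density : open positive_density.
Proof.
have C := @C1_dens setT openT.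
rewrite openE => y /= y0; have := C1on_continuous C (I : setT y).
move=> /cvgr_gt; exact.
Qed.

Let C1_sound2 : C1on positive_density sound2.
Proof.
have oP := open_positive_density.
have Cd := C1_dens oP; have Cs := C1on_state (ix 7) oP.
have Ce := C1on_expR oP Cs.
have Cp := C1on_powR (gamma - 1) oP Cd (fun y Py => Py).
exact: (C1onM oP (C1onM oP (C1on_cst A oP) Ce) (C1onM oP (C1on_cst gamma oP) Cp)).
Qed.

Let C1_bsum : C1on positive_density bsum.
Proof.
have oP := open_positive_density.
have Cd := C1_dens oP; have C2 := C1on_state (ix 5) oP; have C3 := C1on_state (ix 6) oP.
have Ca := @C1on_param R 7 _ oP; have C_s := C1_sound2.
rewrite /bsum /H2 /H3; solve_C1; by move=> y Py; rewrite gt_eqF.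
Qed.

Let C1_disc : C1on positive_density disc.
Proof.
have oP := open_positive_density.
have Cd := C1_dens oP; have Ca := @C1on_param R 7 _ oP; have C_s := C1_sound2.
have Cb := C1_bsum.
rewrite /disc; solve_C1; by move=> y Py; rewrite gt_eqF.
Qed.

Lemma open_regular : open regular.
Proof.
rewrite openE => y /= [y0 d0].
have n1 : nbhs y positive_density by apply: open_nbhs_nbhs; split.
have := C1on_continuous C1_disc y0 => /cvgr_gt/(_ _ d0).
by move: n1; apply: filterS2 => z z0 zd; split.
Qed.

Lemma regular_positive : regular `<=` positive_density.
Proof. by move=> y []. Qed.

Lemma bsum_gt0 y : regular y -> 0 < bsum y.
Proof.
move=> /regular_positive r0; rewrite /bsum ltr_wpDl ?sound2_gt0 //.
apply: mulr_ge0; first by apply/ltW; rewrite divr_gt0.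
by rewrite !addr_ge0 // sqr_ge0.
Qed.

Lemma fast2_gt0 y : regular y -> 0 < 2^-1 * (bsum y + Num.sqrt (disc y)).
Proof. by move=> ry; rewrite mulr_gt0 // ltr_pwDl ?bsum_gt0 // sqrtr_ge0. Qed.

Lemma fast_gt0 y : regular y -> 0 < fast y.
Proof. by move=> ry; rewrite sqrtr_gt0 fast2_gt0. Qed.

Lemma alfven_gt0 y : regular y -> 0 < alfven y.
Proof. by case=> r0 _; rewrite sqrtr_gt0 divr_gt0. Qed.

Lemma slow_ratio_gt0 y : regular y -> 0 < slow_ratio y.
Proof.
by move=> ry; rewrite divr_gt0 ?fast_gt0 // sqrtr_gt0 sound2_gt0 //; case: ry.
Qed.

Lemma C1_density : C1on regular (fun y => dens y.1).
Proof. exact: C1_dens open_regular. Qed.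

Lemma C1_sound : C1on regular sound2.
Proof. exact: (C1on_sub regular_positive C1_sound2). Qed.

Lemma C1_fast : C1on regular fast.
Proof.
have oU := open_regular.
have Cb := C1on_sub regular_positive C1_bsum.
have Cd := C1on_sqrt oU (C1on_sub regular_positive C1_disc) (fun y (ry : regular y) => ry.2).
exact: (C1on_sqrt oU (C1onM oU (C1on_cst (2^-1) oU) (C1onD oU Cb Cd)) fast2_gt0).
Qed.

Lemma C1_alfven : C1on regular alfven.
Proof.
have oU := open_regular; have Cd := C1_density.
have dn0 y : regular y -> dens y.1 != 0 by case=> ? _; rewrite gt_eqF.
apply: (C1on_sqrt oU (C1onM oU (C1on_cst mu0 oU) (C1onV oU Cd dn0))) => y [r0 _].
exact: divr_gt0.
Qed.

Lemma C1_slow_ratio : C1on regular slow_ratio.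
Proof.
have oU := open_regular.
have s0 y : regular y -> 0 < sound2 y by case=> ? _; exact: sound2_gt0.
have f0 y : regular y -> fast y != 0 by move=> /fast_gt0 ?; rewrite gt_eqF.
exact: (C1onM oU (C1on_sqrt oU C1_sound s0) (C1onV oU C1_fast f0)).
Qed.

Lemma C1_speed i : C1on regular (speed i).
Proof.
have oU := open_regular; have Cf := C1_fast; have Ca := C1_alfven; have Cs := C1_slow_ratio.
have Cu := C1on_state (ix 1) oU; have Cp := @C1on_param R 7 _ oU.
move: i; apply: forall_ord7; rewrite /speed /u1 ix_simpl /=; solve_C1.
Qed.

(* fast^2 and the square of the slow speed are the roots of
   X^2 - bsum X + (alfven a)^2 sound2. *)
Lemma fast_quadratic y : regular y ->
  fast y ^+ 2 * (bsum y - fast y ^+ 2) = (alfven y * y.2) ^+ 2 * sound2 y.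
Proof.
move=> ry; have [r0 d0] := ry.
rewrite exprMn (sqr_sqrtr (ltW (fast2_gt0 ry))) (sqr_sqrtr (ltW (divr_gt0 mu0_gt0 r0))).
have := sqr_sqrtr (ltW d0); rewrite {2}/disc => E.
have -> : 2^-1 * (bsum y + Num.sqrt (disc y)) * (bsum y - 2^-1 * (bsum y + Num.sqrt (disc y))) =
  4^-1 * (bsum y ^+ 2 - Num.sqrt (disc y) ^+ 2) by field.
by rewrite E; field; rewrite gt_eqF.
Qed.

(** The roots of the quadratic add up to [bsum], so the second one is bsum - fast^2, and their
    product is (alfven a)^2 sound2. This is the origin of [slow_ratio]: the slow speed is linear in
    a times a positive smooth function, although its defining radicand vanishes at a = 0. *)
Lemma slow_sqr y : regular y ->
  (alfven y * y.2 * slow_ratio y) ^+ 2 = 2^-1 * (bsum y - Num.sqrt (disc y)).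
Proof.
move=> ry; have [r0 d0] := ry.
have fn : fast y != 0 by rewrite gt_eqF // fast_gt0.
transitivity (bsum y - fast y ^+ 2); last first.
  by rewrite (sqr_sqrtr (ltW (fast2_gt0 ry))); field.
apply: (mulfI (expf_neq0 2 fn)).
rewrite fast_quadratic // -(sqr_sqrtr (ltW (sound2_gt0 r0))).
by rewrite /slow_ratio; field.
Qed.

(** The gap equals sqrt(disc). It is the common factor of the two determinants in
    [magnetic_coords_unit]. *)
Lemma fast_slow_gap y : regular y ->
  0 < fast y ^+ 2 - (alfven y * y.2 * slow_ratio y) ^+ 2.
Proof.
move=> ry; rewrite slow_sqr // (sqr_sqrtr (ltW (fast2_gt0 ry))).
have : 0 < Num.sqrt (disc y) by rewrite sqrtr_gt0; case: ry.
lra.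
Qed.

End wave_speeds.

(** * Eigenvector frames *)

Lemma unitmx_injective (F : fieldType) n (M : 'M[F]_n) :
  (forall v : 'cV[F]_n, M *m v = 0 -> v = 0) -> M \in unitmx.
Proof.
move=> H; rewrite -unitmx_tr unitmxE unitfE; apply/det0P => -[v v0 vM].
case/eqP: v0; apply: trmx_inj; rewrite trmx0; apply: H.
by apply: trmx_inj; rewrite trmx_mul trmxK vM trmx0.
Qed.

Lemma elim2 (F : fieldType) (a b c d x y : F) :
  a * d - b * c != 0 -> a * x + b * y = 0 -> c * x + d * y = 0 -> x = 0 /\ y = 0.
Proof.
move=> D E1 E2; split; apply: (mulfI D).
  transitivity (d * (a * x + b * y) - b * (c * x + d * y)); first by ring.
  by rewrite E1 E2; ring.
transitivity (a * (c * x + d * y) - c * (a * x + b * y)); first by ring.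
by rewrite E1 E2; ring.
Qed.

Section frames.
Context {R : realType} (mu0 A gamma : R).
Hypotheses (mu0_gt0 : 0 < mu0) (A_gt0 : 0 < A) (gamma_gt1 : 1 < gamma).
Local Notation V := ('cV[R]_7 * R)%type.
Local Notation sound2 := (sound2 A gamma).
Local Notation alfven := (alfven mu0).
Local Notation fast := (fast mu0 A gamma).
Local Notation slow_ratio := (slow_ratio mu0 A gamma).
Local Notation bsum := (bsum mu0 A gamma).
Local Notation regular := (regular mu0 A gamma).
Local Notation speed := (speed mu0 A gamma).
Implicit Types (y : V) (Phi : 'cV[R]_7).

(* Columns: d/du1, H.d/du, H'.d/du, d/drho, H.d/dH, H'.d/dH, d/dS with
   H' = (H3, -H2). *)
Definition polar_frame Phi : 'M[R]_7 :=
  let h2 := H2 Phi in let h3 := H3 Phi in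
  \matrix_(i < 7, j < 7)
    (nth [::]
    [:: [:: 1; 0; 0; 0; 0; 0; 0];
        [:: 0; h2; h3; 0; 0; 0; 0];
        [:: 0; h3; - h2; 0; 0; 0; 0];
        [:: 0; 0; 0; 1; 0; 0; 0];
        [:: 0; 0; 0; 0; h2; h3; 0];
        [:: 0; 0; 0; 0; h3; - h2; 0];
        [:: 0; 0; 0; 0; 0; 0; 1]] i)`_j.

(* The derivative of [polar_frame] in the direction [polar_frame Phi *m x] is
   [polar_frame Phi *m polar_connection x], with no division by |H|. *)
Definition polar_connection (x : 'cV[R]_7) : 'M[R]_7 :=
  let p := x (ix 5) 0 in let q := x (ix 6) 0 in
  \matrix_(i < 7, j < 7)
    (nth [::]
    [:: [:: 0; 0; 0; 0; 0; 0; 0];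
        [:: 0; p; - q; 0; 0; 0; 0];
        [:: 0; q; p; 0; 0; 0; 0];
        [:: 0; 0; 0; 0; 0; 0; 0];
        [:: 0; 0; 0; 0; p; - q; 0];
        [:: 0; 0; 0; 0; q; p; 0];
        [:: 0; 0; 0; 0; 0; 0; 0]] i)`_j.

(* Coordinates of the right eigenvectors in [polar_frame], where sg is the sign of
   kappa: they are smooth and invertible also at H = 0 and at a = 0. *)
Definition magnetic_coords (sg : R) y : 'M[R]_7 :=
  let s := alfven y in let a := y.2 in let cf := fast y in let g := slow_ratio y in
  let rho := dens y.1 in
  let uf := (s * a) ^+ 2 / cf - cf in let us := s * a * (g^-1 - g) in
  let pf := s ^+ 2 * (sg * a) / cf in let ps := s * sg / g in
  let df := rho * ((s * a) ^+ 2 / cf ^+ 2 - 1) in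
  let ds := rho * ((g ^+ 2)^-1 - 1) in
  \matrix_(i < 7, j < 7)
    (nth [::]
    [:: [:: uf; 0; us; 0; us; 0; uf];
        [:: pf; 0; ps; 0; ps; 0; pf];
        [:: 0; s * sg; 0; 0; 0; s * sg; 0];
        [:: df; 0; ds; - (rho / gamma); - ds; 0; - df];
        [:: -1; 0; -1; 0; 1; 0; 1];
        [:: 0; -1; 0; 0; 0; 1; 0];
        [:: 0; 0; 0; 1; 0; 0; 0]] i)`_j.

(** For kappa = 0 the given eigenvectors are a basis for every H, so plain components suffice; the
    entropy column uses dp_S / c^2 = rho / gamma. *)
Definition nonmagnetic_coords y : 'M[R]_7 :=
  let cf := fast y in let c2 := sound2 y in let rho := dens y.1 in
  let h2 := H2 y.1 in let h3 := H3 y.1 in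
  \matrix_(i < 7, j < 7)
    (nth [::]
    [:: [:: -1; 0; 0; 0; 0; 0; -1];
        [:: 0; 1; 0; 0; 0; 0; 0];
        [:: 0; 0; 1; 0; 0; 0; 0];
        [:: - (rho / cf); 0; 0; - (rho / gamma); - (mu0 * h2 / c2); - (mu0 * h3 / c2); rho / cf];
        [:: - (h2 / cf); 0; 0; 0; 1; 0; h2 / cf];
        [:: - (h3 / cf); 0; 0; 0; 0; 1; h3 / cf];
        [:: 0; 0; 0; 1; 0; 0; 0]] i)`_j.

Lemma polar_frame_unit Phi : H2 Phi ^+ 2 + H3 Phi ^+ 2 <> 0 -> polar_frame Phi \in unitmx.
Proof.
move=> /eqP q0; apply: unitmx_injective => v Ev.
have E i : (polar_frame Phi *m v) i 0 = 0 by rewrite Ev mxE.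
have D : H2 Phi * - H2 Phi - H3 Phi * H3 Phi != 0.
  have -> : H2 Phi * - H2 Phi - H3 Phi * H3 Phi = - (H2 Phi ^+ 2 + H3 Phi ^+ 2) by ring.
  by rewrite oppr_eq0.
have := E (ix 1); have := E (ix 2); have := E (ix 3); have := E (ix 4).
have := E (ix 5); have := E (ix 6); have := E (ix 7).
rewrite !mxE !sum7 !mxE !val_ix //= !mul0r !add0r !addr0 !mul1r.
move=> v7 E6 E5 v4 E3 E2 v1.
have [v2 v3] := elim2 D E2 E3; have [v5 v6] := elim2 D E5 E6.
by apply/colP; apply: forall_ord7; rewrite mxE.
Qed.

(** Right- and left-going families differ by signs, so the system decouples. The velocity rows
    involve only the sums v1 + v7, v3 + v5, v2 + v6, the density and magnetic rows only the
    differences, once v4 = 0. The two 2 x 2 blocks have determinants that are nonzero multiples of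
    the gap between the squared fast and slow speeds. *)
Lemma magnetic_coords_unit sg y : regular y -> sg ^+ 2 = 1 -> magnetic_coords sg y \in unitmx.
Proof.
move=> ry sg2; have [r0 _] := ry.
have s0 := alfven_gt0 mu0_gt0 ry; have cf0 := fast_gt0 mu0_gt0 A_gt0 gamma_gt1 ry.
have g0 := slow_ratio_gt0 mu0_gt0 A_gt0 gamma_gt1 ry.
have gap := fast_slow_gap mu0_gt0 A_gt0 gamma_gt1 ry.
have sgn0 : sg != 0 by apply: contra_eq_neq sg2 => ->; rewrite expr0n /= eq_sym oner_eq0.
apply: unitmx_injective => v Ev.
have E i : (magnetic_coords sg y *m v) i 0 = 0 by rewrite Ev mxE.
have := E (ix 1); have := E (ix 2); have := E (ix 3); have := E (ix 4).
have := E (ix 5); have := E (ix 6); have := E (ix 7).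
rewrite !mxE !sum7 !mxE !val_ix //=.
set s := alfven y in s0 gap *; set cf := fast y in cf0 gap *.
set g := slow_ratio y in g0 gap *; set a := y.2 in gap *; set rho := dens y.1 in r0 *.
have sn : s != 0 by rewrite gt_eqF.
have cfn : cf != 0 by rewrite gt_eqF.
have gn : g != 0 by rewrite gt_eqF.
have rn : rho != 0 by rewrite gt_eqF.
have gapn : cf ^+ 2 - (s * a * g) ^+ 2 != 0 by rewrite gt_eqF.
rewrite !mul0r !add0r !addr0 !mul1r => E7 E6 E5 E4 E3 E2 E1.
have [v17 v35] : v (ix 1) 0 + v (ix 7) 0 = 0 /\ v (ix 3) 0 + v (ix 5) 0 = 0.
  apply: (@elim2 _ ((s * a) ^+ 2 / cf - cf) (s * a * (g^-1 - g)) (s ^+ 2 * (sg * a) / cf) (s * sg /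
    g)).
  - have -> : ((s * a) ^+ 2 / cf - cf) * (s * sg / g) - (s * a * (g^-1 - g)) * (s ^+ 2 * (sg * a) /
    cf) =
      - (s * sg / (g * cf)) * (cf ^+ 2 - (s * a * g) ^+ 2) by field; rewrite cfn gn.
    by rewrite mulf_neq0 // oppr_eq0 mulf_neq0 ?mulf_neq0 // invr_neq0 // mulf_neq0.
  - by rewrite -[RHS]E1; ring.
  - by rewrite -[RHS]E2; ring.
have v26 : v (ix 2) 0 + v (ix 6) 0 = 0.
  apply: (mulfI (mulf_neq0 sn sgn0)); rewrite mulr0 -[RHS]E3; ring.
have [vd17 vd35] : v (ix 1) 0 - v (ix 7) 0 = 0 /\ v (ix 3) 0 - v (ix 5) 0 = 0.
  apply: (@elim2 _ (rho * ((s * a) ^+ 2 / cf ^+ 2 - 1)) (rho * ((g ^+ 2)^-1 - 1)) (-1) (-1)).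
  - have -> : rho * ((s * a) ^+ 2 / cf ^+ 2 - 1) * -1 - rho * ((g ^+ 2)^-1 - 1) * -1 =
      rho / (g ^+ 2 * cf ^+ 2) * (cf ^+ 2 - (s * a * g) ^+ 2) by field; rewrite cfn gn.
    by rewrite mulf_neq0 // mulf_neq0 // invr_neq0 // mulf_neq0 // expf_neq0.
  - by rewrite -[RHS]E4 E7; ring.
  - by rewrite -[RHS]E5; ring.
apply/colP; apply: forall_ord7; rewrite mxE; lra.
Qed.

(** The magnetic rows express v5 and v6 through v7 - v1. The density row then becomes a positive
    multiple of v7 - v1, and the first row gives v1 + v7 = 0. *)
Lemma nonmagnetic_coords_unit y : regular y -> nonmagnetic_coords y \in unitmx.
Proof.
move=> ry; have [r0 _] := ry.
have cf0 := fast_gt0 mu0_gt0 A_gt0 gamma_gt1 ry.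
have c0 := sound2_gt0 A_gt0 gamma_gt1 r0.
apply: unitmx_injective => v Ev.
have E i : (nonmagnetic_coords y *m v) i 0 = 0 by rewrite Ev mxE.
have := E (ix 1); have := E (ix 2); have := E (ix 3); have := E (ix 4).
have := E (ix 5); have := E (ix 6); have := E (ix 7).
rewrite !mxE !sum7 !mxE !val_ix //=.
set cf := fast y in cf0 *; set c2 := sound2 y in c0 *; set rho := dens y.1 in r0 *.
set h2 := H2 y.1; set h3 := H3 y.1.
have cfn : cf != 0 by rewrite gt_eqF.
have cn : c2 != 0 by rewrite gt_eqF.
rewrite !mul0r !add0r !addr0 !mul1r => E7 E6 E5 E4 E3 E2 E1.
have p0 : 0 < (rho + mu0 / c2 * (h2 ^+ 2 + h3 ^+ 2)) / cf.
  rewrite divr_gt0 // ltr_pwDl // mulr_ge0 ?addr_ge0 ?sqr_ge0 //.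
  by rewrite divr_ge0 // ltW.
have d17 : v (ix 7) 0 - v (ix 1) 0 = 0.
  have pn : (rho + mu0 / c2 * (h2 ^+ 2 + h3 ^+ 2)) / cf != 0 by rewrite gt_eqF.
  apply: (mulfI pn); rewrite mulr0 -[RHS]E4 E7.
  have -> : v (ix 5) 0 = - (h2 / cf) * (v (ix 7) 0 - v (ix 1) 0).
    by apply/eqP; rewrite -subr_eq0 -[X in _ == X]E5; apply/eqP; ring.
  have -> : v (ix 6) 0 = - (h3 / cf) * (v (ix 7) 0 - v (ix 1) 0).
    by apply/eqP; rewrite -subr_eq0 -[X in _ == X]E6; apply/eqP; ring.
  by rewrite mulr0 add0r; field; rewrite cfn cn.
have v1 : v (ix 1) 0 = 0 by lra.
have v7 : v (ix 7) 0 = 0 by lra.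
rewrite v1 v7 !mulr0 !add0r !addr0 in E5 E6.
by apply/colP; apply: forall_ord7; rewrite mxE.
Qed.

End frames.

Section vec7_facts.
Context {R : realType}.
Implicit Types (a b c d e f g : R) (x : 'cV[R]_7).

Lemma vec7_entries a b c d e f g (x := vec7 a b c d e f g) :
  (x (ix 1) 0 = a) * (x (ix 2) 0 = b) * (x (ix 3) 0 = c) * (x (ix 4) 0 = d) *
  (x (ix 5) 0 = e) * (x (ix 6) 0 = f) * (x (ix 7) 0 = g).
Proof. by do !split; rewrite /x mxE ix_simpl. Qed.

Lemma vec7_eta x :
  x = vec7 (x (ix 1) 0) (x (ix 2) 0) (x (ix 3) 0) (x (ix 4) 0) (x (ix 5) 0) (x (ix 6) 0) (x (ix 7)
    0).
Proof. by apply/colP; apply: forall_ord7; rewrite vec7_entries. Qed.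

Lemma scale_vec7 k a b c d e f g :
  k *: vec7 a b c d e f g = vec7 (k * a) (k * b) (k * c) (k * d) (k * e) (k * f) (k * g).
Proof. by apply/colP; apply: forall_ord7; rewrite mxE !vec7_entries. Qed.

Lemma mhd_matrix_mul mu0 A gamma kappa Phi a b c d e f g :
  mhd_matrix mu0 A gamma kappa Phi *m vec7 a b c d e f g =
  let u := u1 Phi in let rho := dens Phi in
  vec7 (u * a + sound A gamma Phi ^+ 2 / rho * d + mu0 * H2 Phi / rho * e
          + mu0 * H3 Phi / rho * f + dp_S A gamma Phi / rho * g)
       (u * b - mu0 * kappa / rho * e) (u * c - mu0 * kappa / rho * f)
       (rho * a + u * d) (H2 Phi * a - kappa * b + u * e) (H3 Phi * a - kappa * c + u * f)
       (u * g).
Proof.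
apply/colP; apply: forall_ord7; rewrite mxE sum7 /= !vec7_entries !mxE !ix_simpl /=; ring.
Qed.

Lemma polar_frame_mul Phi a b c d e f g :
  polar_frame Phi *m vec7 a b c d e f g =
  vec7 a (H2 Phi * b + H3 Phi * c) (H3 Phi * b - H2 Phi * c) d
    (H2 Phi * e + H3 Phi * f) (H3 Phi * e - H2 Phi * f) g.
Proof.
apply/colP; apply: forall_ord7; rewrite mxE sum7 /= !vec7_entries !mxE !ix_simpl /=; ring.
Qed.

End vec7_facts.

(** * The given speeds and eigenvectors as functions of (Phi, |kappa|) *)

Section defs_on_states.
Context {R : realType} (mu0 A gamma kappa : R).
Hypotheses (mu0_gt0 : 0 < mu0) (A_gt0 : 0 < A) (gamma_gt1 : 1 < gamma).
Local Notation V := ('cV[R]_7 * R)%type.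
Local Notation sound2 := (sound2 A gamma).
Local Notation alfven := (alfven mu0).
Local Notation fast := (fast mu0 A gamma).
Local Notation slow_ratio := (slow_ratio mu0 A gamma).
Local Notation bsum := (bsum mu0 A gamma).
Local Notation regular := (regular mu0 A gamma).
Local Notation speed := (speed mu0 A gamma).
Implicit Types (y : V) (Phi : 'cV[R]_7).

Local Notation at_kappa Phi := ((Phi, `|kappa|) : V).

Lemma dp_densE Phi : 0 < dens Phi -> dp_dens A gamma Phi = sound2 (at_kappa Phi).
Proof.
move=> r0; rewrite /dp_dens /pressure /sound2 derive1Ml; last first.
  by apply: derivable_powR; rewrite in_itv /= r0.
by congr (_ * _); rewrite powR_derive1 // in_itv /= r0.
Qed.

Lemma dp_SE Phi : dp_S A gamma Phi = A * expR (entropy Phi) * dens Phi `^ gamma.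
Proof.
rewrite /dp_S /pressure derive1Mr; last by apply: derivableM.
congr (_ * _); rewrite derive1Ml //; congr (_ * _).
by rewrite derive1E; case: (is_derive_expR (entropy Phi)).
Qed.

Lemma sound_sqr Phi : 0 < dens Phi -> sound A gamma Phi ^+ 2 = sound2 (at_kappa Phi).
Proof.
move=> r0; rewrite /sound sqr_sqrtr dp_densE // ltW //.
exact: (@sound2_gt0 R A gamma A_gt0 gamma_gt1 (at_kappa Phi)).
Qed.

(** Both sides equal the pressure. The identity reconciles the two forms of r_4, with dp_S / c^2 for
    kappa = 0 and with rho / gamma otherwise. *)
Lemma dp_S_sound Phi : 0 < dens Phi ->
  dp_S A gamma Phi = dens Phi / gamma * sound2 (at_kappa Phi).
Proof.
move=> r0; have g0 : gamma != 0 by rewrite gt_eqF // (lt_trans _ gamma_gt1).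
rewrite dp_SE /sound2 /= powRB; last by rewrite gt_eqF // implybT.
by rewrite powRr1 ?ltW //; field; rewrite g0 gt_eqF.
Qed.

Lemma bquadE Phi : 0 < dens Phi -> bquad mu0 A gamma kappa Phi = bsum (at_kappa Phi).
Proof. by move=> r0; rewrite /bquad sound_sqr // /bsum /= real_normK // num_real. Qed.

Lemma discrE Phi : 0 < dens Phi ->
  discr mu0 A gamma kappa Phi = disc mu0 A gamma (at_kappa Phi).
Proof.
by move=> r0; rewrite /discr bquadE // sound_sqr // /disc /= real_normK // num_real.
Qed.

Lemma CfE Phi : 0 < dens Phi -> Cf mu0 A gamma kappa Phi = fast (at_kappa Phi).
Proof. by move=> r0; rewrite /Cf bquadE // discrE. Qed.

Lemma CsE Phi : regular (at_kappa Phi) ->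
  Cs mu0 A gamma kappa Phi = alfven (at_kappa Phi) * `|kappa| * slow_ratio (at_kappa Phi).
Proof.
move=> ry; have [r0 d0] := ry; rewrite /Cs bquadE // discrE //.
have s0 := alfven_gt0 mu0_gt0 ry.
have g0 := slow_ratio_gt0 mu0_gt0 A_gt0 gamma_gt1 ry.
rewrite -(slow_sqr mu0_gt0 A_gt0 gamma_gt1 ry) sqrtr_sqr ger0_norm //.
by do ![exact: ltW | exact: normr_ge0 | apply: mulr_ge0].
Qed.

Lemma lambda_speed i Phi : regular (at_kappa Phi) ->
  lambda mu0 A gamma kappa i Phi = speed i (at_kappa Phi).
Proof.
by move=> ry; have [r0 _] := ry; rewrite /lambda CfE // CsE.
Qed.

Lemma reig_magnetic k Phi : regular (at_kappa Phi) -> kappa != 0 ->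
  reig mu0 A gamma kappa k Phi =
  polar_frame Phi *m col k (magnetic_coords mu0 A gamma (Num.sg kappa) (at_kappa Phi)).
Proof.
move=> ry k0; have [r0 _] := ry.
have cf0 : fast (at_kappa Phi) != 0 by rewrite gt_eqF // fast_gt0.
have g0 : slow_ratio (at_kappa Phi) != 0 by rewrite gt_eqF // slow_ratio_gt0.
have s0 : alfven (at_kappa Phi) != 0 by rewrite gt_eqF //; exact: (alfven_gt0 mu0_gt0 ry).
have a0 : `|kappa| != 0 by rewrite normr_eq0.
have sg0 : Num.sg kappa != 0 by rewrite sgr_eq0.
(* Each 1 / kappa in the eigenvectors meets a factor |kappa| from C_a^2, C_a^2 / C_s or C_a, so only
   the sign is left. *)
have kV : kappa^-1 = Num.sg kappa / `|kappa|.
  by apply: (mulfI k0); rewrite divff // mulrA [kappa * _]mulrC -normrEsg divff.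
rewrite /reig (negbTE k0) /r_magnetic /Rpm CfE // CsE // /Ca -/(alfven (at_kappa Phi)).
move: cf0 g0 s0 a0 kV; rewrite /magnetic_coords /polar_frame /=.
set y := at_kappa Phi; set cf := fast y; set g := slow_ratio y; set s := alfven y.
set a := `|kappa|; set sg := Num.sg kappa => cf0 g0 s0 a0 kV.
clearbody cf g s a sg.
move: k; apply: forall_ord7; rewrite !ix_simpl /= [col _ _]vec7_eta !mxE !ix_simpl /=;
  rewrite polar_frame_mul; congr vec7; rewrite ?invfM ?kV.
all: by [ring | field; rewrite ?cf0 ?g0 ?s0 ?a0].
Qed.

Lemma reig_nonmagnetic k Phi : regular (at_kappa Phi) -> kappa = 0 ->
  reig mu0 A gamma kappa k Phi = col k (nonmagnetic_coords mu0 A gamma (at_kappa Phi)).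
Proof.
move=> ry k0; have [r0 _] := ry.
have c0 : sound2 (at_kappa Phi) != 0.
  by rewrite gt_eqF //; exact: (@sound2_gt0 R A gamma A_gt0 gamma_gt1 (at_kappa Phi)).
have g0 : gamma != 0 by rewrite gt_eqF // (lt_trans _ gamma_gt1).
rewrite /reig k0 eqxx -k0 /r_nonmagnetic CfE // sound_sqr // dp_S_sound //.
move: k; apply: forall_ord7; rewrite !ix_simpl /= [RHS]vec7_eta !mxE !ix_simpl //=.
by rewrite mulfK.
Qed.

(** All components but the first agree identically; the first is the quadratic equation for K^2,
    with roots C_f^2 and C_s^2. *)
Lemma Rpm_eigen (sg K : R) Phi : kappa != 0 -> K != 0 -> 0 < dens Phi -> sg = 1 \/ sg = -1 ->
  let ca2 := Ca mu0 kappa Phi ^+ 2 in let c2 := sound A gamma Phi ^+ 2 in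
  ca2 * c2 = K ^+ 2 * (bquad mu0 A gamma kappa Phi - K ^+ 2) ->
  mhd_matrix mu0 A gamma kappa Phi *m Rpm mu0 kappa sg K Phi =
  (u1 Phi + sg * K) *: Rpm mu0 kappa sg K Phi.
Proof.
move=> k0 Kn0 r0 sgE /=.
have rn0 : dens Phi != 0 by rewrite gt_eqF.
have ca2E : Ca mu0 kappa Phi ^+ 2 = mu0 / dens Phi * kappa ^+ 2.
  by rewrite exprMn sqr_sqrtr ?real_normK ?num_real // ltW // divr_gt0.
rewrite /bquad ca2E => root.
rewrite /Rpm mhd_matrix_mul scale_vec7 /= ca2E; move: root.
set c2 := sound _ _ _ ^+ 2; set h2 := H2 Phi; set h3 := H3 Phi; set u := u1 Phi.
set rho := dens Phi in r0 rn0 *; clearbody c2 h2 h3 u rho => root.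
have [->|->] := sgE; congr vec7; try by field; rewrite ?Kn0 ?k0 ?rn0.
- apply/eqP; rewrite -subr_eq0; apply/eqP.
  transitivity ((mu0 / rho * kappa ^+ 2 * c2 -
    K ^+ 2 * (mu0 / rho * (kappa ^+ 2 + h2 ^+ 2 + h3 ^+ 2) + c2 - K ^+ 2)) / K ^+ 2).
    by field; rewrite ?Kn0 ?rn0.
  by rewrite root subrr mul0r.
- apply/eqP; rewrite -subr_eq0; apply/eqP.
  transitivity (- (mu0 / rho * kappa ^+ 2 * c2 -
    K ^+ 2 * (mu0 / rho * (kappa ^+ 2 + h2 ^+ 2 + h3 ^+ 2) + c2 - K ^+ 2)) / K ^+ 2).
    by field; rewrite ?Kn0 ?rn0.
  by rewrite root subrr oppr0 mul0r.
Qed.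

Lemma alfven_eigen (x e : R) Phi : kappa != 0 -> 0 < dens Phi ->
  x ^+ 2 = mu0 / dens Phi * kappa ^+ 2 -> e = 1 \/ e = -1 ->
  let r := vec7 0 (x * H3 Phi / kappa) (- (x * H2 Phi / kappa)) 0
    (- e * H3 Phi) (e * H2 Phi) 0 in
  mhd_matrix mu0 A gamma kappa Phi *m r = (u1 Phi + e * x) *: r.
Proof.
move=> k0 r0 xE eE /=; have rn0 : dens Phi != 0 by rewrite gt_eqF.
have muE : mu0 / dens Phi = x ^+ 2 / kappa ^+ 2.
  by rewrite xE mulfK // expf_neq0.
rewrite mhd_matrix_mul scale_vec7 /=.
have E t : mu0 * t / dens Phi = x ^+ 2 / kappa ^+ 2 * t by rewrite -muE mulrAC.
rewrite !E; have [->|->] := eE; congr vec7; by field; rewrite ?k0 ?rn0.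
Qed.

Lemma eigen_fields k Phi : regular (at_kappa Phi) ->
  mhd_matrix mu0 A gamma kappa Phi *m reig mu0 A gamma kappa k Phi =
  lambda mu0 A gamma kappa k Phi *: reig mu0 A gamma kappa k Phi.
Proof.
move=> ry; have [r0 _] := ry.
have c0 : 0 < sound2 (at_kappa Phi).
  exact: (@sound2_gt0 R A gamma A_gt0 gamma_gt1 (at_kappa Phi)).
have g0 : gamma != 0 by rewrite gt_eqF // (lt_trans _ gamma_gt1).
have f0 := fast_gt0 mu0_gt0 A_gt0 gamma_gt1 ry.
have fq := fast_quadratic mu0_gt0 A_gt0 gamma_gt1 ry.
have s0 := alfven_gt0 mu0_gt0 ry.
have ss := sound_sqr r0; have dS := dp_S_sound r0.
have r0' : dens Phi != 0 by rewrite gt_eqF.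
have [k0|kn0] := eqVneq kappa 0.
{ rewrite lambda_speed //.
  have z : (at_kappa Phi).2 = 0 by rewrite /= k0 normr0.
  have fq0 : fast (at_kappa Phi) ^+ 2 = bsum (at_kappa Phi).
    have f2 : fast (at_kappa Phi) ^+ 2 != 0 by rewrite expf_neq0 // gt_eqF.
    apply/esym/eqP; rewrite -subr_eq0; apply/eqP/(mulfI f2).
    by rewrite mulr0 fq z mulr0 expr0n mul0r.
  have kb : (kappa == 0) = true by rewrite k0 eqxx.
  rewrite /reig kb /r_nonmagnetic CfE //.
  move: fq0 c0 f0 ss dS; rewrite /speed /bsum z /=.
  set c2 := sound2 _; set cf := fast _ => fq0 c0 f0 ss dS; clearbody c2 cf.
  have c0' : c2 != 0 by rewrite gt_eqF.
  have f0' : cf != 0 by rewrite gt_eqF.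
  have fqE : c2 = cf ^+ 2 - mu0 / dens Phi * (H2 Phi ^+ 2 + H3 Phi ^+ 2).
    by rewrite fq0; ring.
  move: k; apply: forall_ord7; rewrite !ix_simpl /= ?k0 ?normr0 mhd_matrix_mul scale_vec7 /= ?ss
    ?dS;
    congr vec7.
  all: try by ring.
  all: try by field; rewrite ?c0' ?f0' ?r0' ?g0.
  all: by rewrite fqE; field; rewrite ?c0' ?f0' ?r0' ?g0. }
have kb : (kappa == 0) = false by apply/negbTE.
have a0 : 0 < `|kappa| by rewrite normr_gt0.
have ca2E : Ca mu0 kappa Phi ^+ 2 = mu0 / dens Phi * kappa ^+ 2.
  by rewrite exprMn sqr_sqrtr ?real_normK ?num_real // ltW // divr_gt0.
have caE : Ca mu0 kappa Phi = alfven (at_kappa Phi) * `|kappa| by [].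
have gap := fast_slow_gap mu0_gt0 A_gt0 gamma_gt1 ry.
have fK : Cf mu0 A gamma kappa Phi != 0 by rewrite CfE // gt_eqF.
have sK : Cs mu0 A gamma kappa Phi != 0.
  rewrite CsE // gt_eqF //; apply: mulr_gt0; first exact: mulr_gt0.
  exact: (slow_ratio_gt0 mu0_gt0 A_gt0 gamma_gt1 ry).
have fast_root : Ca mu0 kappa Phi ^+ 2 * sound A gamma Phi ^+ 2 =
    Cf mu0 A gamma kappa Phi ^+ 2 * (bquad mu0 A gamma kappa Phi - Cf mu0 A gamma kappa Phi ^+ 2).
  by rewrite ss CfE // bquadE // caE fq.
(* The relation is symmetric in the two roots, whose sum is [bquad]. *)
have slow_root : Ca mu0 kappa Phi ^+ 2 * sound A gamma Phi ^+ 2 =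
    Cs mu0 A gamma kappa Phi ^+ 2 * (bquad mu0 A gamma kappa Phi - Cs mu0 A gamma kappa Phi ^+ 2).
  have E : Cs mu0 A gamma kappa Phi ^+ 2 = bquad mu0 A gamma kappa Phi - Cf mu0 A gamma kappa Phi
    ^+ 2.
    rewrite CsE // slow_sqr // bquadE // CfE // (sqr_sqrtr (ltW (fast2_gt0 mu0_gt0 A_gt0 gamma_gt1
      ry))).
    by field.
  by rewrite fast_root E; ring.
rewrite /reig kb /lambda /r_magnetic; move: k; apply: forall_ord7; rewrite !ix_simpl /=.
- by rewrite Rpm_eigen ?mul1r //; left.
- have := alfven_eigen kn0 r0 ca2E (or_introl erefl).
  by rewrite /= !mul1r mulN1r.
- by rewrite Rpm_eigen ?mul1r //; left.
- rewrite mhd_matrix_mul scale_vec7 /= ss dS; congr vec7; first [ring | by field; rewrite ?r0' ?g0].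
- by rewrite Rpm_eigen ?mulN1r //; right.
- have := alfven_eigen kn0 r0 ca2E (or_intror erefl).
  by rewrite /= opprK !mul1r !mulN1r.
- by rewrite Rpm_eigen ?mulN1r //; right.
Qed.

End defs_on_states.

(** * Interaction coefficients of a frame *)

Section C1_extra.
Context {R : realType}.

Lemma C1on_sum (V : normedModType R) (U : set V) n (f : 'I_n -> V -> R) : open U ->
  (forall i, C1on U (f i)) -> C1on U (fun y => \sum_i f i y).
Proof.
move=> oU Cf.
suff H (r : seq 'I_n) : C1on U (fun y => \sum_(i <- r) f i y) by exact: H.
elim: r => [|i r IH].
  apply: (C1on_eq oU _ (C1on_cst 0 oU)) => x _; by rewrite big_nil.
apply: (C1on_eq oU _ (C1onD oU (Cf i) IH)) => x _; by rewrite big_cons.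
Qed.

Lemma open_slice (V W : normedModType R) (U : set (V * W)) (b : W) :
  open U -> open [set x | U (x, b)].
Proof.
move=> oU; rewrite openE => x /= Ux.
have cp : {for x, continuous (fun y : V => (y, b))}.
  have c1 : {for x, continuous (@id V)} by exact: cvg_id.
  have c2 : {for x, continuous (fun _ : V => b)} by exact: cvg_cst.
  exact: continuous_pairing c1 c2.
by apply: cp; apply: open_nbhs_nbhs; split.
Qed.

Lemma C1on_sliceC1 (V W : normedModType R) (U : set (V * W)) (f : V * W -> R) (b : W) :
  open U -> C1on U f -> C1on [set x | U (x, b)] (fun x => f (x, b)).
Proof.
move=> oU Cf; apply: (C1on_intro (df := fun x v => 'd f (x, b) (v, 0)) (open_slice b oU)).
- by move=> x Ux; case: (C1on_slice Cf Ux).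
- by move=> x v Ux; case: (C1on_slice Cf Ux) => _ E _; exact: E.
- by move=> x v Ux; case: (C1on_slice Cf Ux) => _ _; exact.
Qed.

Lemma diff_sumM (V : normedModType R) n (p q : 'I_n -> V -> R) x v :
  (forall i, differentiable (p i) x) -> (forall i, differentiable (q i) x) ->
  'd (fun y => \sum_i p i y * q i y) x v =
  \sum_i (p i x * 'd (q i) x v + q i x * 'd (p i) x v).
Proof.
move=> dp dq.
have -> : (fun y => \sum_i p i y * q i y) = \sum_i (p i * q i).
  by apply/funext => y; rewrite fct_sumE.
have dpq i : differentiable (p i * q i) x by exact: differentiableM.
rewrite -deriveE; last exact: differentiable_sum.
rewrite derive_sum; last by move=> i; exact: diff_derivable.
apply: eq_bigr => i _.
have E : 'D_v (p i * q i) x = p i x * 'D_v (q i) x + q i x * 'D_v (p i) x.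
  exact: (deriveM (diff_derivable (dp i)) (diff_derivable (dq i))).
by rewrite E (deriveE v (dp i)) (deriveE v (dq i)).
Qed.

Lemma direction_expand n (g : 'cV[R]_n * R -> R) y (v : 'cV[R]_n) :
  'd g y (v, 0) = \sum_j v j 0 * 'd g y (delta_mx j 0, 0).
Proof.
have -> : ((v, 0) : 'cV[R]_n * R) = \sum_j v j 0 *: ((delta_mx j 0, 0) : 'cV[R]_n * R).
  rewrite [RHS]surjective_pairing; congr pair.
    rewrite {1}[v]matrix_sum_delta (big_morph fst (id1 := 0) (op1 := +%R)) //.
    by apply: eq_bigr => j _; rewrite big_ord1.
  rewrite (big_morph snd (id1 := 0) (op1 := +%R)) //.
  by rewrite big1 // => j _; rewrite /= scaler0.
by rewrite linear_sum; apply: eq_bigr => j _; rewrite linearZ.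
Qed.

(** Here the direction moves with the point, as it does for derivatives along the eigenvector
    fields. *)
Lemma C1on_direction n (U : set ('cV[R]_n * R)) (g : 'cV[R]_n * R -> R)
    (v : 'cV[R]_n * R -> 'cV[R]_n) y :
  C1on U g -> U y -> (forall j, {for y, continuous (fun z => v z j 0)}) ->
  {for y, continuous (fun z => 'd g z (v z, 0))}.
Proof.
move=> Cg Uy cv.
have -> : (fun z => 'd g z (v z, 0)) = (fun z => \sum_j v z j 0 * 'd g z (delta_mx j 0, 0)).
  by apply/funext => z; exact: direction_expand.
have [_ cg] := Cg y Uy.
apply: cvg_big => [|j _]; first exact: add_continuous.
apply: cvgM; [exact: cv|exact: cg].
Qed.

End C1_extra.

Section frame_coefficients.
Context {R : realType}.
Local Notation V := ('cV[R]_7 * R)%type.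
Variables (U : set V) (lamV : 'I_7 -> V -> R).
Variables (F N : 'cV[R]_7 -> 'M[R]_7) (f : V -> 'M[R]_7).
Hypothesis oU : open U.
Hypothesis C1_lamV : forall i, C1on U (lamV i).
Hypothesis C1_f : forall i j, C1on U (fun y => f y i j).
Hypothesis unit_f : forall y, U y -> f y \in unitmx.
Hypothesis C1_F : forall i j, C1on setT (fun Phi => F Phi i j).
Hypothesis diff_F : forall Phi x i j,
  'd (fun Psi => F Psi i j) Phi (F Phi *m x) = (F Phi *m N x) i j.
Hypothesis cont_N : forall i j, continuous (fun x => N x i j).
Implicit Types (y : V) (Phi : 'cV[R]_7).

Definition field_of k y : 'cV[R]_7 := F y.1 *m col k (f y).

(* The derivative of the k-th field along the m-th one, in the frame F. *)
Definition dcoord k m y : 'cV[R]_7 :=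
  \col_b 'd (fun z => f z b k) y (field_of m y, 0) + N (col m (f y)) *m col k (f y).

(** The extension of l_i (Dr_k r_m). Since l_i is a row of f^-1 F^-1 and Dr_k r_m = F [dcoord], the
    frame F cancels, and only f, invertible also at H = 0, is inverted. *)
Definition christoffel i k m y : R := (invmx (f y) *m dcoord k m y) i 0.

Definition gamma_ext i k m y : R :=
  if k == i then - (lamV i y - lamV m y) * (christoffel i i m y - christoffel i m i y)
  else - (lamV k y - lamV m y) * christoffel i k m y.

Definition c_ext i m y : R := 'd (lamV i) y (field_of m y, 0).

Let cvg_f y : U y -> f @ y --> f y.
Proof. by move=> Uy; apply/cvg_mxP => i j; exact: (C1on_continuous (C1_f i j) Uy). Qed.

Let cvg_col k y : U y -> col k (f z) @[z --> y] --> col k (f y).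
Proof.
move=> Uy; apply/cvg_mxP => i j; under eq_fun do rewrite mxE; rewrite mxE.
exact: (C1on_continuous (C1_f i k) Uy).
Qed.

Let cvg_field k y : U y -> field_of k z @[z --> y] --> field_of k y.
Proof.
move=> Uy; apply: cvg_mulmx; last exact: cvg_col.
apply/cvg_mxP => i j.
have c1 : {for y, continuous (fst : V -> 'cV[R]_7)} by exact: cvg_fst.
exact: (continuous_comp c1 (C1on_continuous (C1_F i j) I)).
Qed.

Let field_entry k j y : U y -> {for y, continuous (fun z => field_of k z j 0)}.
Proof. by move=> /(cvg_field (k := k))/cvg_mxP; exact. Qed.

Lemma c_ext_continuous i m y : U y -> {for y, continuous (c_ext i m)}.
Proof.
by move=> Uy; apply: (C1on_direction (C1_lamV i) Uy) => j; exact: field_entry.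
Qed.

Lemma christoffel_continuous i k m y : U y -> {for y, continuous (christoffel i k m)}.
Proof.
move=> Uy; have H : invmx (f z) *m dcoord k m z @[z --> y] --> invmx (f y) *m dcoord k m y.
  apply: cvg_mulmx; first by case: (cvg_invmx (unit_f Uy) (cvg_f Uy)).
  apply: cvgD.
    apply/cvg_mxP => b j; under eq_fun do rewrite mxE; rewrite mxE.
    by apply: (C1on_direction (C1_f b k) Uy) => j'; exact: field_entry.
  apply: cvg_mulmx; last exact: cvg_col.
  apply/cvg_mxP => a b.
  exact: (continuous_cvg _ (@cont_N a b _) (cvg_col (k := m) Uy)).
by move/cvg_mxP: H; exact.
Qed.

Lemma gamma_ext_continuous i k m y : U y -> {for y, continuous (gamma_ext i k m)}.
Proof.
move=> Uy; have cl j : {for y, continuous (lamV j)} := C1on_continuous (C1_lamV j) Uy.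
have cG a b c := @christoffel_continuous a b c y Uy.
rewrite /gamma_ext; case: eqP => _.
  exact: continuousM (continuousN (continuousB (cl i) (cl m))) (continuousB (cG i i m) (cG i m i)).
exact: continuousM (continuousN (continuousB (cl k) (cl m))) (cG i k m).
Qed.

Section slice.
Variables (mu0 A gamma kappa b : R).
Hypothesis field_reig : forall k Phi, U (Phi, b) -> reig mu0 A gamma kappa k Phi = field_of k (Phi,
  b).
Hypothesis speed_lambda : forall i Phi, U (Phi, b) -> lambda mu0 A gamma kappa i Phi = lamV i (Phi,
  b).
Hypothesis unit_F : forall Phi, frame_ok kappa Phi -> F Phi \in unitmx.

Local Notation S := [set Phi | U (Phi, b)].
Let oS : open S. Proof. exact: open_slice. Qed.

Lemma C1_lambda i : C1on S (lambda mu0 A gamma kappa i).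
Proof.
have C := C1on_sliceC1 (b := b) oU (C1_lamV i).
by apply: (C1on_eq oS _ C) => Phi UP; rewrite speed_lambda.
Qed.

Let field_entryE k j Phi : field_of k (Phi, b) j 0 = \sum_c F Phi j c * f (Phi, b) c k.
Proof. by rewrite mxE; apply: eq_bigr => c _; rewrite mxE. Qed.

Lemma C1_reig k j : C1on S (fun Phi => reig mu0 A gamma kappa k Phi j 0).
Proof.
have C : C1on S (fun Phi => \sum_c F Phi j c * f (Phi, b) c k).
  apply: (C1on_sum oS) => c; apply: (C1onM oS (C1on_sub (@subsetT _ _) (C1_F j c))).
  exact: (C1on_sliceC1 (b := b) oU (C1_f c k)).
by apply: (C1on_eq oS _ C) => Phi UP; rewrite field_reig.
Qed.

Lemma diff_reig k j Phi v : U (Phi, b) ->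
  'd (fun Psi => reig mu0 A gamma kappa k Psi j 0) Phi v =
  \sum_c (F Phi j c * 'd (fun y => f y c k) (Phi, b) (v, 0)
          + f (Phi, b) c k * 'd (fun Psi => F Psi j c) Phi v).
Proof.
move=> UP; pose h Psi := \sum_c F Psi j c * f (Psi, b) c k.
have dF c : differentiable (fun Psi => F Psi j c) Phi by case: (C1_F j c (I : setT Phi)).
have df c : differentiable (fun Psi => f (Psi, b) c k) Phi.
  by case: (C1on_slice (C1_f c k) UP).
have near_h : {near Phi, (fun Psi => reig mu0 A gamma kappa k Psi j 0) =1 h}.
  have : nbhs Phi S by exact: open_nbhs_nbhs.
  by apply: filterS => Psi UPsi; rewrite field_reig // field_entryE.
have dh : differentiable h Phi.
  by apply: (near_eq_differentiable near_h); case: (C1_reig k j UP).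
transitivity ('d h Phi v).
  rewrite -deriveE; last by case: (C1_reig k j UP).
  by rewrite -deriveE //; exact: near_eq_derive.
rewrite /h diff_sumM //; apply: eq_bigr => c _; congr (_ * _ + _).
by case: (C1on_slice (C1_f c k) UP) => _ E _; exact: E.
Qed.

(** Leibniz rule for r_k = F f_k. The derivative of F along F x is F N(x), so F factors out on the
    left of both terms. *)
Lemma Dr_field k m Phi : U (Phi, b) ->
  Dr mu0 A gamma kappa k m Phi = F Phi *m dcoord k m (Phi, b).
Proof.
move=> UP; apply/colP => j.
rewrite /Dr derive_mx; last first.
  apply/derivable_mxP => i j'; rewrite ord1; apply: diff_derivable.
  by case: (C1_reig k i UP).
rewrite mxE deriveE; last by case: (C1_reig k j UP).
rewrite diff_reig // field_reig // big_split /= mulmxDr mxE; congr (_ + _).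
  by rewrite mxE; apply: eq_bigr => c _; rewrite mxE.
rewrite mulmxA mxE; apply: eq_bigr => c _; rewrite diff_F mulrC; congr (_ * _).
by rewrite mxE.
Qed.

Lemma frame_mxE Phi : U (Phi, b) -> frame_mx mu0 A gamma kappa Phi = F Phi *m f (Phi, b).
Proof.
move=> UP; apply/matrixP => i j; rewrite mxE field_reig // field_entryE mxE.
by apply: eq_bigr.
Qed.

Lemma frame_mx_unit Phi : U (Phi, b) -> frame_ok kappa Phi ->
  frame_mx mu0 A gamma kappa Phi \in unitmx.
Proof. by move=> UP ok; rewrite frame_mxE // unitmx_mul unit_F // unit_f. Qed.

Lemma christoffelE i k m Phi : U (Phi, b) -> frame_ok kappa Phi ->
  (leig mu0 A gamma kappa i Phi *m Dr mu0 A gamma kappa k m Phi) 0 0 =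
  christoffel i k m (Phi, b).
Proof.
move=> UP ok; rewrite leigE Dr_field // /christoffel.
have u := frame_mx_unit UP ok.
suff -> : F Phi *m dcoord k m (Phi, b) =
    frame_mx mu0 A gamma kappa Phi *m (invmx (f (Phi, b)) *m dcoord k m (Phi, b)).
  by rewrite mulKmx.
by rewrite frame_mxE // -mulmxA mulKVmx // unit_f.
Qed.

Lemma gamma_coefE i k m Phi : U (Phi, b) -> frame_ok kappa Phi ->
  gamma_coef mu0 A gamma kappa i k m Phi = gamma_ext i k m (Phi, b).
Proof.
move=> UP ok; rewrite /gamma_coef /gamma_ext !speed_lambda //.
case: eqP => _; last by rewrite christoffelE.
congr (_ * _); rewrite mulmxBr [LHS]mxE [X in _ + X = _]mxE.
by rewrite !christoffelE.
Qed.

Lemma c_coefE i m Phi : U (Phi, b) -> c_coef mu0 A gamma kappa i m Phi = c_ext i m (Phi, b).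
Proof.
move=> UP; rewrite /c_coef /c_ext -field_reig //.
have [d _] := C1_lambda i UP; have [d' E _] := C1on_slice (C1_lamV i) UP.
rewrite -E -(deriveE _ d'); apply: near_eq_derive.
have : nbhs Phi S by exact: open_nbhs_nbhs.
by apply: filterS => Psi UPsi; rewrite speed_lambda.
Qed.

End slice.
End frame_coefficients.

Lemma C1on_ext (R : realType) (V : normedModType R) (U : set V) (f g : V -> R) :
  f =1 g -> C1on U f -> C1on U g.
Proof. by move=> /funext ->. Qed.

Ltac case7 i := pattern i; refine (@forall_ord7 _ _ _ _ _ _ _ _ i); cbv beta.

(** * Smoothness of the coordinate matrices and of the polar frame *)

Section coordinate_matrices.
Context {R : realType} (mu0 A gamma : R).
Hypotheses (mu0_gt0 : 0 < mu0) (A_gt0 : 0 < A) (gamma_gt1 : 1 < gamma).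
Local Notation V := ('cV[R]_7 * R)%type.
Local Notation regular := (regular mu0 A gamma).

Lemma C1_magnetic_coords sg i j : C1on regular (fun y => magnetic_coords mu0 A gamma sg y i j).
Proof.
have oU := @open_regular R mu0 A gamma.
have Cf := C1_fast mu0_gt0 A_gt0 gamma_gt1; have Ca := @C1_alfven R mu0 A gamma mu0_gt0.
have Cs := C1_slow_ratio mu0_gt0 A_gt0 gamma_gt1; have Cp := @C1on_param R 7 _ oU.
have Cd := @C1_density R mu0 A gamma.
have f0 y : regular y -> fast mu0 A gamma y != 0.
  by move=> ry; rewrite gt_eqF // fast_gt0.
have g0 y : regular y -> slow_ratio mu0 A gamma y != 0.
  by move=> ry; rewrite gt_eqF // slow_ratio_gt0.
have f20 y : regular y -> fast mu0 A gamma y ^+ 2 != 0.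
  by move=> ry; rewrite expf_neq0 // f0.
have g20 y : regular y -> slow_ratio mu0 A gamma y ^+ 2 != 0.
  by move=> ry; rewrite expf_neq0 // g0.
rewrite /magnetic_coords; move: oU Cf Ca Cs Cp Cd f0 g0 f20 g20.
move: (regular) (fast mu0 A gamma) (slow_ratio mu0 A gamma) (alfven mu0).
move=> U cf g s oU Cf Ca Cs Cp Cd f0 g0 f20 g20.
refine (C1on_ext (fun y => esym (mxE _ _ i j)) _).
case7 i; case7 j; rewrite !ix_simpl /=; solve_C1; assumption.
Qed.

Lemma C1_nonmagnetic_coords i j : C1on regular (fun y => nonmagnetic_coords mu0 A gamma y i j).
Proof.
have oU := @open_regular R mu0 A gamma.
have Cf := C1_fast mu0_gt0 A_gt0 gamma_gt1; have Cs := @C1_sound R mu0 A gamma.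
have Cd := @C1_density R mu0 A gamma.
have C2 := C1on_state (ix 5) oU; have C3 := C1on_state (ix 6) oU.
have f0 y : regular y -> fast mu0 A gamma y != 0.
  by move=> ry; rewrite gt_eqF // fast_gt0.
have c0 y : regular y -> sound2 A gamma y != 0.
  by case=> r0 _; rewrite gt_eqF // sound2_gt0.
rewrite /nonmagnetic_coords; move: oU Cf Cs Cd C2 C3 f0 c0.
move: (regular) (fast mu0 A gamma) (sound2 A gamma).
move=> U cf c2 oU Cf Cs Cd C2 C3 f0 c0.
refine (C1on_ext (fun y => esym (mxE _ _ i j)) _).
case7 i; case7 j; rewrite !ix_simpl /= /H2 /H3; solve_C1; assumption.
Qed.

End coordinate_matrices.

Section frame_derivatives.
Context {R : realType}.
Implicit Types Phi x v : 'cV[R]_7.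

Let coord_diff (U : set 'cV[R]_7) j : open U -> C1on U (fun Phi => Phi j 0) /\
  forall Phi v, 'd (fun Psi : 'cV[R]_7 => Psi j 0) Phi v = v j 0.
Proof.
move=> oU; pose f Phi : R := Phi j 0.
have lf : linear f by move=> a u v; rewrite /f !mxE.
pose F : {linear 'cV[R]_7 -> R} := HB.pack f (GRing.isLinear.Build _ _ _ _ f lf).
have cF : continuous F by move=> Phi; exact/differentiable_continuous/differentiable_coord.
split; first exact: (C1on_linear (f := F) oU cF).
by move=> Phi v; rewrite -[LHS]/('d F Phi v) diff_lin.
Qed.

Lemma C1_polar_frame i j : C1on setT (fun Phi => polar_frame Phi i j : R).
Proof.
have oT := @openT 'cV[R]_7.
have [C2 _] := coord_diff (ix 5) oT; have [C3 _] := coord_diff (ix 6) oT.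
refine (C1on_ext (fun y => esym (mxE _ _ i j)) _).
case7 i; case7 j; rewrite !ix_simpl /= /H2 /H3; solve_C1.
Qed.

(** With p and q the fifth and sixth entries of x, the direction moves H by p H + q H'. The map H ->
    H' is linear with square -1, so H' moves by p H' - q H. *)
Lemma diff_polar_frame Phi x i j :
  'd (fun Psi => polar_frame Psi i j : R) Phi (polar_frame Phi *m x) =
  (polar_frame Phi *m polar_connection x) i j.
Proof.
have oT := @openT 'cV[R]_7.
have [_ d2] := coord_diff (ix 5) oT; have [_ d3] := coord_diff (ix 6) oT.
pose v := polar_frame Phi *m x.
have dN : 'd (fun Psi : 'cV[R]_7 => - Psi (ix 5) 0) Phi v = - v (ix 5) 0.
  rewrite -(d2 Phi v) -[LHS]/('d (- (fun Psi : 'cV[R]_7 => Psi (ix 5) 0)) Phi v).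
  by rewrite (diffN (differentiable_coord Phi (ix 5) 0)).
have d0 (a : R) : 'd (fun=> a) Phi v = 0 by rewrite -[LHS]/('d (cst a) Phi v) diff_cst.
have v5 : v (ix 5) 0 = H2 Phi * x (ix 5) 0 + H3 Phi * x (ix 6) 0.
  by rewrite /v [x]vec7_eta polar_frame_mul !vec7_entries.
have v6 : v (ix 6) 0 = H3 Phi * x (ix 5) 0 - H2 Phi * x (ix 6) 0.
  by rewrite /v [x]vec7_eta polar_frame_mul !vec7_entries.
have diff_ext (p q : 'cV[R]_7 -> R) : p =1 q -> 'd p Phi v = 'd q Phi v.
  by move=> /funext ->.
have colE k : col j (polar_connection x) k 0 = polar_connection x k j by rewrite mxE.
have -> : (polar_frame Phi *m polar_connection x) i j =
    (polar_frame Phi *m col j (polar_connection x)) i 0.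
  by rewrite [LHS]mxE [RHS]mxE; apply: eq_bigr => k _; rewrite colE.
rewrite -/v; etransitivity; first exact: (diff_ext _ _ (fun Psi => mxE _ _ i j)).
rewrite [col _ _]vec7_eta !colE polar_frame_mul.
case7 j; case7 i; rewrite !vec7_entries !mxE !ix_simpl /= ?d0 ?d2 ?d3 ?dN ?v5 ?v6; ring.
Qed.

Lemma polar_connection_continuous i j : continuous (fun x => polar_connection x i j : R).
Proof.
have oT := @openT 'cV[R]_7.
have [C2 _] := coord_diff (ix 5) oT; have [C3 _] := coord_diff (ix 6) oT.
suff C : C1on setT (fun x => polar_connection x i j : R).
  by move=> x; exact: (C1on_continuous C (I : setT x)).
refine (C1on_ext (fun y => esym (mxE _ _ i j)) _).
case7 i; case7 j; rewrite !ix_simpl /=; solve_C1.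
Qed.

End frame_derivatives.

(** * Vanishing coefficients and uniform bounds *)

(** Evenness makes the derivatives along v and - v equal, while linearity of the differential makes
    them opposite. *)
Lemma derive_even (R : realType) (V : normedModType R) (f : V -> R) x v :
  differentiable f x -> (forall h : R, f (- h *: v + x) = f (h *: v + x)) -> 'D_v f x = 0.
Proof.
move=> df fE.
have E : 'D_(- v) f x = 'D_v f x.
  rewrite /derive.
  suff -> : (fun h : R => h^-1 *: ((f \o shift x) (h *: - v) - f x)) =
            (fun h : R => h^-1 *: ((f \o shift x) (h *: v) - f x)) by [].
  by apply/funext => h /=; rewrite scalerN -scaleNr fE.
have : 'D_v f x = - 'D_v f x.
  by rewrite -{1}E (deriveE (- v) df) (deriveE v df) linearN.
lra.
Qed.

Section vanishing_coefficients.
Context {R : realType} (mu0 A gamma kappa : R).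
Hypotheses (mu0_gt0 : 0 < mu0) (A_gt0 : 0 < A) (gamma_gt1 : 1 < gamma).
Implicit Types Phi v : 'cV[R]_7.
Local Notation lam := (lambda mu0 A gamma kappa).

(* The speeds depend on the magnetic field only through |H|, which is even along
   directions orthogonal to H. *)
Lemma lambda_even i Phi v (h : R) : v (ix 1) 0 = 0 -> v (ix 4) 0 = 0 -> v (ix 7) 0 = 0 ->
  H2 Phi * v (ix 5) 0 + H3 Phi * v (ix 6) 0 = 0 ->
  lam i (- h *: v + Phi) = lam i (h *: v + Phi).
Proof.
move=> v1 v4 v7 v56.
have eu : u1 (- h *: v + Phi) = u1 (h *: v + Phi) by rewrite /u1 !mxE v1 !mulr0.
have ed : dens (- h *: v + Phi) = dens (h *: v + Phi) by rewrite /dens !mxE v4 !mulr0.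
have es : entropy (- h *: v + Phi) = entropy (h *: v + Phi) by rewrite /entropy !mxE v7 !mulr0.
have eh : kappa ^+ 2 + H2 (- h *: v + Phi) ^+ 2 + H3 (- h *: v + Phi) ^+ 2 =
          kappa ^+ 2 + H2 (h *: v + Phi) ^+ 2 + H3 (h *: v + Phi) ^+ 2.
  rewrite /H2 /H3 !mxE; move: v56; rewrite /H2 /H3 => v56.
  apply/eqP; rewrite -subr_eq0; apply/eqP.
  transitivity (- 4 * h * (Phi (ix 5) 0 * v (ix 5) 0 + Phi (ix 6) 0 * v (ix 6) 0)); first by ring.
  by rewrite v56 mulr0.
have ec : sound A gamma (- h *: v + Phi) = sound A gamma (h *: v + Phi).
  by rewrite /sound /dp_dens es ed.
have eb : bquad mu0 A gamma kappa (- h *: v + Phi) = bquad mu0 A gamma kappa (h *: v + Phi).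
  by rewrite /bquad eh ed ec.
by rewrite /lambda /Cf /Cs /Ca /discr !eb !ed !ec !eu.
Qed.

Lemma u1_derive Phi v : v (ix 1) 0 = 0 -> 'D_v (@u1 R) Phi = 0.
Proof.
move=> v1; apply: derive_even; first exact: differentiable_coord.
by move=> h; rewrite /u1 !mxE v1 !mulr0.
Qed.

Lemma reig_u1 k Phi : k \in [:: ix 2; ix 4; ix 6] ->
  reig mu0 A gamma kappa k Phi (ix 1) 0 = 0.
Proof.
by rewrite !inE /reig; case: ifP => _ /or3P[] /eqP ->;
  rewrite /r_nonmagnetic /r_magnetic !ix_simpl /= vec7_entries.
Qed.

(** Two mechanisms. If kappa = 0, or i = m = 4, the speed is u1 and r_m has no u1-component.
    Otherwise m is 2 or 6, and r_m changes the magnetic field only orthogonally to H and leaves u1,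
    density and entropy fixed, so every speed is even along it. *)
Lemma c_coef_vanish i m Phi : regular mu0 A gamma (Phi, `|kappa|) ->
  differentiable (lam i) Phi ->
  (i, m) \in [:: (ix 2, ix 2); (ix 4, ix 4); (ix 6, ix 6); (ix 3, ix 2); (ix 5, ix 6)] ->
  c_coef mu0 A gamma kappa i m Phi = 0.
Proof.
move=> ry dl im; rewrite /c_coef.
have mm : m \in [:: ix 2; ix 4; ix 6].
  by move: im; rewrite !inE !xpair_eqE => /or4P[| | |/orP[]] /andP[_ ->] //; rewrite ?orbT.
have [k0|kn0] := eqVneq kappa 0.
  have nr : nbhs Phi [set Psi | regular mu0 A gamma (Psi, `|kappa|)].
    by apply: open_nbhs_nbhs; split=> //; apply: open_slice; exact: open_regular.
  rewrite -(u1_derive Phi (reig_u1 Phi mm)); apply: near_eq_derive; apply: filterS nr => Psi rPsi.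
  have a0 : `|kappa| = 0 :> R by rewrite k0 normr0.
  rewrite lambda_speed // /speed; move: im; rewrite !inE !xpair_eqE.
  by move=> /or4P[| | |/orP[]] /andP[/eqP -> _]; rewrite !ix_simpl /= ?a0 ?mulr0 ?mul0r ?subr0
    ?addr0.
have [/andP[/eqP -> /eqP ->]|im4] := boolP ((i == ix 4) && (m == ix 4)).
  have -> : lam (ix 4) = @u1 R by apply/funext => Psi; rewrite /lambda ix_simpl.
  by apply: u1_derive; apply: reig_u1; rewrite !inE eqxx orbT.
have m26 : m \in [:: ix 2; ix 6].
  move: im; rewrite !inE !xpair_eqE => /or4P[| | |/orP[]] /andP[/eqP iE /eqP mE];
    rewrite mE ?eqxx ?orbT //.
  by rewrite iE mE !eqxx in im4.
apply: derive_even => // h; apply: lambda_even; move: m26; rewrite !inE /reig (negbTE kn0);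
  move=> /orP[] /eqP ->; rewrite /r_magnetic !ix_simpl /= !vec7_entries; ring.
Qed.

End vanishing_coefficients.

(** * Compactness of the small states and positivity of the discriminant *)

Section compact_box.
Context {R : realType}.

Definition box (r : R) : set 'cV[R]_7 := [set Phi | forall j, `|Phi j 0| <= r].

Lemma box_compact r : compact (box r).
Proof.
have -> : box r = (fun v : 'rV[R]_7 => v^T) @` [set v : 'rV[R]_7 | forall i, v 0 i \in `[(- r), r]].
  apply/seteqP; split=> Phi /=.
    move=> HP; exists Phi^T; last by rewrite trmxK.
    by move=> i; rewrite mxE in_itv /= -ler_norml.
  by move=> [v Hv <-] j; rewrite mxE ler_norml; have := Hv j; rewrite in_itv.
have cT (v : 'rV[R]_7) : (fun u : 'rV[R]_7 => u^T) @ nbhs v --> v^T.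
  apply/(@cvg_mxP R _ (nbhs v)) => i j; under eq_fun do rewrite mxE; rewrite mxE.
  exact: (differentiable_continuous (differentiable_coord v j i)).
apply: continuous_compact; first exact: (continuous_subspaceT cT).
apply: (@rV_compact _ 7 (fun=> `[(- r), r]%classic)) => _; exact: segment_compact.
Qed.

Lemma enorm_box (d : R) Phi : enorm Phi <= d -> box d Phi.
Proof.
move=> H j; apply: le_trans H; rewrite -sqrtr_sqr ler_wsqrtr //.
by rewrite (bigD1 j) //= lerDl sumr_ge0 // => k _; exact: sqr_ge0.
Qed.

Lemma compact_family_bound (T : topologicalType) (I : finType) (K : set T) (f : I -> T -> R) :
  compact K -> K !=set0 -> (forall i y, K y -> {for y, continuous (f i)}) ->
  exists C, forall i y, K y -> `|f i y| <= C.
Proof.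
move=> cK K0 cf.
have [c Hc] : {c & forall i, forall y, K y -> `|f i y| <= c i}.
  apply: (@choice _ _ (fun i c => forall y, K y -> `|f i y| <= c)) => i.
  have [||y _ Hy] := @compact_EVT_max _ R (fun y => `|f i y|) K K0 => //.
    apply: continuous_in_subspaceT => y; rewrite inE => Ky.
    exact: (continuous_comp (cf i y Ky) (@norm_continuous _ _ _)).
  by exists `|f i y| => z Kz; apply: Hy; rewrite inE.
exists (\sum_i `|c i|) => i y Ky; apply: le_trans (Hc i y Ky) _.
rewrite (bigD1 i) //=; apply: le_trans (ler_norm _) _.
by rewrite lerDl sumr_ge0.
Qed.

End compact_box.

Section small_states.
Context {R : realType} (mu0 A gamma : R).
Hypotheses (mu0_gt0 : 0 < mu0) (A_gt0 : 0 < A) (gamma_gt1 : 1 < gamma).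

(** The radius is chosen so that r gamma = 1/8. Then (1 + t)^gamma >= (1 - r)^gamma >= exp(- 2 r
    gamma) >= 3/4 and exp(s) >= 1 - r >= 7/8, with product 21/32 > 1/2. *)
Lemma small_density (r t s : R) : r = (8 * gamma)^-1 -> `|t| <= r -> `|s| <= r ->
  0 < t + 1 /\ 2^-1 < expR s * (t + 1) `^ gamma.
Proof.
move=> rE tr sr.
have g0 : 0 < gamma by rewrite (lt_trans _ gamma_gt1).
have rg : r * gamma = 8^-1 by rewrite rE; field; rewrite gt_eqF.
have r0 : 0 < r by rewrite rE invr_gt0 mulr_gt0.
have r8 : r <= 8^-1 by rewrite -rg ler_peMr ?ltW.
have t1 : 1 - r <= t + 1 by move: tr; rewrite ler_norml => /andP[]; lra.
have s1 : 1 - r <= expR s.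
  apply: le_trans (expR_ge1Dx s); move: sr; rewrite ler_norml => /andP[]; lra.
have e1 : expR (- (2 * r)) <= 1 - r.
  rewrite expRN invf_ple ?posrE ?expR_gt0 //; last by lra.
  apply: le_trans (expR_ge1Dx _); rewrite -div1r ler_pdivrMr; last by lra.
  nra.
have p1 : 1 - 2 * r * gamma <= (t + 1) `^ gamma.
  have -> : 1 - 2 * r * gamma = 1 + (- (2 * r) * gamma) by ring.
  apply: le_trans (expR_ge1Dx _) _; rewrite expRM.
  apply: ge0_ler_powR; rewrite ?nnegrE ?expR_ge0 //; [exact: ltW|lra|].
  by apply: le_trans e1 t1.
split; first by lra.
have p1' : 3 / 4 <= (t + 1) `^ gamma by apply: le_trans p1; rewrite -mulrA rg; lra.
have s1' : 7 / 8 <= expR s by apply: le_trans s1; lra.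
nra.
Qed.

(** All admissible |kappa| are included at once, so a maximum over this set is uniform in kappa. The
    factor 1/4 is the [eps0] of the theorem. *)
Definition state_box : set ('cV[R]_7 * R) := [set y | box (8 * gamma)^-1 y.1 /\
  0 <= y.2 /\ y.2 ^+ 2 <= 4^-1 * Num.min (mu0^-1 * A * gamma) 1].

Lemma state_box_compact : compact state_box.
Proof.
have -> : state_box = box (8 * gamma)^-1 `*`
    `[0, Num.sqrt (4^-1 * Num.min (mu0^-1 * A * gamma) 1)].
  apply/seteqP; split=> -[Phi a] /=; rewrite in_itv /=.
    move=> [bP [a0 aM]]; split=> //; rewrite a0 /=.
    by rewrite -[a]ger0_norm // -sqrtr_sqr ler_wsqrtr.
  move=> [bP /andP[a0 aM]]; split=> //; split=> //.
  rewrite -[leRHS]sqr_sqrtr; last first.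
    rewrite mulr_ge0 // le_min ler01 andbT; apply: mulr_ge0; last by rewrite (le_trans _ (ltW
      gamma_gt1)).
    by rewrite mulr_ge0 ?invr_ge0 // ltW.
  by rewrite ler_sqr ?nnegrE ?sqrtr_ge0.
apply: compact_setX; [exact: box_compact|exact: segment_compact].
Qed.

(** By [small_density], rho c^2 exceeds A gamma / 2, while mu0 a^2 <= A gamma / 4; so the squared
    Alfven speed x stays below c^2, and the discriminant is positive even at H = 0. *)
Lemma state_box_regular : state_box `<=` regular mu0 A gamma.
Proof.
move=> [Phi a] [/= bP [a0 aM]].
have [r0 big] := small_density erefl (bP (ix 4)) (bP (ix 7)).
rewrite -/(dens Phi) -/(entropy Phi) in r0 big.
split=> //=.
have g0 : 0 < gamma by rewrite (lt_trans _ gamma_gt1).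
have rn : dens Phi != 0 by rewrite gt_eqF.
pose c2 := sound2 A gamma (Phi, a).
have c2E : c2 * dens Phi = A * gamma * (expR (entropy Phi) * dens Phi `^ gamma).
  rewrite /c2 /sound2 /= powRB; last by rewrite gt_eqF // implybT.
  by rewrite powRr1 ?ltW //; field.
pose x := mu0 * a ^+ 2 / dens Phi.
have x0 : 0 <= x by rewrite /x divr_ge0 ?mulr_ge0 ?sqr_ge0 // ltW.
have xc : x < c2.
  rewrite /x ltr_pdivrMr // c2E.
  have aA : mu0 * a ^+ 2 <= 4^-1 * (A * gamma).
    have : a ^+ 2 <= 4^-1 * (mu0^-1 * A * gamma).
      by apply: le_trans aM _; rewrite ler_wpM2l // ge_min lexx.
    move=> /(ler_wpM2l (ltW mu0_gt0)) /le_trans; apply.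
    by rewrite le_eqVlt; apply/orP; left; apply/eqP; field; rewrite gt_eqF.
  apply: le_lt_trans aA _.
  have Ag : 0 < A * gamma by rewrite mulr_gt0.
  by rewrite [ltLHS]mulrC ltr_pM2l // (lt_trans _ big) //; lra.
pose h := mu0 / dens Phi * (H2 Phi ^+ 2 + H3 Phi ^+ 2).
have h0 : 0 <= h.
  by apply: mulr_ge0; [apply: divr_ge0; exact: ltW|rewrite addr_ge0 // sqr_ge0].
(* A sum of squares and nonnegative terms obtained from (x + h + c2)^2 - 4 x c2. *)
have -> : disc mu0 A gamma (Phi, a) = (c2 - x) ^+ 2 + h ^+ 2 + 2 * h * (c2 + x).
  by rewrite /disc /bsum -/c2 /= /h /x; field.
have : 0 < (c2 - x) ^+ 2 by rewrite exprn_gt0 // subr_gt0.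
have : 0 <= h ^+ 2 by exact: sqr_ge0.
have : 0 <= 2 * h * (c2 + x) by apply: mulr_ge0; [exact: mulr_ge0|apply: addr_ge0 => //; exact:
  le_trans x0 (ltW xc)].
lra.
Qed.

End small_states.

(** * Conclusion *)

Section adapted_frames.
Context {R : realType} (mu0 A gamma : R).
Hypotheses (mu0_gt0 : 0 < mu0) (A_gt0 : 0 < A) (gamma_gt1 : 1 < gamma).
Local Notation V := ('cV[R]_7 * R)%type.
Local Notation regular := (regular mu0 A gamma).
Local Notation speed := (speed mu0 A gamma).
Implicit Types (F N : 'cV[R]_7 -> 'M[R]_7) (f : V -> 'M[R]_7).

(** The interface shared by the polar frame, for either sign of kappa, and the standard basis, so
    that bounds and extensions are proved once. *)
Record smooth_frame F N f : Prop := SmoothFrame {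
  frame_C1_coords : forall i j, C1on regular (fun y => f y i j);
  frame_coords_unit : forall y, regular y -> f y \in unitmx;
  frame_C1_basis : forall i j, C1on setT (fun Phi => F Phi i j);
  frame_connection : forall Phi x i j,
    'd (fun Psi => F Psi i j) Phi (F Phi *m x) = (F Phi *m N x) i j;
  frame_connection_continuous : forall i j, continuous (fun x => N x i j) }.

Lemma magnetic_frame sg : sg ^+ 2 = 1 ->
  smooth_frame polar_frame polar_connection (magnetic_coords mu0 A gamma sg).
Proof.
move=> sg2; split.
- exact: C1_magnetic_coords.
- by move=> y ry; exact: magnetic_coords_unit.
- exact: C1_polar_frame.
- exact: diff_polar_frame.
- exact: polar_connection_continuous.
Qed.

Lemma nonmagnetic_frame :
  smooth_frame (fun=> 1%:M) (fun=> 0) (nonmagnetic_coords mu0 A gamma).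
Proof.
split.
- exact: C1_nonmagnetic_coords.
- by move=> y ry; exact: nonmagnetic_coords_unit.
- by move=> i j; exact: (C1on_cst _ openT).
- move=> Phi x i j; rewrite mulmx0 [RHS]mxE.
  by rewrite -[LHS]/('d (cst ((1%:M : 'M[R]_7) i j)) Phi _) diff_cst.
- by move=> i j x; exact: cst_continuous.
Qed.

Lemma smooth_frame_bound F N f : smooth_frame F N f ->
  exists C, forall y, state_box mu0 A gamma y ->
    (forall i m, `|c_ext speed F f i m y| <= C) /\
    (forall i k m, `|christoffel F N f i k m y| <= C).
Proof.
case=> Cf uf CF dF cN.
have box_reg := @state_box_regular R mu0 A gamma mu0_gt0 A_gt0 gamma_gt1.
have cK := @state_box_compact R mu0 A gamma mu0_gt0 A_gt0 gamma_gt1.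
have K0 : state_box mu0 A gamma !=set0.
  exists (0, 0); split=> [j|] /=.
    by rewrite mxE normr0 invr_ge0 mulr_ge0 // (le_trans ler01) // ltW.
  rewrite lexx expr0n /= mulr_ge0 // le_min ler01 andbT.
  by rewrite !mulr_ge0 ?invr_ge0 ?ltW // (lt_trans _ gamma_gt1).
have [C1 H1] := compact_family_bound (f := fun (p : 'I_7 * 'I_7) y => c_ext speed F f p.1 p.2 y)
  cK K0 (fun p y Ky => c_ext_continuous (i := p.1) (m := p.2) (C1_speed mu0_gt0 A_gt0 gamma_gt1) Cf
    CF (box_reg y Ky)).
have [C2 H2] := compact_family_bound
  (f := fun (p : 'I_7 * 'I_7 * 'I_7) y => christoffel F N f p.1.1 p.1.2 p.2 y)
  cK K0 (fun p y Ky => christoffel_continuous (i := p.1.1) (k := p.1.2) (m := p.2) Cf uf CF cN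
    (box_reg y Ky)).
exists (Num.max C1 C2) => y Ky; split=> [i m|i k m].
  by rewrite le_max (H1 (i, m)).
by rewrite le_max (H2 (i, k, m)) ?orbT.
Qed.

(** The 2 accounts for the difference of two Christoffel terms when k = i. The bound has the factor
    speed k - speed m for every i, which gives all weak interactions alike. *)
Lemma gamma_ext_bound F N f C i k m y :
  (forall i k m, `|christoffel F N f i k m y| <= C) ->
  `|gamma_ext speed F N f i k m y| <= 2 * C * `|speed k y - speed m y|.
Proof.
move=> HC; rewrite /gamma_ext; case: eqP => [->|_].
  rewrite normrM normrN mulrC ler_wpM2r // (le_trans (ler_normB _ _)) //.
  by rewrite mulr2n mulrDl mul1r lerD.
rewrite normrM normrN mulrC ler_wpM2r // (le_trans (HC _ _ _)) //.
have : 0 <= C by apply: le_trans (HC i k m).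
lra.
Qed.

End adapted_frames.

Unset Implicit Arguments.

Theorem theorem1p1 (R : realType) :
  exists2 eps0 : R, 0 < eps0 &
  forall (mu0 A gamma : R), 0 < mu0 -> 0 < A -> 1 < gamma ->
  exists delta0 C : R, [/\ 0 < delta0, 0 < C &
  forall (kappa delta : R),
    kappa ^+ 2 <= eps0 * Num.min (mu0^-1 * A * gamma) 1 ->
    0 < delta <= delta0 ->
  let lam := lambda mu0 A gamma kappa in
  let c := c_coef mu0 A gamma kappa in
  let ball := [set Phi : 'cV[R]_7 | enorm Phi <= 2 * delta] in
  exists gam : 'I_7 -> 'I_7 -> 'I_7 -> 'cV[R]_7 -> R,
  (* the left eigenvectors are dual to the right ones *)
  (forall Phi, Phi \in ball -> frame_ok kappa Phi -> forall i j : 'I_7,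
     (leig mu0 A gamma kappa i Phi *m reig mu0 A gamma kappa j Phi) 0 0
     = (i == j)%:R) /\
  (* gam i k m is the continuous extension of gamma^i_{km} to the ball *)
  (forall i k m : 'I_7, m != i ->
     {within ball, continuous (gam i k m)} /\
     (forall Phi, Phi \in ball -> frame_ok kappa Phi ->
        gam i k m Phi = gamma_coef mu0 A gamma kappa i k m Phi)) /\
  (* the equations for rho_i, w_i, v_i *)
  (forall (T : R) (Phi : R -> R -> 'cV[R]_7) (X : 'I_7 -> R -> R -> R),
     0 < T ->
     mhd_solution mu0 A gamma kappa T Phi ->
     (forall x t, 0 <= t < T -> Phi x t \in ball) ->
     characteristics mu0 A gamma kappa T Phi X ->
     let W := w mu0 A gamma kappa Phi in
     let V := v mu0 A gamma kappa Phi X in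
     let rho := inv_density X in
     forall i : 'I_7,
     (forall z t, 0 <= t < T -> derivable (X i ^~ t) z 1) /\
     (forall x t, 0 <= t < T -> frame_ok kappa (Phi x t) ->
        is_ds mu0 A gamma kappa T Phi i (W i) x t
          (- c i i (Phi x t) * W i x t ^+ 2
           + (\sum_(m | m != i)
                (- c i m (Phi x t) + gam i i m (Phi x t)) * W m x t) * W i x t
           + \sum_(m | m != i) \sum_(k | (k != i) && (m != k))
               gam i k m (Phi x t) * W k x t * W m x t)) /\
     (forall z t, 0 <= t < T ->
        let x := X i z t in
        frame_ok kappa (Phi x t) ->
        is_ds_char T (rho i) z t
          (c i i (Phi x t) * V i z t
           + (\sum_(m | m != i) c i m (Phi x t) * W m x t) * rho i z t) /\
        is_ds_char T (V i) z t
          ((\sum_(m | m != i) gam i i m (Phi x t) * W m x t) * V i z t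
           + (\sum_(m | m != i) \sum_(k | (k != i) && (m != k))
                gam i k m (Phi x t) * W k x t * W m x t) * rho i z t))) /\
  (* all the coefficients are of order 1 *)
  (forall Phi, Phi \in ball ->
     (forall i m : 'I_7, `|c i m Phi| <= C) /\
     (forall i k m : 'I_7, m != i -> `|gam i k m Phi| <= C)) /\
  (* the structure of the coefficients *)
  (forall Phi, Phi \in ball ->
     let d23 := `|lam (ix 2) Phi - lam (ix 3) Phi| in
     let d56 := `|lam (ix 5) Phi - lam (ix 6) Phi| in
     (* (a) *)
     [/\ c (ix 2) (ix 2) Phi = 0, c (ix 4) (ix 4) Phi = 0 &
         c (ix 6) (ix 6) Phi = 0] /\
     (* (b) *)
     (c (ix 3) (ix 2) Phi = 0 /\ c (ix 5) (ix 6) Phi = 0) /\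
     (* (c) *)
     (forall i : 'I_7, i != ix 2 -> i != ix 3 ->
        `|gam i (ix 2) (ix 3) Phi| <= C * d23 /\
        `|gam i (ix 3) (ix 2) Phi| <= C * d23) /\
     (forall i : 'I_7, i != ix 5 -> i != ix 6 ->
        `|gam i (ix 5) (ix 6) Phi| <= C * d56 /\
        `|gam i (ix 6) (ix 5) Phi| <= C * d56) /\
     (* (d) *)
     [/\ `|gam (ix 2) (ix 2) (ix 3) Phi| <= C * d23,
         `|gam (ix 3) (ix 3) (ix 2) Phi| <= C * d23,
         `|gam (ix 5) (ix 5) (ix 6) Phi| <= C * d56 &
         `|gam (ix 6) (ix 6) (ix 5) Phi| <= C * d56] /\
     (`|- c (ix 3) (ix 2) Phi + gam (ix 3) (ix 3) (ix 2) Phi| <= C * d23 /\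
      `|- c (ix 5) (ix 6) Phi + gam (ix 5) (ix 5) (ix 6) Phi| <= C * d56))].
Proof.
(* Any value below the lower bound 1/2 of exp(S) rho^gamma would keep C_a < c. *)
exists 4^-1 => [|mu0 A gamma mu0_gt0 A_gt0 gamma_gt1]; first by rewrite invr_gt0.
have gamma_gt0 : 0 < gamma by rewrite (lt_trans _ gamma_gt1).
have sq1 : (1 : R) ^+ 2 = 1 by rewrite expr1n.
have sqN1 : (-1 : R) ^+ 2 = 1 by rewrite sqrrN expr1n.
(* The constants for both signs of kappa and for kappa = 0 are fixed before kappa is introduced. *)
have [C1 H1] := smooth_frame_bound mu0_gt0 A_gt0 gamma_gt1 (magnetic_frame mu0_gt0 A_gt0 gamma_gt1
  sq1).
have [C2 H2] := smooth_frame_bound mu0_gt0 A_gt0 gamma_gt1 (magnetic_frame mu0_gt0 A_gt0 gamma_gt1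
  sqN1).
have [C3 H3] := smooth_frame_bound mu0_gt0 A_gt0 gamma_gt1 (nonmagnetic_frame mu0_gt0 A_gt0
  gamma_gt1).
have box_reg := @state_box_regular R mu0 A gamma mu0_gt0 A_gt0 gamma_gt1.
have C1s := C1_speed mu0_gt0 A_gt0 gamma_gt1.
have box0 : state_box mu0 A gamma !=set0.
  exists (0, 0); split=> [j|] /=.
    by rewrite mxE normr0 invr_ge0 mulr_ge0 // ltW.
  rewrite lexx expr0n /= mulr_ge0 // le_min ler01 andbT.
  by rewrite !mulr_ge0 ?invr_ge0 ?ltW.
have [C4 H4] := compact_family_bound (f := speed mu0 A gamma)
  (state_box_compact (mu0 := mu0) (A := A) (gamma := gamma) mu0_gt0 A_gt0 gamma_gt1) box0
  (fun i y Ky => C1on_continuous (C1s i) (box_reg y Ky)).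
pose C := 1 + `|C1| + `|C2| + `|C3| + `|C4|.
have [C_ge1 C1C C2C C3C C4C] : [/\ 1 <= C, C1 <= C, C2 <= C, C3 <= C & C4 <= C].
  have := ler_norm C1; have := ler_norm C2; have := ler_norm C3; have := ler_norm C4.
  have := normr_ge0 C1; have := normr_ge0 C2; have := normr_ge0 C3; have := normr_ge0 C4.
  by rewrite /C; split; lra.
have C_gt0 : 0 < C by rewrite (lt_le_trans ltr01).
have CC : C <= C * C by rewrite ler_peMl // ltW.
(* The radius gives 2 delta <= 1 / (8 gamma), the size of [state_box]. In 4 C^2 one factor 2 C comes
   from [gamma_ext_bound] and the other bounds |lambda_k - lambda_m|; as C >= 1, the same constant
   covers the weak bounds and the c^i_{im}. *)
exists (16 * gamma)^-1, (4 * (C * C)); split; first by rewrite invr_gt0 mulr_gt0.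
  by rewrite !mulr_gt0.
move=> kappa delta kappa_small /andP[delta_gt0 delta_small] lam c ball.
have ball_box Phi : Phi \in ball -> state_box mu0 A gamma (Phi, `|kappa|).
  rewrite inE /= => HP; split=> /=.
    apply: enorm_box; apply: le_trans HP _.
    apply: le_trans (ler_wpM2l _ delta_small) _ => //.
    by rewrite le_eqVlt; apply/orP; left; apply/eqP; field; rewrite gt_eqF.
  by rewrite normr_ge0 real_normK ?num_real.
have ball_reg Phi : Phi \in ball -> regular mu0 A gamma (Phi, `|kappa|).
  by move=> /ball_box; exact: box_reg.
have [F [N [f [SF [field_reig unit_F [bound_c bound_G]]]]]] : exists F N f,
    smooth_frame mu0 A gamma F N f /\
    [/\ forall k Phi, regular mu0 A gamma (Phi, `|kappa|) ->
          reig mu0 A gamma kappa k Phi = field_of F f k (Phi, `|kappa|),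
        forall Phi, frame_ok kappa Phi -> F Phi \in unitmx &
        (forall y i m, state_box mu0 A gamma y -> `|c_ext (speed mu0 A gamma) F f i m y| <= C) /\
        (forall y i k m, state_box mu0 A gamma y -> `|christoffel F N f i k m y| <= C)].
  have [k0|kn0] := eqVneq kappa 0.
    exists (fun=> 1%:M), (fun=> 0), (nonmagnetic_coords mu0 A gamma).
    split; first exact: nonmagnetic_frame.
    split; [| |split].
    - by move=> k Phi rP; rewrite /field_of mul1mx reig_nonmagnetic.
    - by move=> Phi _; exact: unitmx1.
    - by move=> y i m /H3[H _]; exact: le_trans (H i m) C3C.
    - by move=> y i k m /H3[_ H]; exact: le_trans (H i k m) C3C.
  have sgE : Num.sg kappa = 1 \/ Num.sg kappa = -1.
    have [k|k|k] := ltgtP kappa 0; [right|left|].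
    - exact: ltr0_sg.
    - exact: gtr0_sg.
    - by rewrite k eqxx in kn0.
  exists polar_frame, polar_connection, (magnetic_coords mu0 A gamma (Num.sg kappa)).
  split; first by apply: magnetic_frame => //; case: sgE => ->.
  split; [| |split].
  - by move=> k Phi rP; rewrite reig_magnetic.
  - by move=> Phi [/eqP|]; [rewrite (negbTE kn0)|exact: polar_frame_unit].
  - move=> y i m Ky; case: sgE => ->; [case: (H1 y Ky) => H _|case: (H2 y Ky) => H _].
      exact: le_trans (H i m) C1C.
    exact: le_trans (H i m) C2C.
  - move=> y i k m Ky; case: sgE => ->; [case: (H1 y Ky) => _ H|case: (H2 y Ky) => _ H].
      exact: le_trans (H i k m) C1C.
    exact: le_trans (H i k m) C2C.
have [Cf uf CF dF cN] := SF.
have oU := @open_regular R mu0 A gamma.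
have spl i Phi : regular mu0 A gamma (Phi, `|kappa|) ->
    lambda mu0 A gamma kappa i Phi = speed mu0 A gamma i (Phi, `|kappa|).
  by move=> rP; exact: lambda_speed.
have diff_lam i Phi : Phi \in ball -> differentiable (lambda mu0 A gamma kappa i) Phi.
  by move=> /ball_reg rP; case: (C1_lambda oU C1s spl i rP).
have C1_lam i Phi v : Phi \in ball ->
    {for Phi, continuous (fun Psi => 'd (lambda mu0 A gamma kappa i) Psi v)}.
  by move=> /ball_reg rP; case: (C1_lambda oU C1s spl i rP) => _; exact.
have bound_lam i Phi : Phi \in ball -> `|lambda mu0 A gamma kappa i Phi| <= C.
  move=> BP; rewrite spl; last exact: ball_reg.
  exact: le_trans (H4 i _ (ball_box _ BP)) C4C.
have diff_r k j Phi : Phi \in ball ->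
    differentiable (fun Psi => reig mu0 A gamma kappa k Psi j 0) Phi.
  by move=> /ball_reg rP; case: (C1_reig oU Cf CF field_reig k j rP).
have unit_frame Phi : Phi \in ball -> frame_ok kappa Phi -> frame_mx mu0 A gamma kappa Phi \in
  unitmx.
  by move=> /ball_reg rP ok; exact: (frame_mx_unit uf field_reig unit_F rP ok).
have eigen k Phi : Phi \in ball -> mhd_matrix mu0 A gamma kappa Phi *m reig mu0 A gamma kappa k Phi
  =
    lambda mu0 A gamma kappa k Phi *: reig mu0 A gamma kappa k Phi.
  by move=> /ball_reg rP; exact: eigen_fields.
(* Where the dual frame fails, [gamma_coef] is built from a meaningless [leig]; the extension at a =
   |kappa| replaces it. *)
pose gam i k m Phi := gamma_ext (speed mu0 A gamma) F N f i k m (Phi, `|kappa|).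
have gamE i k m Phi : Phi \in ball -> frame_ok kappa Phi ->
    gamma_coef mu0 A gamma kappa i k m Phi = gam i k m Phi.
  move=> /ball_reg rP ok.
  exact: (gamma_coefE oU Cf uf CF dF field_reig spl unit_F i k m rP ok).
have gam_le i k m Phi : Phi \in ball ->
    `|gam i k m Phi| <= 2 * C * `|lam k Phi - lam m Phi|.
  move=> BP; rewrite /lam !spl; try exact: ball_reg.
  by apply: gamma_ext_bound => i' k' m'; apply: bound_G; exact: ball_box.
have gam_weak i k m Phi : Phi \in ball ->
    `|gam i k m Phi| <= 4 * (C * C) * `|lam k Phi - lam m Phi|.
  move=> BP; apply: le_trans (gam_le i k m Phi BP) _.
  by rewrite ler_wpM2r //; move: C_gt0 CC; lra.
have c_vanish i m Phi : Phi \in ball ->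
    (i, m) \in [:: (ix 2, ix 2); (ix 4, ix 4); (ix 6, ix 6); (ix 3, ix 2); (ix 5, ix 6)] ->
    c i m Phi = 0.
  move=> BP im; apply: c_coef_vanish => //; [exact: ball_reg|exact: diff_lam].
exists gam; split; [|split; [|split; [|split]]].
- by move=> Phi BP ok i j; exact: (leig_dual unit_frame i j BP ok).
- move=> i k m mi; split; last by move=> Phi BP ok; rewrite gamE.
  apply: continuous_in_subspaceT => Phi BP.
  have cp : {for Phi, continuous (fun Psi : 'cV[R]_7 => (Psi, `|kappa|))}.
    have c1 : {for Phi, continuous (@id 'cV[R]_7)} by exact: cvg_id.
    have c2 : {for Phi, continuous (fun _ : 'cV[R]_7 => `|kappa|)} by exact: cst_continuous.
    exact: continuous_pairing c1 c2.
  have cg := gamma_ext_continuous (i := i) (k := k) (m := m) C1s Cf uf CF cN (ball_reg Phi BP).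
  exact: continuous_comp cp cg.
- move=> T Phi X T_gt0 sol inB charX W V rho i.
  have sumE x t : 0 <= t < T -> frame_ok kappa (Phi x t) ->
      \sum_(m | m != i) \sum_(k | (k != i) && (m != k)) gam i k m (Phi x t) * W k x t * W m x t =
      \sum_(m | m != i) \sum_(k | (k != i) && (m != k))
        gamma_coef mu0 A gamma kappa i k m (Phi x t) * W k x t * W m x t.
    move=> tT ok; apply: eq_bigr => m _; apply: eq_bigr => k _.
    by rewrite (gamE i k m _ (inB x t tT) ok).
  split; [|split].
  + move=> z t tT.
    by case: (characteristic_rates diff_lam C1_lam bound_lam diff_r unit_frame eigen sol inB charX
      i z tT).
  + move=> x t tT ok.
    have [gt [gx [dt dx E _]]] := wave_rates diff_lam diff_r unit_frame eigen sol inB i tT ok.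
    exists gt, gx; split=> //; rewrite E sumE //; congr (_ + _ * _ + _).
    by apply: eq_bigr => m _; rewrite (gamE i i m _ (inB x t tT) ok).
  + move=> z t tT x ok.
    have [_ /(_ ok)[drho dV]] := characteristic_rates diff_lam C1_lam bound_lam diff_r unit_frame
      eigen sol inB charX i z tT.
    split; first exact: drho.
    rewrite sumE //.
    have -> : \sum_(m | m != i) gam i i m (Phi x t) * W m x t =
        \sum_(m | m != i) gamma_coef mu0 A gamma kappa i i m (Phi x t) * W m x t.
      by apply: eq_bigr => m _; rewrite (gamE i i m _ (inB x t tT) ok).
    exact: dV.
- move=> Phi BP; split=> [i m|i k m _].
    rewrite /c (c_coefE oU C1s field_reig spl i m (ball_reg Phi BP)).
    apply: le_trans (bound_c _ i m (ball_box Phi BP)) _.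
    by move: C_gt0 CC; lra.
  apply: le_trans (gam_le i k m Phi BP) _.
  have : `|lam k Phi - lam m Phi| <= 2 * C.
    rewrite (le_trans (ler_normB _ _)) // mulr2n mulrDl mul1r lerD //; exact: bound_lam.
  have C20 : 0 <= 2 * C by rewrite mulr_ge0 // ltW.
  move=> /(ler_wpM2l C20) /le_trans; apply.
  by rewrite le_eqVlt; apply/orP; left; apply/eqP; ring.
- move=> Phi BP d23 d56.
  have d32 : d23 = `|lam (ix 3) Phi - lam (ix 2) Phi| by rewrite /d23 distrC.
  have d65 : d56 = `|lam (ix 6) Phi - lam (ix 5) Phi| by rewrite /d56 distrC.
  have c32 : c (ix 3) (ix 2) Phi = 0 by apply: c_vanish => //; rewrite !inE eqxx ?orbT.
  have c56 : c (ix 5) (ix 6) Phi = 0 by apply: c_vanish => //; rewrite !inE eqxx ?orbT.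
  have g23 i : `|gam i (ix 2) (ix 3) Phi| <= 4 * (C * C) * d23 by exact: gam_weak.
  have g32 i : `|gam i (ix 3) (ix 2) Phi| <= 4 * (C * C) * d23 by rewrite d32; exact: gam_weak.
  have g56 i : `|gam i (ix 5) (ix 6) Phi| <= 4 * (C * C) * d56 by exact: gam_weak.
  have g65 i : `|gam i (ix 6) (ix 5) Phi| <= 4 * (C * C) * d56 by rewrite d65; exact: gam_weak.
  split; first by split; apply: c_vanish => //; rewrite !inE eqxx ?orbT.
  split; first by [].
  split; first by move=> i _ _; split.
  split; first by move=> i _ _; split.
  split; first by split.
  by rewrite c32 c56 oppr0 !add0r; split.
Qed.
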